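(* Let $\mathcal{A}=\{a_0,\dots,a_{n+1}\}\subset\mathbb{Z}^n$ be a circuit, let $\{K_0,\dots,K_{k-1}\}$ be a partition of $[n+2]$, and let $\bar\sigma:[k]\to K$ be any bijection, where $K$ is any set of representatives of $K_0,\dots,K_{k-1}$. Let $b_j=(-1)^j\det A(j)$ for $j=0,\dots,n+1$, and let $\mu=(\mu_0,\dots,\mu_{k-1})$ be the sequence $\mu_\ell=\sum_{j\in K_{\bar\sigma_0}\cup\dots\cup K_{\bar\sigma_\ell}}b_j$, where $K_{\bar\sigma_i}$ is the block containing $\bar\sigma_i$. Assume that $\mu$ is not identically zero, and let $\ell_0<\ell_1<\dots<\ell_m$ be its indices of sign changes (so $m=\operatorname{sgnvar}(\mu)$). Then there exist matrices $C=(c_{i,j})$ and $H=(h_{i,j})$ in $\mathbb{R}^{n\times(n+2)}$ such that, with $\mathcal{A}_i=\{a_j\in\mathcal{A}: c_{i,j}\ne0\}$, the regular mixed subdivision of $\mathcal{A}_1+\dots+\mathcal{A}_n$ associated to $H$ contains precisely $m+1$ mixed cells $Z_0,\dots,Z_m$ positively decorated by $C$, with Euclidean volumes $\operatorname{vol}(Z_s)=|\mu_{\ell_s}|$ for $s=0,\dots,m$. Moreover, for any real number $t$ with $0<t<1$, the matrix $C_t=(c_{i,j}t^{h_{i,j}})$ has maximal rank, satisfies that the origin lies in $\mathbb{R}_{>0}(C_t)_0+\dots+\mathbb{R}_{>0}(C_t)_{n+1}$ (where $(C_t)_j$ denotes the $j$th column of $C_t$), and $\bar\sigma$ is a strict ordering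 for $C_t$. Furthermore, there exists $t_0>0$ such that for any $t$ with $0<t<t_0$ the Viro polynomial system $$\sum_{j=0}^{n+1}c_{i,j}\,t^{h_{i,j}}\,x^{a_j}=0,\qquad i=1,\dots,n,$$ satisfies $n_{\mathcal{A}}(C_t)=1+\operatorname{sgnvar}(\mu)$. If, in addition, $m=n$, then $\sum_{s=0}^{n}\operatorname{vol}(Z_s)=n!\operatorname{vol}(\mathcal{A})$, where $\operatorname{vol}(\mathcal{A})$ is the Euclidean volume of the convex hull of $\mathcal{A}$.
   Context: Notation: $[s]=\{0,1,\dots,s-1\}$. For a finite real sequence $c=(c_0,\dots,c_r)$, $\operatorname{sgnvar}(c)$ is the number of pairs $i<j$ with $c_ic_j<0$ and $c_\ell=0$ for all $i<\ell<j$. For a sequence $\mu=(\mu_0,\dots,\mu_{k-1})$ with $\operatorname{sgnvar}(\mu)=m$, the indices of sign changes $\ell_0<\dots<\ell_m$ are defined recursively by $\ell_0=\min\{\ell:\mu_\ell\ne0\}$ and $\ell_i=\min\{\ell\in\{\ell_{i-1},\dots,k-1\}:\mu_\ell\,\mu_{\ell_{i-1}}<0\}$. Let $\mathcal{A}=\{a_0,\dots,a_{n+1}\}\subset\mathbb{Z}^n$ be an ordered set of cardinality $n+2$ whose convex hull has dimension $n$, and let $A\in\mathbb{Z}^{(n+1)\times(n+2)}$ be the matrix with columns $(1,a_j)$. $A(j)$ is the square matrix obtained from $A$ by deleting the column indexed by $j$. $\mathcal{A}$ is a circuit if it is minimally affinely dependent, i.e. all $b_j=(-1)^j\det A(j)$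 are nonzero; the vector $(b_0,\dots,b_{n+1})^\top$ spans $\ker A$. For $C=(c_{i,j})\in\mathbb{R}^{n\times(n+2)}$ (columns indexed by $[n+2]$), $n_{\mathcal{A}}(C)$ denotes the number of solutions in $\mathbb{R}_{>0}^n$, counted with multiplicity, of the system $\sum_{j=0}^{n+1}c_{i,j}x^{a_j}=0$, $i=1,\dots,n$. Strict ordering: let $C'\in\mathbb{R}^{n\times(n+2)}$ have rank $n$ with the origin in the sum $\mathbb{R}_{>0}C'_0+\dots+\mathbb{R}_{>0}C'_{n+1}$ of the open rays of its columns. Let $P\in\mathbb{R}^{(n+2)\times2}$ have columns forming a basis of $\ker C'$, with rows $P_0,\dots,P_{n+1}$. Let $\sim$ be the equivalence relation on $[n+2]$ given by $i\sim j\iff\det(P_i,P_j)=0$. Given a partition $\{K_0,\dots,K_{k-1}\}$ of $[n+2]$ and a set $K$ of representatives of its blocks, a bijection $\bar\sigma:[k]\to K$ is a strict ordering for $C'$ if the equivalence classes of $\sim$ are exactly $K_0,\dots,K_{k-1}$ and there is $\epsilon\in\{-1,1\}$ with $\epsilon\det(P_{\bar\sigma_i},P_{\bar\sigma_j})>0$ for all $i<j$ (this does not depend on the choice of $P$). Mixed subdivisions: $H$ lifts the point $a_j\in\mathcal{A}_i$ to height $h_{i,j}$, and so defines (by projecting the lower hull) a regular subdivision of the Cayley configuration $\mathcal{A}_1*\cdots*\mathcal{A}_n$ and, via the Cayley trick, a regular mixed subdivision of the Minkowski sum $\mathcal{A}_1+\dots+\mathcal{A}_n$. Explicitly, its full-dimensional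 cells are the $n$-dimensional sums $\sigma_1+\dots+\sigma_n$ where, for some $z\in\mathbb{R}^n$, $\sigma_i$ is the set of $a_j\in\mathcal{A}_i$ minimizing $\langle z,a_j\rangle+h_{i,j}$ over $\mathcal{A}_i$. Such a cell is mixed if every $\sigma_i$ is a segment (consists of exactly two points); its Euclidean volume is that of its convex hull. A mixed cell with $\sigma_i=\{a_{i_1},a_{i_2}\}$ is positively decorated by $C$ if $c_{i,i_1}c_{i,i_2}<0$ for every $i=1,\dots,n$. *)

(* Defs.v *)
From HB Require Import structures.
From mathcomp Require Import all_boot all_order all_algebra.
From mathcomp Require mpoly.
(* the notations of mpoly clash with those of mathcomp-analysis *)
Import -(notations) mpoly.
From mathcomp Require Import all_classical all_reals all_analysis.
Import Order.TTheory GRing.Theory Num.Theory.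
Import numFieldNormedType.Exports.

Set Implicit Arguments.
Unset Strict Implicit.
Unset Printing Implicit Defensive.

Local Open Scope classical_set_scope.
Local Open Scope ring_scope.

Section SignVariation.
Variable T : realDomainType.

Definition sgnvar (c : seq T) : nat :=
  #|[set ij : 'I_(size c) * 'I_(size c) |
      [&& (ij.1 < ij.2)%N, c`_ij.1 * c`_ij.2 < 0 &
          [forall l : 'I_(size c), (ij.1 < l < ij.2)%N ==> (c`_l == 0)]]]%SET|.

Fixpoint sign_change_index (c : seq T) (i : nat) : nat :=
  match i with
  | 0 => find (fun x => x != 0) c
  | i'.+1 => let l := sign_change_index c i' in
             (l + find (fun x => (x * c`_l < 0)%R) (drop l c))%N
  end.

End SignVariation.

(* dimension of the affine hull (equivalently, of the convex hull) of a
   nonempty finite list of points *)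
Definition affdim (R : fieldType) (n : nat) (s : seq 'rV[R]_n) : nat :=
  \rank (\matrix_(i < size s) (s`_i - s`_0)).

Definition convex_hull (R : realType) (n : nat) (s : seq 'rV[R]_n) :
    set 'rV[R]_n :=
  [set x | exists w : 'I_(size s) -> R,
     [/\ forall i, 0 <= w i, \sum_i w i = 1 & x = \sum_i w i *: s`_i]].

Section LebesgueMeasureRn.
Variable R : realType.
Local Notation MR := (measurableTypeR R).

Definition tcons n (p : MR * n.-tuple MR) : n.+1.-tuple MR :=
  [tuple of p.1 :: p.2].

Lemma measurable_tcons n : measurable_fun setT (@tcons n).
Proof. exact: (measurable_cons measurable_fst measurable_snd). Qed.

Section step.
Variables (n : nat) (mu : {sigma_finite_measure set (n.-tuple MR) -> \bar R}).

Definition leb_step : set (n.+1.-tuple MR) -> \bar R :=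
  pushforward (@lebesgue_measure R \x mu)%E (@tcons n).

(* the instance is named because it cannot infer the measurability of tcons *)
HB.instance Definition _ := Measure.copy leb_step
  (measure_function_pushforward__canonical__measure_function_Measure
     (@lebesgue_measure R \x mu)%E (@measurable_tcons n)).

Let leb_step_sigma_finite : sigma_finite setT leb_step.
Proof.
have /sigma_finiteP[F [FT ndF mF]] := sigma_finiteT (@lebesgue_measure R).
have /sigma_finiteP[G [GT ndG mG]] := sigma_finiteT mu.
pose g (t : n.+1.-tuple MR) : (MR * n.-tuple MR)%type :=
  (thead t, [tuple of behead t]).
have mg : measurable_fun setT g.
  apply: measurable_fun_pair; last exact: measurable_behead.
  exact: (@measurable_tnth _ MR n.+1 ord0).
have gK : cancel (@tcons n) g by move=> [x t]; congr pair; exact: val_inj.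
exists (fun i => g @^-1` (F i `*` G i)).
  rewrite -preimage_bigcup -(preimage_setT g); congr preimage.
  apply/esym; rewrite -subTset => -[x y] _.
  have [k _ Fkx] : (\bigcup_i F i) x by rewrite -FT.
  have [l _ Gly] : (\bigcup_i G i) y by rewrite -GT.
  exists (maxn k l) => //; split.
    by move: (x) Fkx; exact/subsetPset/ndF/leq_maxl.
  by move: (y) Gly; exact/subsetPset/ndG/leq_maxr.
move=> i; have [mFi Foo] := mF i; have [mGi Goo] := mG i; split.
  by rewrite -[X in measurable X]setTI; apply: mg => //; exact: measurableX.
rewrite /leb_step /pushforward -comp_preimage (_ : g \o _ = id); last first.
  exact/funext.
by rewrite preimage_id product_measure1E// lte_mul_pinfty// ge0_fin_numE.
Qed.

HB.instance Definition _ :=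
  Measure_isSigmaFinite.Build _ _ _ leb_step leb_step_sigma_finite.

End step.

(* Lebesgue measure on R^n, as the n-fold product of Lebesgue measure on R *)
Fixpoint lebesgue_tuple n : {sigma_finite_measure set (n.-tuple MR) -> \bar R} :=
  match n with
  | 0 => @dirac _ (0.-tuple MR) [tuple] R
  | n'.+1 => leb_step (lebesgue_tuple n')
  end.

Definition volume n (S : set 'rV[R]_n) : \bar R :=
  lebesgue_tuple n [set t | S (\row_i tnth t i)].

End LebesgueMeasureRn.

Section Circuit.
Variables (n : nat) (a : 'I_n.+2 -> 'rV[int]_n).

Definition config_matrix : 'M[int]_(n.+1, n.+2) :=
  \matrix_(i, j) (col_mx (1%:M : 'M[int]_1) (a j)^T) i ord0.

Definition affine_relation (j : 'I_n.+2) : int :=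
  (-1) ^+ j * \det (col' j config_matrix).

Variable R : realType.

Definition real_point (j : 'I_n.+2) : 'rV[R]_n := map_mx intr (a j).

(* Minimal affine dependence is stated through the maximal minors. Injectivity
   says that the configuration has n + 2 elements; it rules out n = 0. *)
Definition circuit : Prop :=
  [/\ injective a, affdim (codom real_point) = n &
      forall j, affine_relation j != 0].

End Circuit.

Definition partial_sums (n k : nat) (b : 'I_n.+2 -> int)
    (Kp : {set {set 'I_n.+2}}) (sbar : 'I_k -> 'I_n.+2) : seq int :=
  [seq \sum_(j in (\bigcup_(i < k | (i <= l)%N) finset.pblock Kp (sbar i))%SET) b j
    | l : 'I_k <- enum 'I_k].

Section StrictOrdering.
Variables (R : realType) (n : nat).

Definition zero_in_open_cone (C : 'M[R]_(n, n.+2)) : Prop :=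
  exists w : 'I_n.+2 -> R,
    (forall j, 0 < w j) /\ \sum_j w j *: col j C = 0.

Definition kernel_basis (C : 'M[R]_(n, n.+2)) (P : 'M[R]_(n.+2, 2)) : Prop :=
  forall v : 'cV[R]_n.+2, C *m v = 0 <-> exists! w : 'cV[R]_2, v = P *m w.

Definition det_rows (P : 'M[R]_(n.+2, 2)) (i j : 'I_n.+2) : R :=
  \det (col_mx (row i P) (row j P) : 'M[R]_2).

(* The rank of C and [zero_in_open_cone C] are not repeated here: they are
   standing assumptions under which [P] exists, has no zero row, and the
   relation [det_rows P i j == 0] is an equivalence. Two choices of P differ by
   an invertible 2 x 2 factor, so the condition does not depend on P. *)
Definition strict_ordering (C : 'M[R]_(n, n.+2)) (Kp : {set {set 'I_n.+2}})
    (k : nat) (sbar : 'I_k -> 'I_n.+2) : Prop :=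
  exists P : 'M[R]_(n.+2, 2),
    [/\ kernel_basis C P,
        equivalence_partition (fun i j => det_rows P i j == 0)
          [set: 'I_n.+2]%SET = Kp &
        exists2 eps : R, eps = 1 \/ eps = -1 &
          forall i j : 'I_k, (i < j)%N ->
            0 < eps * det_rows P (sbar i) (sbar j)].

End StrictOrdering.

(* A cell sigma_1 + ... + sigma_n is recorded by its labels: the i-th component
   is the set of indices j with a_j in sigma_i. Full-dimensional cells with
   distinct labels have disjoint interiors, so counting labels counts cells. *)
Definition cell_label (n : nat) : finType := {ffun 'I_n -> {set 'I_n.+2}}.

Section MixedSubdivision.
Variables (R : realType) (n : nat) (a : 'I_n.+2 -> 'rV[int]_n).
Implicit Types (C H : 'M[R]_(n, n.+2)) (sigma : cell_label n).

Definition support_set C (i : 'I_n) : {set 'I_n.+2} :=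
  [set j | C i j != 0]%SET.

Definition lifted_height H (z : 'rV[R]_n) (i : 'I_n) (j : 'I_n.+2) : R :=
  (z *m (real_point a R j)^T) ord0 ord0 + H i j.

Definition minimizers C H z (i : 'I_n) : {set 'I_n.+2} :=
  [set j in support_set C i |
    [forall k in support_set C i,
       lifted_height H z i j <= lifted_height H z i k]]%SET.

Definition minkowski_points sigma : seq 'rV[R]_n :=
  [seq \sum_i real_point a R (p i)
    | p : {ffun 'I_n -> 'I_n.+2} in family (fun i => mem (sigma i))].

Definition full_cell C H sigma : Prop :=
  (exists z, forall i, sigma i = minimizers C H z i) /\
  affdim (minkowski_points sigma) = n.

Definition mixed sigma : Prop := forall i, #|sigma i| = 2.

Definition positively_decorated C sigma : Prop :=
  forall i, {in sigma i &, forall j j', j != j' -> C i j * C i j' < 0}.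

Definition decorated_mixed_cell C H sigma : Prop :=
  [/\ full_cell C H sigma, mixed sigma & positively_decorated C sigma].

Definition cell_volume sigma : \bar R :=
  volume (convex_hull (minkowski_points sigma)).

End MixedSubdivision.

Section Multiplicity.
Variables (R : realType) (n : nat).
Local Notation F := {fraction (mpoly n R)}.

Definition const_frac (c : R) : F := FracField.tofrac (mpolyC n c).

Definition laurent_monomial (e : 'rV[int]_n) : F :=
  \prod_(l < n) FracField.tofrac (mpolyX R (mnm1 l)) ^ e ord0 l.

Definition local_ring (x : 'rV[R]_n) : set F :=
  [set u | exists p q : mpoly n R,
     meval (x ord0) q != 0 /\
     u = FracField.tofrac p / FracField.tofrac q].

Definition local_ideal (x : 'rV[R]_n) (f : 'I_n -> F) : set F :=
  [set u | exists2 v : 'I_n -> F,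
     forall i, local_ring x (v i) & u = \sum_i v i * f i].

(* [local_multiplicity x f d]: the quotient of the local ring at x by the ideal
   generated by f_1, ..., f_n has dimension d over R; x being a real point, this
   is also the complex dimension of the local ring of the system over C. Laurent
   monomials belong to the local ring at any x with nonzero coordinates. *)
Definition local_multiplicity (x : 'rV[R]_n) (f : 'I_n -> F) (d : nat) : Prop :=
  exists2 e : 'I_d -> F, forall k, local_ring x (e k) &
    forall u, local_ring x u ->
      exists! c : 'rV[R]_d,
        local_ideal x f (u - \sum_k const_frac (c ord0 k) * e k).

Variable a : 'I_n.+2 -> 'rV[int]_n.
Implicit Type C : 'M[R]_(n, n.+2).

Definition system_poly C (i : 'I_n) : F :=
  \sum_j const_frac (C i j) * laurent_monomial (a j).

Definition positive_solution C (x : 'rV[R]_n) : Prop :=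
  (forall l, 0 < x ord0 l) /\
  forall i, \sum_j C i j * \prod_(l < n) x ord0 l ^ a j ord0 l = 0.

(* [num_positive_solutions C N]: n_A(C) is finite and equal to N *)
Definition num_positive_solutions C (N : nat) : Prop :=
  exists (s : seq 'rV[R]_n) (d : 'rV[R]_n -> nat),
    [/\ uniq s,
        forall x, x \in s <-> positive_solution C x,
        forall x, x \in s -> local_multiplicity x (system_poly C) (d x) &
        N = (\sum_(x <- s) d x)%N].

End Multiplicity.

Definition viro_matrix (R : realType) (n : nat) (C H : 'M[R]_(n, n.+2)) (t : R) :
    'M[R]_(n, n.+2) :=
  \matrix_(i, j) (C i j * t `^ H i j).

(* Main.v *)
Require Import Defs.
From HB Require Import structures.
From mathcomp Require Import all_boot all_order fingroup perm all_algebra.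
From mathcomp Require mpoly.
Import -(notations) mpoly.
From mathcomp Require Import all_classical all_reals all_analysis.
From mathcomp Require Import measurable_realfun lebesgue_integral_nonneg.
From mathcomp Require Import zify ring lra.
Import Order.TTheory GRing.Theory Num.Theory.
Import numFieldNormedType.Exports.

Set Implicit Arguments.
Unset Strict Implicit.
Unset Printing Implicit Defensive.

Local Open Scope classical_set_scope.
Local Open Scope ring_scope.

(** Write l(j) for the position of the block of j, 0 <= l(j) <= K+1 with
k = K+2, let r0 and r1 represent the first and the last block, let b be the
affine relation and D_l = M^l with M = sum |b_j| + 2.  The matrix C_t is built
from its kernel, which consists of the vectors

  v_j = g_j (alpha_j u + beta_j v),   g_j = t^(kappa b_j),

where (alpha_j, beta_j) is (1, 0) in the first block, (0, 1) in the last one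
and (1, t^(-D_l(j))) in between, and where g_j is replaced by 1 at the two
roots r0 and r1.  Each row of C_t expresses the coordinate of one index rho_i
other than r0 and r1 in terms of u = v_r0 and v = v_r1, so that C_t has entries
in the columns rho_i, r0, r1 only.  The vectors (alpha_j, beta_j) turn
monotonically with l(j), which is the strict ordering; u = v = 1 shows that 0
lies in the open cone of the columns.

Positive solutions.  As b spans the affine relations, a positive vector is
proportional to the vector of monomials (x^(a_j)) of a point x, and then of one
point only, if and only if sum b_j ln v_j = 0.  Hence the positive solutions
correspond to the positive zeros y = u/v of

  G(y) = sum b_j ln (alpha_j y + beta_j) - L kap,   L = - ln t.

On the scale y = e^(L w), G/L is uniformly close to the piecewise linear
function f(w) = sum b_j max(w, D_l(j)) - kap, where the maximum is w in the
first block and 0 in the last one; its slope on the piece [D_l, D_(l+1)] is the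
partial sum mu_l.  The constant kap = kappa sum b_rho_i^2, contributed by the
factors g_j, is chosen to make f vanish at distance one from the right end of the
first piece of nonzero slope.  The next pieces grow so fast that f has at D_(l+1)
the sign of the last nonzero slope; thus f crosses zero exactly on the pieces where mu changes sign, transversally, and
stays away from zero on the others ([small_value], [crossing_window]).  For L
large, G inherits one zero per crossing piece ([logsum_zeros]).  These zeros
are simple, so the Jacobian matrix of the system is invertible there, and
Cramer's rule writes the local parameters in terms of the equations: the
multiplicity is one ([nondegenerate_multiplicity]).

Cells.  Minimizing <z, a_j> + h_(i,j) for all i simultaneously is the tropical
version of the same elimination: if z selects a decorated mixed cell, then
w = <z, a_r1> - <z, a_r0> is a zero of f, every zero of f arises in this way, and
rho_i is joined to r0 if D_l(rho_i) < w and to r1 otherwise ([decorated_cells]).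
Such a cell is a parallelepiped, whose edges form a forest with two trees; their
determinant is, up to sign, the sum of the b_j over the tree of r0, that is mu_l
([det_forest]).

Case m = n.  All blocks are then singletons and all the mu_l alternate in sign,
so sum |mu_l| is half of sum |b_j|, that is the sum of the positive b_j.  This
is n! vol(A), because the simplices obtained by omitting one a_j with b_j > 0
tile the hull of the circuit and have volume |b_j| / n!
([volume_circuit_hull]). *)

(** * Lebesgue measure under affine maps *)

Section Scaling.
Variable R : realType.
Local Notation MR := (measurableTypeR R).

(** The hypothesis says that [mu] is [r] times its push-forward by [phi], so
integrals scale like the measures of sets. *)
Lemma scaled_integral d (T : measurableType d)
    (mu : {measure set T -> \bar R}) (phi : T -> T) (r : R) (h : T -> \bar R) :
  measurable_fun setT phi -> 0 <= r ->
  (forall S, measurable S -> (r%:E * mu (phi @^-1` S) = mu S)%E) ->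
  measurable_fun setT h -> (forall x, 0 <= h x)%E ->
  (r%:E * \int[mu]_x h (phi x) = \int[mu]_x h x)%E.
Proof.
move=> mphi r0 scale mh h0.
pose P := measure_function_pushforward__canonical__measure_function_Measure mu mphi.
have -> : (\int[mu]_x h x = \int[mscale (NngNum r0) P]_x h x)%E.
  by apply: eq_measure_integral => A mA _; rewrite -scale.
rewrite ge0_integral_mscale//; congr (_ * _)%E; apply/esym.
exact: (ge0_integral_pushforward mphi mu measurableT mh (fun y _ => h0 y)).
Qed.

(** Lebesgue measure is determined by its values on half-open intervals, where
the scaling rule is an explicit computation. *)
Lemma lebesgue_measure_affine (m c : R) (S : set MR) : m != 0 -> measurable S ->
  (`|m|%:E * lebesgue_measure ((fun x : MR => (x * m + c)%R : MR) @^-1` S) =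
   lebesgue_measure S)%E.
Proof.
move=> m0 mS; apply/esym.
pose phi (x : MR) : MR := x * m + c.
have mphi : measurable_fun setT phi by apply: measurable_funD => //; exact: measurable_funM.
pose P := measure_function_pushforward__canonical__measure_function_Measure
  (@lebesgue_measure R) mphi.
apply: (@lebesgue_measure_unique R (mscale (NngNum (normr_ge0 m)) P)) => //.
move=> _ [[a b] _ <-] /=; rewrite /mscale /= /pushforward.
rewrite lebesgue_measure_itv /=.
have [mp|mn] := ltP 0 m.
  have -> : phi @^-1` `]a, b]%classic = `](a - c) / m, (b - c) / m]%classic.
    apply/seteqP; split => x; rewrite /= !in_itv /= /phi ltr_pdivrMr// ler_pdivlMr//; lra.
  rewrite lebesgue_measure_itv /= !lte_fin ltr_pM2r ?invr_gt0// ltrD2r.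
  case: ifP => _; last by rewrite mule0.
  by rewrite -!EFinB -EFinM gtr0_norm//; congr (_%:E); field; rewrite gt_eqF.
have {}mn : m < 0 by rewrite lt_neqAle m0.
have -> : phi @^-1` `]a, b]%classic = `[(b - c) / m, (a - c) / m[%classic.
  apply/seteqP; split => x; rewrite /= !in_itv /= /phi ltr_ndivlMr// ler_ndivrMr//; lra.
rewrite lebesgue_measure_itv /= !lte_fin ltr_nM2r ?invr_lt0// ltrD2r.
case: ifP => _; last by rewrite mule0.
by rewrite -!EFinB -EFinM ltr0_norm//; congr (_%:E); field; rewrite lt_eqF.
Qed.
End Scaling.

Section LebesgueTuple.
Variable R : realType.
Local Notation MR := (measurableTypeR R).
Local Notation lambda := (@lebesgue_tuple R).

Definition tuple_row n (t : n.-tuple MR) : 'rV[R]_n := \row_i tnth t i.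
Definition row_tuple n (v : 'rV[R]_n) : n.-tuple MR := [tuple v 0 i | i < n].

Lemma tuple_rowK n : cancel (@tuple_row n) (@row_tuple n).
Proof. by move=> t; apply/eq_from_tnth => i; rewrite tnth_mktuple mxE. Qed.

Lemma row_tupleK n : cancel (@row_tuple n) (@tuple_row n).
Proof. by move=> v; apply/rowP => i; rewrite mxE tnth_mktuple. Qed.

Lemma tuple_row_tcons n (x : MR) (y : n.-tuple MR) :
  tuple_row (tcons (x, y)) = (row_mx (x%:M : 'M[R]_1) (tuple_row y) : 'rV[R]_(1 + n)).
Proof.
apply/rowP => i; rewrite !mxE; case: split_ordP => j ->.
  by rewrite ord1 mxE eqxx mulr1n (tnth_nth x).
by rewrite mxE !(tnth_nth x).
Qed.

Lemma row_tuple_block n (x : R) (v : 'rV[R]_n) :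
  row_tuple (row_mx (x%:M : 'M[R]_1) v : 'rV[R]_(1 + n)) = tcons (x : MR, row_tuple v).
Proof. by apply: (can_inj (@tuple_rowK _)); rewrite row_tupleK tuple_row_tcons row_tupleK. Qed.

Definition affine n (M : 'M[R]_n) (c : 'rV[R]_n) (t : n.-tuple MR) : n.-tuple MR :=
  row_tuple (tuple_row t *m M + c).

Lemma measurable_affine n (M : 'M[R]_n) c : measurable_fun setT (affine M c).
Proof.
apply/measurable_fun_tnthP => i.
have -> : (@tnth n MR ^~ i \o affine M c) =
   (fun t : n.-tuple MR => ((\sum_j tnth t j * M j i) + c 0 i)%R : MR).
  apply/funext => t /=; rewrite tnth_mktuple !mxE; congr (_ + _).
  by apply: eq_bigr => j _; rewrite !mxE.
apply: measurable_funD => //; apply: measurable_sum => j.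
by apply: measurable_funM => //; exact: measurable_tnth.
Qed.

(** The change of variables formula, stated for preimages so that only the
measurability of [S] is needed.  The translation part is quantified over in
order to let the induction on triangular matrices go through: eliminating one
coordinate produces a translation depending on that coordinate. *)
Definition scales n (M : 'M[R]_n) := forall c S, measurable S ->
  (`|\det M|%:E * lambda n (affine M c @^-1` S) = lambda n S)%E.

Lemma affine_comp n (M N : 'M[R]_n) c d :
  affine (M *m N) (c *m N + d) = affine N d \o affine M c.
Proof. by apply/funext => t; rewrite /affine /= row_tupleK mulmxDl mulmxA addrA. Qed.

Lemma scales_mulmx n (M N : 'M[R]_n) :
  scales M -> scales N -> scales (M *m N).
Proof.
move=> sM sN c S mS.
have -> : c = 0 *m N + c by rewrite mul0mx add0r.
rewrite affine_comp comp_preimage det_mulmx normrM mulrC EFinM -muleA sM ?sN//.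
by rewrite -[X in measurable X]setTI; exact: measurable_affine.
Qed.

Lemma lebesgue_tupleS n (S : set (n.+1.-tuple MR)) : lambda n.+1 S =
  (\int[@lebesgue_measure R]_x lambda n [set y | S (tcons (x, y))])%E.
Proof.
apply: eq_integral => x _ /=; congr (lambda n _).
by apply/seteqP; split => y; rewrite /xsection /= inE.
Qed.

(** Slicing along the other factor: uniqueness of the product measure allows the
first coordinate to be integrated innermost. *)
Lemma lebesgue_tupleS2 n (S : set (n.+1.-tuple MR)) : measurable S -> lambda n.+1 S =
  (\int[lambda n]_y @lebesgue_measure R [set x | S (tcons (x, y))])%E.
Proof.
move=> mS.
transitivity ((@lebesgue_measure R \x^ lambda n)%E (@tcons R n @^-1` S)).
  apply: product_measure_unique.
    by move=> A B mA mB; exact: product_measure2E.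
  by rewrite -[X in measurable X]setTI; exact: measurable_tcons.
apply: eq_integral => y _ /=; congr (lebesgue_measure _).
by apply/seteqP; split => x; rewrite /ysection /= inE.
Qed.

Lemma measurable_xsec n (S : set (n.+1.-tuple MR)) (x : MR) : measurable S ->
  measurable [set y | S (tcons (x, y))].
Proof.
move=> mS; rewrite -[X in measurable X]setTI.
have mc : measurable_fun setT (fun y : n.-tuple MR => tcons (x, y)).
  by apply: (measurableT_comp (@measurable_tcons R n)); exact: measurable_fun_pair.
exact: mc.
Qed.

Lemma measurable_ysec n (S : set (n.+1.-tuple MR)) (y : n.-tuple MR) : measurable S ->
  measurable [set x : MR | S (tcons (x, y))].
Proof.
move=> mS; rewrite -[X in measurable X]setTI.
have mc : measurable_fun setT (fun x : MR => tcons (x, y)).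
  by apply: (measurableT_comp (@measurable_tcons R n)); exact: measurable_fun_pair.
exact: mc.
Qed.

Lemma measurable_fun_xsec n (S : set (n.+1.-tuple MR)) : measurable S ->
  measurable_fun setT (fun x : MR => lambda n [set y | S (tcons (x, y))]).
Proof.
move=> mS; have mS' : measurable (@tcons R n @^-1` S).
  by rewrite -[X in measurable X]setTI; exact: measurable_tcons.
have := measurable_fun_xsection (lambda n) mS'.
congr measurable_fun; apply/funext => x /=; congr (lambda n _).
by apply/seteqP; split => y; rewrite /xsection /= inE.
Qed.

Lemma measurable_fun_ysec n (S : set (n.+1.-tuple MR)) : measurable S ->
  measurable_fun setT (fun y : n.-tuple MR => @lebesgue_measure R [set x | S (tcons (x, y))]).
Proof.
move=> mS; have mS' : measurable (@tcons R n @^-1` S).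
  by rewrite -[X in measurable X]setTI; exact: measurable_tcons.
have := measurable_fun_ysection (@lebesgue_measure R) mS'.
congr measurable_fun; apply/funext => y /=; congr (lebesgue_measure _).
by apply/seteqP; split => x; rewrite /ysection /= inE.
Qed.

Lemma measurable_affine_preimage n (M : 'M[R]_n) c (S : set (n.-tuple MR)) :
  measurable S -> measurable (affine M c @^-1` S).
Proof. by move=> mS; rewrite -[X in measurable X]setTI; exact: measurable_affine. Qed.

(** With an upper triangular block, the first coordinate of the image depends on
the first coordinate only; slices at a fixed first coordinate are handled by the
block [M], and the outer integral by the one-dimensional case. *)
Lemma scales_ublock n (m : R) (u : 'rV[R]_n) (M : 'M[R]_n) : m != 0 ->
  scales M -> @scales (1 + n) (block_mx m%:M u 0 M).
Proof.
move=> m0 sM c S mS.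
rewrite det_ublock det_scalar1 -[c]hsubmxK [lsubmx c]mx11_scalar.
set c0 := lsubmx c 0 0; set c' := rsubmx c; set N := block_mx _ _ _ _.
have aE x y : affine N (row_mx c0%:M c' : 'rV[R]_(1 + n)) (tcons (x, y))
    = tcons ((x * m + c0)%R : MR, affine M (x *: u + c') y).
  rewrite /affine tuple_row_tcons mul_row_block mulmx0 addr0 add_row_mx.
  rewrite -scalar_mxM -raddfD /= row_tuple_block; congr (tcons (_, row_tuple _)).
  by rewrite mul_scalar_mx addrA [X in X + _]addrC.
rewrite !lebesgue_tupleS normrM EFinM -muleA.
have mh := measurable_fun_xsec mS.
rewrite -[RHS](@scaled_integral R _ MR (@lebesgue_measure R)
  (fun x : MR => (x * m + c0)%R : MR) (`|m|)
  (fun x : MR => lambda n [set y | S (tcons (x, y))])) => //.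
- congr (_ * _)%E; rewrite -ge0_integralZl//; last first.
    by apply: measurable_fun_xsec; exact: (measurable_affine_preimage (n := n.+1)).
  apply: eq_integral => x _.
  rewrite -[RHS](sM (x *: u + c')); last exact: (measurable_xsec _ mS).
  congr (_ * lambda n _)%E; apply/seteqP; split => y; by rewrite /= aE.
- by apply: measurable_funD => //; exact: measurable_funM.
- by move=> A mA; exact: lebesgue_measure_affine.
Qed.

(** Mirror case: now the last coordinates of the image do not involve the first
one, so the slices are taken in the other order. *)
Lemma scales_lblock n (m : R) (v : 'cV[R]_n) (M : 'M[R]_n) : m != 0 ->
  scales M -> @scales (1 + n) (block_mx m%:M 0 v M).
Proof.
move=> m0 sM c S mS.
rewrite det_lblock det_scalar1 -[c]hsubmxK [lsubmx c]mx11_scalar.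
set c0 := lsubmx c 0 0; set c' := rsubmx c; set N := block_mx _ _ _ _.
have aE x y : affine N (row_mx c0%:M c' : 'rV[R]_(1 + n)) (tcons (x, y))
    = tcons ((x * m + ((tuple_row y *m v) 0 0 + c0))%R : MR, affine M c' y).
  rewrite /affine tuple_row_tcons mul_row_block mulmx0 add0r add_row_mx.
  rewrite [tuple_row y *m v]mx11_scalar -scalar_mxM -!raddfD /= row_tuple_block.
  by congr (tcons (_, row_tuple _)); rewrite !mxE eqxx mulr1n addrA.
rewrite (lebesgue_tupleS2 (n := n) mS) (lebesgue_tupleS2 (n := n)); last first.
  exact: (measurable_affine_preimage (n := n.+1)).
rewrite normrM mulrC EFinM -muleA.
have mh := measurable_fun_ysec mS.
rewrite -[RHS](@scaled_integral R _ (n.-tuple MR) (lambda n) (affine M c') (`|\det M|)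
  (fun y => @lebesgue_measure R [set x | S (tcons (x, y))])) => //.
- congr (_ * _)%E; rewrite -ge0_integralZl//; last first.
    by apply: measurable_fun_ysec; exact: (measurable_affine_preimage (n := n.+1)).
  apply: eq_integral => y _.
  rewrite -[RHS](@lebesgue_measure_affine R m ((tuple_row y *m v) 0 0 + c0)) //; last exact: (measurable_ysec _ mS).
  congr (_ * lebesgue_measure _)%E; apply/seteqP; split => x; by rewrite /= aE.
- exact: measurable_affine.
- by move=> A mA; exact: sM.
Qed.

Lemma scales_upper n (M : 'M[R]_n) : (forall i j : 'I_n, (j < i)%N -> M i j = 0) ->
  \det M != 0 -> scales M.
Proof.
elim: n M => [|n IH] M Mu dM.
  move=> c S mS; rewrite det_mx00 normr1 mul1e; congr (lambda 0 _).
  by apply/seteqP; split => t; rewrite /= [affine _ _ _]tuple0 [t]tuple0.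
have bM : M = block_mx ((M 0 0)%:M : 'M[R]_1) (ursubmx (M : 'M[R]_(1 + n))) 0 (drsubmx (M : 'M[R]_(1 + n))) :> 'M[R]_(1 + n).
  rewrite -[LHS](submxK (M : 'M[R]_(1 + n))); congr (block_mx _ _ _ _).
    by rewrite [LHS]mx11_scalar !mxE; congr (M _ _)%:M; apply: val_inj.
  by apply/matrixP => i j; rewrite !mxE Mu //= ord1.
have dE : \det M = M 0 0 * \det (drsubmx (M : 'M[R]_(1 + n))).
  by rewrite -(det_scalar1 (M 0 0)) -(det_ublock _ (ursubmx (M : 'M[R]_(1 + n)))) -bM.
move: dM; rewrite dE mulf_eq0 negb_or => /andP[m0 dM]; rewrite bM.
apply: scales_ublock => //; apply: IH => // i j ij.
by rewrite !mxE; apply: Mu.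
Qed.

Lemma scales_lower n (M : 'M[R]_n) : (forall i j : 'I_n, (i < j)%N -> M i j = 0) ->
  \det M != 0 -> scales M.
Proof.
elim: n M => [|n IH] M Mu dM.
  move=> c S mS; rewrite det_mx00 normr1 mul1e; congr (lambda 0 _).
  by apply/seteqP; split => t; rewrite /= [affine _ _ _]tuple0 [t]tuple0.
have bM : M = block_mx ((M 0 0)%:M : 'M[R]_1) 0 (dlsubmx (M : 'M[R]_(1 + n))) (drsubmx (M : 'M[R]_(1 + n))) :> 'M[R]_(1 + n).
  rewrite -[LHS](submxK (M : 'M[R]_(1 + n))); congr (block_mx _ _ _ _).
    by rewrite [LHS]mx11_scalar !mxE; congr (M _ _)%:M; apply: val_inj.
  by apply/matrixP => i j; rewrite !mxE Mu //= ord1.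
have dE : \det M = M 0 0 * \det (drsubmx (M : 'M[R]_(1 + n))).
  by rewrite -(det_scalar1 (M 0 0)) -(det_lblock _ (dlsubmx (M : 'M[R]_(1 + n)))) -bM.
move: dM; rewrite dE mulf_eq0 negb_or => /andP[m0 dM]; rewrite bM.
apply: scales_lblock => //; apply: IH => // i j ij.
by rewrite !mxE; apply: Mu.
Qed.

(** An LUP decomposition reduces an invertible map to triangular ones and a
permutation of the coordinates.  Restricting to sets [Q] invariant under
permutations, such as the cube and the standard simplex, makes the permutation
factor disappear. *)
Lemma volume_affine_imageS n (M : 'M[R]_n.+1) (c : 'rV[R]_n.+1) (Q : set 'rV[R]_n.+1) :
  M \in unitmx -> measurable (@tuple_row n.+1 @^-1` Q) ->
  (forall s x, Q x -> Q (col_perm s x)) ->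
  volume [set x *m M + c | x in Q] = (`|\det M|%:E * volume Q)%E.
Proof.
move=> uM mQ Qperm.
have /is_perm_mxP[s Ps] := cormen_lup_perm M.
have := cormen_lup_correct M; have := cormen_lup_detL M.
have := @cormen_lup_lower _ _ M; have := @cormen_lup_upper _ _ M.
move: Ps; case: (cormen_lup M) => [[P L] U] /= -> Uu Ll detL PLU.
set N := L *m U; have {}PLU : perm_mx s *m M = N by exact: PLU.
have dN : `|\det M| = `|\det N|.
  by rewrite -PLU det_mulmx normrM det_perm normrX normrN1 expr1n mul1r.
have N0 : \det N != 0 by rewrite -normr_eq0 -dN normr_eq0 -unitfE -unitmxE.
have sN : scales N.
  move: N0; rewrite /N det_mulmx mulf_eq0 negb_or => /andP[L0 U0].
  apply: scales_mulmx; last exact: scales_upper.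
  apply: scales_lower => // i j ij; rewrite Ll; last exact: ltnW.
  by rewrite (_ : i == j = false)//; apply/negbTE; rewrite neq_ltn ij.
have uN : N \in unitmx by rewrite unitmxE unitfE.
pose A := [set t : n.+1.-tuple MR | [set x *m N + c | x in Q] (tuple_row t)].
have -> : volume [set x *m M + c | x in Q] = lambda n.+1 A.
  congr (lambda _ _); apply/seteqP; split => t [x Qx xE] /=.
    exists (col_perm s x); first exact: Qperm.
    by rewrite -[RHS]xE col_permE -PLU mulmxA -[_ *m _ *m perm_mx s]mulmxA -perm_mxM mulVg perm_mx1 mulmx1.
  exists (col_perm s^-1 x); first exact: Qperm.
  by rewrite -[RHS]xE col_permE invgK -mulmxA PLU.
have QE : @tuple_row n.+1 @^-1` Q = affine N c @^-1` A.
  apply/seteqP; split => t /= Qt.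
    by exists (tuple_row t) => //; rewrite row_tupleK.
  have [x Qx] := Qt; rewrite row_tupleK => /addIr /(congr1 (mulmxr (invmx N))) /=.
  by rewrite !mulmxK// => <-.
have mA : measurable A.
  rewrite (_ : A = affine (invmx N) (- c *m invmx N) @^-1` (@tuple_row n.+1 @^-1` Q)).
    exact: measurable_affine_preimage.
  apply/seteqP; split => t /=; rewrite row_tupleK -mulmxDl.
    by move=> [x Qx <-]; rewrite addrK mulmxK.
  by move=> Qt; exists ((tuple_row t - c) *m invmx N) => //; rewrite mulmxKV// subrK.
rewrite dN -(sN c A mA) -QE; congr (_ * lambda _ _)%E.
Qed.

Lemma volume_affine_image n (M : 'M[R]_n) (c : 'rV[R]_n) (Q : set 'rV[R]_n) :
  M \in unitmx -> measurable (@tuple_row n @^-1` Q) ->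
  (forall s x, Q x -> Q (col_perm s x)) ->
  volume [set x *m M + c | x in Q] = (`|\det M|%:E * volume Q)%E.
Proof.
case: n M c Q => [|n] M c Q; last exact: volume_affine_imageS.
move=> _ _ _; rewrite det_mx00 normr1 mul1e; congr (volume _).
apply/seteqP; split => x => [[y Qy _]|Qx]; first by rewrite (_ : x = y)// [x]thinmx0 [y]thinmx0.
by exists x => //; rewrite [LHS]thinmx0 [RHS]thinmx0.
Qed.

Lemma volumeE n (Q : set 'rV[R]_n) : volume Q = lambda n (@tuple_row n @^-1` Q).
Proof. by []. Qed.

Lemma volume_unit_cube n : volume [set x : 'rV[R]_n | forall i, 0 <= x 0 i <= 1] = 1%:E.
Proof.
rewrite /volume; elim: n => [|n IH].
  by rewrite /= diracE mem_set//= => -[].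
rewrite lebesgue_tupleS.
rewrite (eq_integral (EFin \o \1_(`[0 : R, 1]%classic : set MR))); last first.
  move=> x _ /=; rewrite indicE.
  have [x01|x01] := boolP (x \in `[0 : R, 1]%classic).
    rewrite -[RHS]IH; congr (lambda n _); apply/seteqP; split => y /= H i.
      by have := H (lift ord0 i); rewrite !mxE (tnth_nth 0) /= -tnth_nth.
    case: (unliftP ord0 i) => [j ->|->].
      by have := H j; rewrite !mxE !(tnth_nth 0).
    by move: x01; rewrite inE /= in_itv /= mxE.
  rewrite -[RHS](measure0 (lambda n)); congr (lambda n _).
  apply/seteqP; split => y //= H; move/negP: x01; apply.
  by have := H ord0; rewrite mxE inE /= in_itv.
rewrite integral_indic// setIT.
have := lebesgue_measure_itv `[0 : R, 1]; rewrite /= lte_fin ltr01 => ->.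
by rewrite oppr0 adde0.
Qed.

End LebesgueTuple.

(** * Volumes of simplices *)

Section Simplex.
Variable R : realType.
Local Notation MR := (measurableTypeR R).
Local Notation lambda := (@lebesgue_tuple R).

Definition closed_simplex n (s : R) : set 'rV[R]_n :=
  [set x | (forall i, 0 <= x 0 i) /\ \sum_i x 0 i <= s].
Definition open_simplex n (s : R) : set 'rV[R]_n :=
  [set x | (forall i, 0 < x 0 i) /\ \sum_i x 0 i < s].

Lemma integral_simplex n (s : R) : 0 < s ->
  (\int[@lebesgue_measure R]_(x in `[0%R, s]) ((s - x) ^+ n / n`!%:R)%:E = (s ^+ n.+1 / n.+1`!%:R)%:E)%E.
Proof.
move=> s0.
pose F x : R := - (s - x) ^+ n.+1 / n.+1`!%:R.
have dF x : is_derive x (1 : R) F ((s - x) ^+ n / n`!%:R).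
  have -> : F = (- n.+1`!%:R^-1) \*: ((cst s - id) ^+ n.+1 : R -> R).
    apply/funext => y; rewrite /F /= /GRing.scale /= !mulNr [in RHS]mulrC.
    by rewrite exprfctE.
  apply: is_derive_eq.
  rewrite /= /GRing.scale /= sub0r mulrN1 factS natrM invfM mulrNN mulrACA.
  by rewrite mulVf ?pnatr_eq0// mul1r mulrC.
have cF x : F y @[y --> x] --> F x.
  by have [dF1 _] := dF x; exact/differentiable_continuous/derivable1_diffP.
rewrite (@continuous_FTC2 _ _ F 0 s)//.
- by rewrite -EFinB /F subrr subr0 expr0n /= oppr0 mul0r sub0r mulNr opprK.
- apply: continuous_subspaceT => x.
  have -> : (fun x => (s - x) ^+ n / n`!%:R) = (n`!%:R)^-1 \*: ((cst s - id) ^+ n : R -> R).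
    by apply/funext => y; rewrite /= exprfctE /GRing.scale /= mulrC.
  apply: differentiable_continuous; apply/derivable1_diffP. exact: ex_derive.
- split; first by move=> x _; exact: (@ex_derive _ _ _ _ _ _ _ (dF x)).
    exact: cvg_at_right_filter.
  exact: cvg_at_left_filter.
- by move=> x _; rewrite derive1E; exact: (@derive_val _ _ _ _ _ _ _ (dF x)).
Qed.

Lemma sum_tuple_row n (t : n.-tuple MR) : \sum_i tuple_row t 0 i = \sum_i tnth t i.
Proof. by apply: eq_bigr => i _; rewrite mxE. Qed.

Lemma measurable_tuple_sum n : measurable_fun setT (fun t : n.-tuple MR => (\sum_i tnth t i)%R : MR).
Proof. by apply: measurable_sum => i; exact: measurable_tnth. Qed.

Lemma measurable_forall_tnth n (B : set MR) : measurable B ->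
  measurable [set t : n.-tuple MR | forall i, B (tnth t i)].
Proof.
move=> mB.
rewrite (_ : [set t | _] = \bigcap_(i in [set: 'I_n]) (fun t : n.-tuple MR => tnth t i) @^-1` B).
  apply: fin_bigcap_measurable => // i _.
  by rewrite -[X in measurable X]setTI; exact: measurable_tnth.
by apply/seteqP; split => t /= Ht i => [_|]; exact: Ht.
Qed.

Lemma measurable_cube n :
  measurable (@tuple_row R n @^-1` [set x : 'rV[R]_n | forall i, 0 <= x 0 i <= 1]).
Proof.
have := @measurable_forall_tnth n `[0, 1]%classic (measurable_itv _); congr measurable.
by apply/seteqP; split => t /= H i; move: (H i); rewrite !mxE ?in_itv.
Qed.

Lemma measurable_closed_simplex n s : measurable (@tuple_row R n @^-1` closed_simplex s).
Proof.
rewrite (_ : _ @^-1` _ = [set t | forall i, `[0%R, +oo[%classic (tnth t i)] `&`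
  (fun t : n.-tuple MR => (\sum_i tnth t i)%R : MR) @^-1` `]-oo, s]%classic).
  apply: measurableI; first exact: measurable_forall_tnth.
  by rewrite -[X in measurable X]setTI; exact: measurable_tuple_sum.
apply/seteqP; split => t /= [H].
  rewrite sum_tuple_row in_itv /=; split => // i.
  by move: (H i); rewrite mxE in_itv /= andbT.
rewrite in_itv /=; split; last by rewrite sum_tuple_row.
by move=> i; move: (H i); rewrite mxE in_itv /= andbT.
Qed.

Lemma measurable_open_simplex n s : measurable (@tuple_row R n @^-1` open_simplex s).
Proof.
rewrite (_ : _ @^-1` _ = [set t | forall i, `]0%R, +oo[%classic (tnth t i)] `&`
  (fun t : n.-tuple MR => (\sum_i tnth t i)%R : MR) @^-1` `]-oo, s[%classic).
  apply: measurableI; first exact: measurable_forall_tnth.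
  by rewrite -[X in measurable X]setTI; exact: measurable_tuple_sum.
apply/seteqP; split => t /= [H].
  rewrite sum_tuple_row in_itv /=; split => // i.
  by move: (H i); rewrite mxE in_itv /= andbT.
rewrite in_itv /=; split; last by rewrite sum_tuple_row.
by move=> i; move: (H i); rewrite mxE in_itv /= andbT.
Qed.

Lemma sum_tcons n (x : R) (y : n.-tuple MR) :
  \sum_i tuple_row (tcons (x : MR, y)) 0 i = x + \sum_i tuple_row y 0 i.
Proof.
rewrite !sum_tuple_row big_ord_recl (tnth_nth 0) /=; congr (_ + _).
by apply: eq_bigr => i _; rewrite !(tnth_nth 0).
Qed.

Lemma closed_simplex_tcons n s (x : R) (y : n.-tuple MR) :
  closed_simplex s (tuple_row (tcons (x : MR, y))) <-> 0 <= x /\ closed_simplex (s - x) (tuple_row y).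
Proof.
rewrite /closed_simplex /= sum_tcons lerBrDl; split => [[H ?]|[x0 [H ?]]]; split => //.
- by have := H ord0; rewrite mxE (tnth_nth 0).
- by split=> // i; have := H (lift ord0 i); rewrite !mxE !(tnth_nth 0).
- move=> i; case: (unliftP ord0 i) => [j ->|->]; last by rewrite mxE (tnth_nth 0).
  by have := H j; rewrite !mxE !(tnth_nth 0).
Qed.

Lemma open_simplex_tcons n s (x : R) (y : n.-tuple MR) :
  open_simplex s (tuple_row (tcons (x : MR, y))) <-> 0 < x /\ open_simplex (s - x) (tuple_row y).
Proof.
rewrite /open_simplex /= sum_tcons ltrBrDl; split => [[H ?]|[x0 [H ?]]]; split => //.
- by have := H ord0; rewrite mxE (tnth_nth 0).
- by split=> // i; have := H (lift ord0 i); rewrite !mxE !(tnth_nth 0).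
- move=> i; case: (unliftP ord0 i) => [j ->|->]; last by rewrite mxE (tnth_nth 0).
  by have := H j; rewrite !mxE !(tnth_nth 0).
Qed.

Lemma closed_simplex_eq0 n s : s < 0 -> @closed_simplex n s = set0.
Proof.
move=> s0; apply/seteqP; split => x //= [H]; rewrite leNgt (lt_le_trans s0)//.
exact: sumr_ge0.
Qed.

Lemma open_simplex_eq0 n s : s <= 0 -> @open_simplex n s = set0.
Proof.
move=> s0; apply/seteqP; split => x //= [H]; rewrite ltNge (le_trans s0)//.
by apply: sumr_ge0 => i _; exact: ltW.
Qed.

Lemma volume_set0 n : volume (@set0 'rV[R]_n) = 0%E.
Proof. exact: measure0. Qed.

(** Slicing by the first coordinate [x] gives simplices of size [s - x]; the
induction therefore runs over all sizes. *)
Lemma volume_closed_simplex n s : 0 <= s ->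
  volume (@closed_simplex n s) = (s ^+ n / n`!%:R)%:E.
Proof.
elim: n s => [|n IH] s s0.
  rewrite /volume /= diracE mem_set ?divr1//=.
  by split => [[]//|]; rewrite big_ord0.
rewrite /volume lebesgue_tupleS.
have slice (x : MR) : lambda n [set y | closed_simplex s (\row_i tnth (tcons (x, y)) i)]
   = if 0 <= x then volume (@closed_simplex n (s - x)) else 0%E.
  case: ifPn => x0.
    congr (lambda n _); apply/seteqP; split => y; first by move=> /closed_simplex_tcons[].
    by move=> h; apply/closed_simplex_tcons.
  rewrite -[RHS](measure0 (lambda n)); congr (lambda n _).
  by apply/seteqP; split => y //= /closed_simplex_tcons[]; rewrite (negbTE x0).
transitivity (\int[@lebesgue_measure R]_(x in `[0%R, s]) ((s - x) ^+ n / n`!%:R)%:E)%E.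
  rewrite [RHS]integral_mkcond; apply: eq_integral => x _ /=.
  rewrite slice patchE mem_setE in_itv /=.
  case: (leP 0 x) => //= x0; case: (leP x s) => xs; first by rewrite IH// subr_ge0.
  by rewrite closed_simplex_eq0 ?subr_lt0// volume_set0.
move: s0; rewrite le_eqVlt => /predU1P[<-|s0]; last exact: integral_simplex.
by rewrite set_itv1 integral_set1 expr0n mul0r.
Qed.

(** The open simplex has the same volume as the closed one.  Its volume is
computed by the same slicing, which avoids any discussion of the boundary. *)
Lemma volume_open_simplex n s : 0 < s ->
  volume (@open_simplex n s) = (s ^+ n / n`!%:R)%:E.
Proof.
elim: n s => [|n IH] s s0.
  rewrite /volume /= diracE mem_set ?divr1//=.
  by split => [[]//|]; rewrite big_ord0.
rewrite /volume lebesgue_tupleS.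
have slice (x : MR) : lambda n [set y | open_simplex s (\row_i tnth (tcons (x, y)) i)]
   = if 0 < x then volume (@open_simplex n (s - x)) else 0%E.
  case: ifPn => x0.
    congr (lambda n _); apply/seteqP; split => y; first by move=> /open_simplex_tcons[].
    by move=> h; apply/open_simplex_tcons.
  rewrite -[RHS](measure0 (lambda n)); congr (lambda n _).
  by apply/seteqP; split => y //= /open_simplex_tcons[]; rewrite (negbTE x0).
transitivity (\int[@lebesgue_measure R]_(x in `]0%R, s[) ((s - x) ^+ n / n`!%:R)%:E)%E.
  rewrite [RHS]integral_mkcond; apply: eq_integral => x _ /=.
  rewrite slice patchE mem_setE in_itv /=.
  case: (ltP 0 x) => //= x0; case: (ltP x s) => xs; first by rewrite IH// subr_gt0.
  by rewrite open_simplex_eq0 ?subr_le0// volume_set0.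
rewrite -integral_simplex//. rewrite [RHS]integral_itv_bndoo//.
apply/measurable_EFinP; apply: measurable_funM => //; apply: measurable_funX.
exact: measurable_funB.
Qed.

End Simplex.

(** * Minkowski sums of segments *)

Section Hulls.
Variable R : realType.

(** Convex combinations may be indexed by the parameters of the points instead of
by positions in the enumerating list. *)
Lemma convex_hull_image (T : finType) (A : pred T) n (g : T -> 'rV[R]_n) x :
  convex_hull [seq g p | p in A] x <->
  exists w : T -> R, [/\ forall p, p \in A -> 0 <= w p, \sum_(p in A) w p = 1 &
    x = \sum_(p in A) w p *: g p].
Proof.
case: (pickP A) => [p0 Ap0|A0]; last first.
  have eA : enum A = [::] by rewrite (eq_enum A0) enum0.
  split => [[w [w0 w1 xE]]|[w [w0 w1 xE]]].
    move: w1; rewrite big1 => [|i _]; first by move=> /esym/eqP; rewrite oner_eq0.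
    by exfalso; case: i => i; rewrite size_map eA.
  by move: w1; rewrite big_pred0// => /esym/eqP; rewrite oner_eq0.
set s := [seq g p | p in A].
have ss : size s = #|A| by rewrite size_image.
have sumE (V : nmodType) (F : T -> V) : \sum_(p in A) F p = \sum_(i < size s) F (nth p0 (enum A) i).
  by rewrite -big_enum (big_nth p0) big_mkord -cardE ss.
have snth (i : 'I_(size s)) : s`_i = g (nth p0 (enum A) i).
  by rewrite /s /image_mem (nth_map p0)// -cardE -ss.
split => [[w [w0 w1 ->]]|[w [w0 w1 ->]]].
- pose W p := \sum_(i < size s | nth p0 (enum A) i == p) w i.
  have WE (i : 'I_(size s)) : W (nth p0 (enum A) i) = w i.
    rewrite /W (big_pred1 i)// => j /=.
    by rewrite nth_uniq ?enum_uniq -?cardE -?ss.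
  exists W; split.
  + by move=> p _; apply: sumr_ge0.
  + by rewrite sumE -w1; apply: eq_bigr => i _; rewrite WE.
  + by rewrite sumE; apply: eq_bigr => i _; rewrite WE snth.
- exists (fun i => w (nth p0 (enum A) i)); split.
  + by move=> i; apply: w0; rewrite -mem_enum mem_nth// -cardE -ss.
  + by rewrite -w1 sumE.
  + by rewrite sumE; apply: eq_bigr => i _; rewrite snth.
Qed.

Section Zonotope.
Variables (n N : nat) (pt : 'I_N -> 'rV[R]_n) (u v : 'I_n -> 'I_N).
Hypothesis uv : forall i, u i != v i.
Let cell i : {set 'I_N} := [set u i; v i]%SET.
Let vertices := [seq \sum_i pt (p i) | p : {ffun 'I_n -> 'I_N} in family (fun i => mem (cell i))].
Definition edges : 'M[R]_n := \matrix_i (pt (u i) - pt (v i)).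

(** The Minkowski sum of segments is an affine image of the unit cube.  From left
to right, the coordinate [x_i] is the total weight of the vertices using the end
point [u i]; conversely the vertices receive product weights. *)
Lemma convex_hull_parallelepiped :
  convex_hull vertices =
  [set x *m edges + \sum_i pt (v i) | x in [set x : 'rV_n | forall i, 0 <= x 0 i <= 1]].
Proof.
have mulE (x : 'rV_n) : x *m edges + \sum_i pt (v i) =
   \sum_i (x 0 i *: pt (u i) + (1 - x 0 i) *: pt (v i)).
  rewrite mulmx_sum_row -big_split; apply: eq_bigr => i _ /=.
  by rewrite rowK scalerBr scalerBl scale1r -addrA [- _ + _]addrC.
apply/seteqP; split => y.
- move=> /convex_hull_image[w [w0 w1 ->]].
  pose x : 'rV[R]_n := \row_i \sum_(p in family (fun i => mem (cell i)) | p i == u i) w p.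
  have xc i : 1 - x 0 i = \sum_(p in family (fun i => mem (cell i)) | p i != u i) w p.
    by rewrite mxE -w1 (bigID (fun p : {ffun _} => p i == u i)) /= addrC addrK.
  exists x.
    move=> i; apply/andP; split.
      by rewrite mxE; apply: sumr_ge0 => p /andP[pc _]; exact: w0.
    by rewrite -subr_ge0 xc; apply: sumr_ge0 => p /andP[pc _]; exact: w0.
  rewrite mulE; under [RHS]eq_bigr do rewrite scaler_sumr.
  rewrite exchange_big; apply: eq_bigr => i _ /=.
  rewrite xc mxE [RHS](bigID (fun p : {ffun _} => p i == u i)) /= !scaler_suml.
  congr (_ + _); apply: eq_bigr => p /andP[/familyP/(_ i) pc].
    by move=> /eqP->.
  by move: pc; rewrite !inE => /orP[->//|/eqP->].
- move=> [x x01 <-]; apply/convex_hull_image.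
  pose F i j : R := if j == u i then x 0 i else 1 - x 0 i.
  have Fu i : F i (u i) = x 0 i by rewrite /F eqxx.
  have Fv i : F i (v i) = 1 - x 0 i by rewrite /F eq_sym (negbTE (uv i)).
  have F1 i : \sum_(j in cell i) F i j = 1.
    by rewrite big_setU1 ?inE// big_set1 Fu Fv; exact: subrKC.
  exists (fun p : {ffun 'I_n -> 'I_N} => \prod_i F i (p i)); split.
  + move=> p _; apply: prodr_ge0 => i _; rewrite /F.
    by have /andP[? ?] := x01 i; case: ifP => // _; rewrite subr_ge0.
  + transitivity (\prod_i \sum_(j in cell i) F i j); last by rewrite big1.
    by apply/esym; exact: (bigA_distr_big_dep (fun i => mem (cell i)) F).
  + rewrite mulE; under [RHS]eq_bigr do rewrite scaler_sumr.
    rewrite exchange_big; apply: eq_bigr => i _ /=.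
    apply/rowP => l; rewrite summxE.
    pose G i' j := F i' j * (if i' == i then pt j 0 l else 1).
    transitivity (\sum_(p in family (fun i => mem (cell i))) \prod_i' G i' (p i')); last first.
      apply: eq_bigr => p _; rewrite mxE big_split /=; congr (_ * _).
      by rewrite (bigD1 i)//= eqxx big1 ?mulr1// => j /negbTE->.
    transitivity (\prod_i' \sum_(j in cell i') G i' j); last first.
      exact: (bigA_distr_big_dep (fun i => mem (cell i)) G).
    rewrite (bigD1 i)//= [X in _ * X]big1 ?mulr1.
      by rewrite !mxE /G big_setU1 ?inE// big_set1 !eqxx Fu Fv.
    move=> j /negbTE ji; rewrite -[RHS](F1 j); apply: eq_bigr => j' _.
    by rewrite /G ji mulr1.
Qed.

(** Moving a single end point from [v i] to [u i] changes the sum by the edge [i],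
so that the edges lie in the direction space of the vertices. *)
Lemma affdim_vertices : edges \in unitmx -> affdim vertices = n.
Proof.
move=> uE; apply/eqP; rewrite eqn_leq rank_leq_col /=.
rewrite -{1}(mxrank_unit uE); apply: mxrankS; apply/row_subP => i; rewrite rowK.
set M := \matrix_(i < _) _.
have vin (p : {ffun 'I_n -> 'I_N}) : p \in family (fun i => mem (cell i)) ->
    (\sum_i pt (p i) - vertices`_0 <= M)%MS.
  move=> pf; have pv : \sum_i pt (p i) \in vertices by apply: map_f; rewrite mem_enum.
  have ip := pv; rewrite -index_mem in ip.
  by have := row_sub (Ordinal ip) M; rewrite rowK /= nth_index.
pose p0 := [ffun i => v i]; pose p1 := [ffun j => if j == i then u j else v j].
have p0f : p0 \in family (fun i => mem (cell i)).
  by apply/familyP => j; rewrite ffunE !inE eqxx orbT.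
have p1f : p1 \in family (fun i => mem (cell i)).
  by apply/familyP => j; rewrite ffunE !inE; case: ifP; rewrite eqxx ?orbT.
have := addmx_sub (vin _ p1f) (_ : (- (\sum_i pt (p0 i) - vertices`_0) <= M)%MS).
rewrite eqmx_opp => /(_ (vin _ p0f)); rewrite opprB addrA subrK -sumrB.
rewrite (bigD1 i)//= big1 ?addr0 => [|j /negbTE ji].
  by rewrite !ffunE eqxx.
by rewrite !ffunE ji subrr.
Qed.
End Zonotope.

End Hulls.

(** * Affine relations on a circuit *)

Section CircuitAlgebra.
Variables (n : nat) (a : 'I_n.+2 -> 'rV[int]_n).
Local Notation A := (config_matrix a).
Local Notation b := (affine_relation a).

Lemma config_matrix0 j : A ord0 j = 1.
Proof.
rewrite mxE (_ : ord0 = lshift n (ord0 : 'I_1)); last exact: val_inj.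
by rewrite col_mxEu mxE.
Qed.

Lemma config_matrixS l j : A (lift ord0 l) j = a j ord0 l.
Proof.
rewrite mxE (_ : lift ord0 l = rshift 1 l); last exact: val_inj.
by rewrite (@col_mxEd _ 1 n) mxE.
Qed.

(** The affine relation consists of the signed maximal minors, hence is a Laplace
expansion along an additional row. *)
Lemma det_config_row (r : 'rV[int]_n.+2) :
  \det (col_mx r A : 'M[int]_(1 + n.+1)) = \sum_j r 0 j * b j.
Proof.
rewrite (expand_det_row _ (lshift _ 0)); apply: eq_bigr => j _.
rewrite col_mxEu; congr (_ * _); rewrite /cofactor add0n; congr (_ * \det _).
apply/matrixP => i k; rewrite !mxE -/(A _ _).
have -> : lift (lshift n.+1 (0 : 'I_1)) i = rshift 1 i by exact: val_inj.
by case: splitP => // i'; rewrite ?ord1 //= /bump /= => /eqP; rewrite !add1n eqSS => /eqP/val_inj->; rewrite !mxE.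
Qed.

(** A determinant with a repeated row vanishes. *)
Lemma affine_relation_row i : \sum_j A i j * b j = 0.
Proof.
rewrite -[RHS](@determinant_alternate _ _ (col_mx (row i A) A : 'M[int]_(1 + n.+1)) (lshift _ 0) (rshift 1 i)).
- by rewrite det_config_row; apply: eq_bigr => j _; rewrite [in RHS]mxE.
- by [].
- by move=> j; rewrite col_mxEu col_mxEd mxE.
Qed.

Lemma sum_affine_relation : \sum_j b j = 0.
Proof.
by rewrite -[RHS](affine_relation_row ord0); apply: eq_bigr => j _; rewrite config_matrix0 mul1r.
Qed.

Variable R : realType.
Hypothesis b0 : forall j, b j != 0.
Local Notation pt := (real_point a R).
Local Notation br j := ((b j)%:~R : R).

Definition pairing (xi : 'rV[R]_n) j : R := (xi *m (pt j)^T) 0 0.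

Lemma pairingE xi j : pairing xi j = \sum_l xi 0 l * (a j 0 l)%:~R.
Proof. by rewrite /pairing mxE; apply: eq_bigr => l _; rewrite !mxE. Qed.

Lemma sum_affine_relationR : \sum_j br j = 0.
Proof. by rewrite -rmorph_sum sum_affine_relation. Qed.

Lemma sum_affine_relation_point l : \sum_j br j * (a j 0 l)%:~R = 0.
Proof.
transitivity ((\sum_j A (lift ord0 l) j * b j)%:~R : R); last by rewrite affine_relation_row.
rewrite rmorph_sum; apply: eq_bigr => j _.
by rewrite rmorphM config_matrixS mulrC.
Qed.

Lemma sum_affine_relation_pairing xi : \sum_j br j * pairing xi j = 0.
Proof.
under eq_bigr do rewrite pairingE mulr_sumr.
rewrite exchange_big big1 // => l _ /=.
transitivity (xi 0 l * \sum_j br j * (a j 0 l)%:~R); last first.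
  by rewrite sum_affine_relation_point mulr0.
by rewrite mulr_sumr; apply: eq_bigr => j _; rewrite mulrCA.
Qed.

Let Ar : 'M[R]_(n.+1, n.+2) := map_mx intr A.

Lemma Ar0 j : Ar ord0 j = 1.
Proof. by transitivity ((A ord0 j)%:~R : R); [rewrite mxE|rewrite config_matrix0]. Qed.

Lemma ArS l j : Ar (lift ord0 l) j = (a j 0 l)%:~R.
Proof. by transitivity ((A (lift ord0 l) j)%:~R : R); [rewrite mxE|rewrite config_matrixS]. Qed.

Lemma row_config (c : R) (xi : 'rV[R]_n) j :
  ((row_mx c%:M xi : 'rV[R]_(1 + n)) *m Ar) 0 j = c + pairing xi j.
Proof.
rewrite mxE big_ord_recl pairingE Ar0 mulr1; congr (_ + _).
  rewrite (_ : ord0 = lshift n (ord0 : 'I_1)); last exact: val_inj.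
  by rewrite row_mxEl mxE.
apply: eq_bigr => l _; rewrite ArS (_ : lift ord0 l = rshift 1 l); last exact: val_inj.
by rewrite row_mxEr.
Qed.

Lemma mulmx_col' (v : 'rV[R]_n.+1) j i : (v *m col' j Ar) 0 i = (v *m Ar) 0 (lift j i).
Proof.
by rewrite mxE [in RHS]mxE; apply: eq_bigr => l _; rewrite [col' _ _ _ _]mxE.
Qed.

Lemma config_minor_unit j : col' j Ar \in unitmx.
Proof.
rewrite unitmxE unitfE -map_col' det_map_mx intr_eq0.
by have := b0 j; rewrite /affine_relation mulf_eq0 negb_or => /andP[].
Qed.

(** Already the points other than [a ord0] are affinely independent, the
corresponding minor being [b ord0] up to sign. *)
Lemma affine_span c xi : (forall j, pairing xi j = c) -> xi = 0.
Proof.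
move=> H; have : (row_mx (- c)%:M xi : 'rV[R]_(1 + n)) *m col' ord0 Ar = 0.
  by apply/rowP => i; rewrite [RHS]mxE mulmx_col' row_config H addNr.
move=> /(congr1 (mulmxr (invmx (col' ord0 Ar)))) /=.
rewrite mul0mx mulmxK ?config_minor_unit// => /(congr1 (@rsubmx _ 1 1 n)).
by rewrite row_mxKr linear0.
Qed.

(** An affine function takes prescribed values at the points other than [a ord0];
orthogonality to [b] and [b ord0 != 0] force the remaining value. *)
Lemma affine_interpolation (eta : 'I_n.+2 -> R) : \sum_j br j * eta j = 0 ->
  exists c xi, forall j, eta j = c + pairing xi j.
Proof.
move=> eta0.
pose v : 'rV[R]_(1 + n) := (\row_i eta (lift ord0 i)) *m invmx (col' ord0 Ar).
pose c := lsubmx v 0 0; pose xi := rsubmx v.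
have vE : v = row_mx c%:M xi by rewrite -[LHS]hsubmxK [lsubmx v]mx11_scalar.
have H i : eta (lift ord0 i) = c + pairing xi (lift ord0 i).
  rewrite -row_config -vE.
  have : v *m col' ord0 Ar = \row_i eta (lift ord0 i) by rewrite mulmxKV ?config_minor_unit.
  by move=> /rowP/(_ i); rewrite mulmx_col' [RHS]mxE => ->.
exists c, xi => j; case: (unliftP ord0 j) => [i ->//|->].
have : \sum_j br j * (eta j - (c + pairing xi j)) = 0.
  under eq_bigr do rewrite mulrBr mulrDr.
  rewrite sumrB big_split /= sum_affine_relation_pairing -mulr_suml sum_affine_relationR.
  by rewrite eta0 mul0r addr0 subr0.
rewrite big_ord_recl big1 ?addr0 => [/eqP|i _]; last by rewrite H subrr mulr0.
by rewrite mulf_eq0 intr_eq0 (negbTE (b0 _)) /= subr_eq0 => /eqP.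
Qed.

(** Subtracting the multiple of [b] that agrees at the first point leaves a
dependence between affinely independent points. *)
Lemma affine_dependence_unique (d : 'I_n.+2 -> R) :
  \sum_j d j = 0 -> \sum_j d j *: pt j = 0 ->
  exists s, forall j, d j = s * br j.
Proof.
move=> d0 dp; pose s := d ord0 / br ord0; exists s.
pose e : 'cV[R]_n.+1 := \col_i (d (lift ord0 i) - s * br (lift ord0 i)).
have e0 : d ord0 - s * br ord0 = 0.
  by rewrite /s divfK ?subrr// intr_eq0.
have : col' ord0 Ar *m e = 0.
  apply/colP => i; rewrite [RHS]mxE.
  transitivity (\sum_j Ar i j * (d j - s * br j)).
    rewrite big_ord_recl e0 mulr0 add0r mxE; apply: eq_bigr => l _.
    by rewrite [col' _ _ _ _]mxE [e _ _]mxE.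
  under eq_bigr do rewrite mulrBr.
  rewrite sumrB; case: (unliftP ord0 i) => [l ->|->].
    have -> : \sum_j Ar (lift ord0 l) j * d j = 0.
      move/rowP: dp => /(_ l); rewrite summxE mxE => dp; rewrite -[RHS]dp.
      by apply: eq_bigr => j _; rewrite ArS !mxE mulrC.
    rewrite sub0r; apply/eqP; rewrite oppr_eq0; apply/eqP.
    transitivity (s * \sum_j br j * (a j 0 l)%:~R); last first.
      by rewrite sum_affine_relation_point mulr0.
    by rewrite mulr_sumr; apply: eq_bigr => j _; rewrite ArS mulrC mulrA.
  have -> : \sum_j Ar ord0 j * d j = 0.
    by rewrite -[RHS]d0; apply: eq_bigr => j _; rewrite Ar0 mul1r.
  rewrite sub0r; apply/eqP; rewrite oppr_eq0; apply/eqP.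
  transitivity (s * \sum_j br j); last by rewrite sum_affine_relationR mulr0.
  by rewrite mulr_sumr; apply: eq_bigr => j _; rewrite Ar0 mul1r.
move=> /(congr1 (mulmx (invmx (col' ord0 Ar)))); rewrite mulmx0 mulKmx ?config_minor_unit// => /colP eE j.
case: (unliftP ord0 j) => [i ->|->]; last by apply/eqP; rewrite -subr_eq0 e0.
by apply/eqP; rewrite -subr_eq0; have := eE i; rewrite !mxE => ->.
Qed.

End CircuitAlgebra.

(** * Edge determinants of two-rooted forests *)

Section Forest.
Variables (n : nat) (a : 'I_n.+2 -> 'rV[int]_n).
Local Notation A := (config_matrix a).
Local Notation b := (affine_relation a).
Variables (r0 : 'I_n.+2) (r1' : 'I_n.+1).
Let r1 := lift r0 r1'.
Let rho (i : 'I_n) := lift r0 (lift r1' i).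

(** The second root is written [lift r0 r1'] and the other indices
[lift r0 (lift r1' i)], so that distinctness is built in and the latter are
indexed by ['I_n], like the rows of the system. *)
Lemma nonroot_cases j : [\/ j = r0, j = r1 | exists i, j = rho i].
Proof.
case: (unliftP r0 j) => [j' ->|->]; last by constructor 1.
case: (unliftP r1' j') => [i ->|->]; last by constructor 2.
by constructor 3; exists i.
Qed.

(** The vectors are the edges of a forest with roots [r0] and [r1] whose trees are
stars.  Put the indicator of the tree of [r0] on top of the configuration
matrix and subtract from each non-root column the column of its root: this is
unimodular, and it leaves in the first two rows only the two roots, so the
determinant is that of the edges.  Expanding the original matrix along the
indicator row gives the sum of [b] over the tree. *)
Lemma det_forest (root : 'I_n -> 'I_n.+2) :
  (forall i, (root i == r0) || (root i == r1)) ->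
  (`|\det (\matrix_i (a (rho i) - a (root i)))|%N =
   `|(b r0 + \sum_(i | root i == r0) b (rho i))%R|%N).
Proof.
move=> rootE.
pose inT j := (j == r0) || [exists i, (root i == r0) && (j == rho i)].
pose ind : 'rV[int]_n.+2 := \row_j (inT j)%:R.
pose G : 'M[int]_n.+2 := col_mx ind A : 'M[int]_(1 + n.+1).
have rho_r0 i : rho i != r0 by rewrite eq_sym neq_lift.
have rho_r1 i : rho i != r1 by rewrite (inj_eq lift_inj) eq_sym neq_lift.
have rho_inj : injective rho by move=> i j /lift_inj/lift_inj.
have r10 : r1 != r0 by rewrite eq_sym neq_lift.
have inT0 : inT r0 by rewrite /inT eqxx.
have inT1 : inT r1 = false.
  rewrite /inT (negbTE r10) /=; apply/existsP => -[i /andP[_]].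
  by rewrite eq_sym (negbTE (rho_r1 i)).
have inTrho i : inT (rho i) = (root i == r0).
  rewrite /inT (negbTE (rho_r0 i)) /=; apply/existsP/idP => [[j /andP[jr /eqP/rho_inj->]]//|ir].
  by exists i; rewrite ir eqxx.
have inTroot i : inT (root i) = (root i == r0).
  by have /orP[/eqP->|/eqP->] := rootE i; rewrite ?inT0 ?eqxx ?inT1 ?(negbTE r10).
have dG : \det G = b r0 + \sum_(i | root i == r0) b (rho i).
  rewrite /G det_config_row (bigD1_ord r0)//= mxE inT0 mul1r; congr (_ + _).
  rewrite (bigD1_ord r1')//= mxE inT1 mul0r add0r [RHS]big_mkcond /=.
  by apply: eq_bigr => i _; rewrite mxE inTrho; case: ifP; rewrite ?mul1r ?mul0r.
rewrite -dG.
(* N sends each non-root column to its root; N is nilpotent because roots are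
   not sent anywhere, so 1 - N is unimodular. *)
pose N : 'M[int]_n.+2 := \sum_i delta_mx (root i) (rho i).
have NE M j k : (M *m N) j k = \sum_i (k == rho i)%:R * M j (root i) :> int.
  rewrite mulmx_sumr summxE; apply: eq_bigr => i _.
  rewrite mxE (bigD1 (root i))//= mxE eqxx big1 ?addr0 => [|l /negbTE lr]; first by rewrite mulrC.
  by rewrite mxE lr mulr0.
have NN : N *m N = 0.
  apply/matrixP => j k; rewrite NE mxE big1// => i _.
  rewrite /N summxE big1 ?mulr0// => l _; rewrite mxE.
  have /orP[/eqP->|/eqP->] := rootE i; rewrite [_ == rho l]eq_sym.
    by rewrite (negbTE (rho_r0 l)) andbF.
  by rewrite (negbTE (rho_r1 l)) andbF.
have dU : `|\det (1%:M - N)|%N = 1%N.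
  apply/eqP; suff : (`|\det (1%:M - N)| * `|\det (1%:M + N)| == 1)%N by rewrite muln_eq1 => /andP[].
  by rewrite -abszM -det_mulmx mulmxDr mulmx1 mulmxBl mul1mx NN subr0 subrK det1.
have -> : (`|\det G| = `|\det (G *m (1%:M - N))|)%N by rewrite det_mulmx abszM dU muln1.
set G' := G *m _.
have G'root j k : (forall i, k != rho i) -> G' j k = G j k.
  move=> kr; rewrite /G' mulmxBr mulmx1 [LHS]mxE [X in _ + X]mxE NE big1 ?subr0// => i _.
  by rewrite (negbTE (kr i)) mul0r.
have G'rho j i : G' j (rho i) = G j (rho i) - G j (root i).
  rewrite /G' mulmxBr mulmx1 [LHS]mxE [X in _ + X]mxE NE (bigD1 i)//= eqxx mul1r.
  rewrite big1 ?addr0// => l /negbTE li; by rewrite (inj_eq rho_inj) eq_sym li mul0r.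
have G0 j : G ord0 j = (inT j)%:R.
  transitivity ((col_mx ind A : 'M[int]_(1 + n.+1)) (lshift n.+1 ord0) j); last by rewrite col_mxEu mxE.
  by congr (fun_of_matrix _ _ _); exact: val_inj.
have GS i j : G (lift ord0 i) j = A i j.
  transitivity ((col_mx ind A : 'M[int]_(1 + n.+1)) (rshift 1 i) j); last by rewrite col_mxEd.
  by congr (fun_of_matrix _ _ _); exact: val_inj.
rewrite (expand_det_row G' ord0) (bigD1_ord r0)//= big1 ?addr0; last first.
  move=> j _; case: (unliftP r1' j) => [i ->|->].
    by rewrite G'rho !G0 inTrho inTroot subrr mul0r.
  by rewrite G'root ?G0 -/r1 ?inT1 ?mul0r// => i; rewrite eq_sym.
rewrite G'root ?G0 ?inT0 ?mul1r; last by move=> i; rewrite eq_sym.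
rewrite /cofactor abszM abszX exp1n mul1n.
set G2 := row' _ _.
have G2E i j : G2 i j = G' (lift ord0 i) (lift r0 j) by rewrite !mxE.
rewrite (expand_det_row G2 ord0) (bigD1_ord r1')//= big1 ?addr0; last first.
  move=> i _; rewrite G2E G'rho !GS !config_matrix0 subrr mul0r //.
rewrite G2E G'root; last by move=> i; rewrite eq_sym.
rewrite GS config_matrix0 mul1r /cofactor abszM abszX exp1n mul1n -det_tr.
congr (`|\det _|)%N; apply/matrixP => i l.
by rewrite [RHS]mxE [RHS]mxE [RHS]mxE G2E G'rho !GS !config_matrixS !mxE.
Qed.
End Forest.

(** * The volume of the hull of a circuit *)

Section CircuitVolume.
Variables (n : nat) (a : 'I_n.+2 -> 'rV[int]_n) (R : realType).
Local Notation b := (affine_relation a).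
Local Notation pt := (real_point a R).
Local Notation br j := ((b j)%:~R : R).
Hypothesis b0 : forall j, b j != 0.

Definition facet_edges (j : 'I_n.+2) : 'M[R]_n :=
  \matrix_i (pt (lift j (lift ord0 i)) - pt (lift j ord0)).

(** Subtracting the first row of the homogenized points from the others. *)
Lemma det_difference_matrix (p : 'I_n.+1 -> 'rV[R]_n) :
  \det (\matrix_i (row_mx 1%:M (p i) : 'rV[R]_(1 + n)) : 'M[R]_(1 + n)) =
  \det (\matrix_i (p (lift ord0 i) - p ord0)).
Proof.
set E := \matrix_i (p _ - _).
have -> : (\matrix_i (row_mx 1%:M (p i) : 'rV[R]_(1 + n)) : 'M[R]_(1 + n)) =
   block_mx 1%:M 0 (const_mx 1) 1%:M *m block_mx 1%:M (p ord0) 0 E.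
  rewrite mulmx_block !mul1mx !mul0mx !mulmx1 !addr0.
  apply/row_matrixP => i; rewrite rowK.
  case: (@split_ordP 1 n i) => k ->.
    rewrite rowKu row_row_mx [k]ord1 !row_id; congr (row_mx _ (p _)); exact: val_inj.
  rewrite rowKd row_row_mx; congr row_mx.
    by apply/rowP => l; rewrite !mxE ord1 eqxx.
  rewrite raddfD /= rowK row_mul.
  have -> : row k (const_mx 1 : 'cV[R]_n) = 1%:M by apply/rowP => l; rewrite !mxE ord1 eqxx.
  rewrite mul1mx subrKC; congr (p _); exact: val_inj.
by rewrite det_mulmx det_lblock det_ublock !det1 !mul1r.
Qed.

Lemma det_facet_edges j : `|\det (facet_edges j)| = `|br j|.
Proof.
rewrite /facet_edges -(det_difference_matrix (fun i => pt (lift j i))).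
rewrite /affine_relation rmorphM rmorph_sign normrM normr_sign mul1r -det_map_mx -[in RHS]det_tr.
congr (`|\det _|); apply/matrixP => i k.
transitivity ((config_matrix a k (lift j i))%:~R : R); last first.
  by rewrite [RHS]mxE [RHS]mxE; congr (_%:~R); rewrite [RHS]mxE.
rewrite [LHS]mxE; case: (unliftP ord0 k) => [l ->|->].
  rewrite config_matrixS (_ : lift ord0 l = rshift 1 l); last exact: val_inj.
  by rewrite row_mxEr mxE.
rewrite config_matrix0 (_ : ord0 = lshift n (ord0 : 'I_1)); last exact: val_inj.
by rewrite row_mxEl mxE.
Qed.

Lemma sum_simplex_coord (x : 'rV[R]_n) (j : 'I_n.+2) :
  x *m facet_edges j + pt (lift j ord0) =
  (1 - \sum_i x 0 i) *: pt (lift j ord0) + \sum_i x 0 i *: pt (lift j (lift ord0 i)).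
Proof.
rewrite mulmx_sum_row (eq_bigr (fun i => x 0 i *: pt (lift j (lift ord0 i)) - x 0 i *: pt (lift j ord0))).
  by rewrite sumrB -scaler_suml scalerBl scale1r addrAC -addrA addrC.
by move=> i _; rewrite rowK scalerBr.
Qed.

(** The coordinates in the standard simplex are the weights of all the points but
[a j] and the base point, which takes the remaining weight. *)
Lemma closed_partE j :
  [set x *m facet_edges j + pt (lift j ord0) | x in closed_simplex (1 : R)] =
  [set y | exists w : 'I_n.+2 -> R, [/\ forall i, 0 <= w i, w j = 0, \sum_i w i = 1 & y = \sum_i w i *: pt i]].
Proof.
apply/seteqP; split => y.
- move=> [x [x0 x1] <-].
  pose w i := if unlift j i is Some k then
     (if unlift ord0 k is Some l then x 0 l else 1 - \sum_i x 0 i) else 0.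
  have wj : w j = 0 by rewrite /w unlift_none.
  have w00 : w (lift j ord0) = 1 - \sum_i x 0 i by rewrite /w liftK unlift_none.
  have wl l : w (lift j (lift ord0 l)) = x 0 l by rewrite /w !liftK.
  exists w; split => //.
  + move=> i; rewrite /w; case: (unlift j i) => // k; case: (unlift ord0 k) => [l|]//.
    by rewrite subr_ge0.
  + rewrite (bigD1_ord j)//= wj add0r big_ord_recl w00 (eq_bigr _ (fun l _ => wl l)).
    by rewrite subrK.
  + rewrite sum_simplex_coord (bigD1_ord j)//= wj scale0r add0r big_ord_recl w00.
    by congr (_ + _); apply: eq_bigr => l _; rewrite wl.
- move=> [w [w0 wj w1 ->]].
  have sw : w (lift j ord0) + \sum_i w (lift j (lift ord0 i)) = 1.
    by move: w1; rewrite (bigD1_ord j)//= wj add0r big_ord_recl.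
  exists (\row_i w (lift j (lift ord0 i))).
    split; first by move=> i; rewrite mxE.
    under eq_bigr do rewrite mxE.
    by rewrite -sw lerDr.
  rewrite sum_simplex_coord (bigD1_ord j)//= wj scale0r add0r big_ord_recl.
  under eq_bigr do rewrite mxE; rewrite -sw addrK; congr (_ + _).
  by under eq_bigr do rewrite mxE.
Qed.

Lemma closed_simplex_perm m s (sg : 'S_m) (x : 'rV[R]_m) :
  closed_simplex s x -> closed_simplex s (col_perm sg x).
Proof.
move=> [x0 x1]; split; first by move=> i; rewrite mxE.
have -> // : \sum_i col_perm sg x 0 i = \sum_i x 0 i.
by rewrite [RHS](reindex_inj (@perm_inj _ sg)); apply: eq_bigr => i _; rewrite mxE.
Qed.

Lemma open_simplex_perm m s (sg : 'S_m) (x : 'rV[R]_m) :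
  open_simplex s x -> open_simplex s (col_perm sg x).
Proof.
move=> [x0 x1]; split; first by move=> i; rewrite mxE.
have -> // : \sum_i col_perm sg x 0 i = \sum_i x 0 i.
by rewrite [RHS](reindex_inj (@perm_inj _ sg)); apply: eq_bigr => i _; rewrite mxE.
Qed.

Let closed_part j := [set x *m facet_edges j + pt (lift j ord0) | x in closed_simplex (1 : R)].
Let open_part j := [set x *m facet_edges j + pt (lift j ord0) | x in open_simplex (1 : R)].

Lemma open_partE j y : open_part j y ->
  exists w : 'I_n.+2 -> R, [/\ forall i, i != j -> 0 < w i, w j = 0, \sum_i w i = 1 & y = \sum_i w i *: pt i].
Proof.
move=> [x [x0 x1] <-].
pose w i := if unlift j i is Some k then
   (if unlift ord0 k is Some l then x 0 l else 1 - \sum_i x 0 i) else 0.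
have wj : w j = 0 by rewrite /w unlift_none.
have w00 : w (lift j ord0) = 1 - \sum_i x 0 i by rewrite /w liftK unlift_none.
have wl l : w (lift j (lift ord0 l)) = x 0 l by rewrite /w !liftK.
exists w; split => //.
+ move=> i; rewrite /w eq_sym => /unlift_some[k _ ->]; case: (unlift ord0 k) => [l|]//.
  by rewrite subr_gt0.
+ rewrite (bigD1_ord j)//= wj add0r big_ord_recl w00 (eq_bigr _ (fun l _ => wl l)).
  by rewrite subrK.
+ rewrite sum_simplex_coord (bigD1_ord j)//= wj scale0r add0r big_ord_recl w00.
  by congr (_ + _); apply: eq_bigr => l _; rewrite wl.
Qed.

Local Notation lambda := (@lebesgue_tuple R n).
Local Notation pre S := (@tuple_row R n @^-1` S).

Lemma facet_edges_unit j : facet_edges j \in unitmx.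
Proof. by rewrite unitmxE unitfE -normr_eq0 det_facet_edges normr_eq0 intr_eq0. Qed.

Lemma volume_closed_part j : volume (closed_part j) = (`|br j| / n`!%:R)%:E.
Proof.
rewrite volume_affine_image ?facet_edges_unit//; last first.
- exact: closed_simplex_perm.
- exact: measurable_closed_simplex.
by rewrite volume_closed_simplex// det_facet_edges expr1n mul1r.
Qed.

Lemma volume_open_part j : volume (open_part j) = (`|br j| / n`!%:R)%:E.
Proof.
rewrite volume_affine_image ?facet_edges_unit//; last first.
- exact: open_simplex_perm.
- exact: measurable_open_simplex.
by rewrite volume_open_simplex// det_facet_edges expr1n mul1r.
Qed.

Lemma measurable_affine_image (M : 'M[R]_n) c (Q : set 'rV[R]_n) : M \in unitmx ->
  measurable (pre Q) -> measurable (pre [set x *m M + c | x in Q]).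
Proof.
move=> uM mQ.
rewrite (_ : pre _ = affine (invmx M) (- c *m invmx M) @^-1` (pre Q)).
  exact: measurable_affine_preimage.
apply/seteqP; split => t /=; rewrite row_tupleK -mulmxDl.
  by move=> [x Qx <-]; rewrite addrK mulmxK.
by move=> Qt; exists ((tuple_row t - c) *m invmx M) => //; rewrite mulmxKV// subrK.
Qed.

Lemma measurable_closed_part j : measurable (pre (closed_part j)).
Proof. by apply: measurable_affine_image; [exact: facet_edges_unit|exact: measurable_closed_simplex]. Qed.

Lemma measurable_open_part j : measurable (pre (open_part j)).
Proof. by apply: measurable_affine_image; [exact: facet_edges_unit|exact: measurable_open_simplex]. Qed.

Lemma in_bigsetU (I : finType) (T : Type) (P : pred I) (F : I -> set T) x :
  (\big[setU/set0]_(j | P j) F j) x <-> exists2 j, P j & F j x.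
Proof.
split => [|[j Pj Fj]]; last by rewrite (bigD1 j)//=; left.
by elim/big_rec: _ => //= j X Pj IH [Fj|/IH//]; exists j.
Qed.

(** In a convex combination, subtract the largest multiple of the affine relation
that keeps the weights nonnegative: the weight of some point with [b j > 0]
becomes zero, so the combination lies in the simplex omitting that point. *)
Lemma hull_cover : convex_hull (codom pt) = \big[setU/set0]_(j | 0 < b j) closed_part j.
Proof.
apply/seteqP; split => y.
- move=> /convex_hull_image[w [w0 w1 ->]].
  have [j0 j0P] : exists j0, 0 < b j0.
    apply/existsP; rewrite -[X in is_true X]negbK negb_exists; apply/negP => /forallP H.
    have /eqP := sum_affine_relation a; rewrite -oppr_eq0 -sumrN psumr_eq0.
      by move=> /allP/(_ ord0 (mem_index_enum _)); rewrite oppr_eq0 (negbTE (b0 _)).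
    by move=> j _; rewrite oppr_ge0 leNgt H.
  (* the ratio test: the first weight to vanish *)
  case: (@arg_minP _ R _ j0 (fun j => 0 < b j) (fun j => w j / br j) j0P) => j jP jmin.
  apply/in_bigsetU; exists j => //.
  rewrite /closed_part closed_partE; pose s := w j / br j.
  have bj0 : 0 < br j by rewrite ltr0z.
  have s0 : 0 <= s by rewrite divr_ge0 ?w0// ltW.
  exists (fun i => w i - s * br i); split.
  + move=> i; rewrite subr_ge0; have [ip|ip] := ltP 0 (b i).
      by rewrite -ler_pdivlMr ?ltr0z//; exact: jmin.
    by rewrite (le_trans _ (w0 i _))// mulr_ge0_le0// ?lerz0.
  + by rewrite /s divfK ?subrr// gt_eqF.
  + by rewrite sumrB -mulr_sumr sum_affine_relationR mulr0 subr0.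
  + apply/esym; under eq_bigr do rewrite scalerBl.
    rewrite sumrB; apply/eqP; rewrite subr_eq addrC -subr_eq subrr eq_sym; apply/eqP.
    apply/rowP => l; rewrite summxE [RHS]mxE.
    transitivity (s * \sum_j br j * (a j 0 l)%:~R).
      by rewrite mulr_sumr; apply: eq_bigr => i _; rewrite !mxE mulrA.
    by rewrite sum_affine_relation_point mulr0.
- move=> /in_bigsetU[j jP]; rewrite /closed_part closed_partE => -[w [w0 wj w1 ->]].
  by apply/convex_hull_image; exists w.
Qed.

(** Two representations of a point differ by a multiple [s] of the affine
relation.  Comparing the weights of the two omitted points gives [s > 0] and
[s < 0]. *)
Lemma open_parts_disjoint : trivIset [set j | 0 < b j] (fun j => pre (open_part j)).
Proof.
move=> j j' jP jP' [t [/open_partE[w [w0 wj w1 wE]] /open_partE[w' [w0' wj' w1' wE']]]].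
apply/eqP; apply: contrapT => /negP jj'.
have [||s sE] := @affine_dependence_unique _ a R b0 (fun i => w i - w' i).
- by rewrite sumrB w1 w1' subrr.
- by under eq_bigr do rewrite scalerBl; rewrite sumrB -wE -wE' subrr.
have := sE j; have := sE j'; rewrite wj wj' sub0r subr0 => E' E.
have : 0 < s.
  rewrite -(pmulr_lgt0 (x := br j')) ?ltr0z// -E'; apply: w0; by rewrite eq_sym.
have : s < 0.
  rewrite -(pmulr_llt0 (x := br j)) ?ltr0z// -E oppr_lt0; exact: w0'.
by move=> /lt_trans h /h; rewrite ltxx.
Qed.

Lemma measure_bigsetU_le d (T : measurableType d) (mu : {measure set T -> \bar R})
   (I : finType) (P : pred I) (F : I -> set T) : (forall i, measurable (F i)) ->
   (mu (\big[setU/set0]_(j | P j) F j) <= \sum_(j | P j) mu (F j))%E.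
Proof.
move=> mF; suff [] : measurable (\big[setU/set0]_(j | P j) F j) /\
   (mu (\big[setU/set0]_(j | P j) F j) <= \sum_(j | P j) mu (F j))%E by [].
elim/big_rec2: _ => [|j y X Pj [mX IH]]; first by rewrite measure0.
split; first exact: measurableU.
by apply: le_trans (measureU2 _ _ _) _ => //; exact: leeD.
Qed.

(** The closed simplices cover the hull and the open ones are disjoint inside it;
both families have the same volumes, which squeezes the volume of the hull. *)
Lemma volume_circuit_hull :
  volume (convex_hull (codom pt)) = ((\sum_(j | 0 < b j) b j)%:~R / n`!%:R)%:E.
Proof.
have volE : ((\sum_(j | 0 < b j) b j)%:~R / n`!%:R)%:E =
  (\sum_(j | (0 < b j)%R) volume (closed_part j))%E.
  rewrite (eq_bigr (fun j => (`|br j| / n`!%:R)%:E) (fun j _ => volume_closed_part j)).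
  rewrite sumEFin; congr (_%:E); rewrite rmorph_sum mulr_suml.
  by apply: eq_bigr => j jP; rewrite gtr0_norm// ltr0z.
rewrite volE hull_cover; apply/eqP; rewrite eq_le; apply/andP; split.
  rewrite volumeE (big_morph _ (preimage_setU _) (preimage_set0 _)).
  apply: (measure_bigsetU_le lambda) => j. exact: measurable_closed_part.
rewrite (eq_bigr (fun j => volume (open_part j)) (fun j _ => etrans (volume_closed_part j) (esym (volume_open_part j)))).
rewrite -(measure_bigsetU_ord_cond lambda); last 2 first.
- by move=> j _; exact: measurable_open_part.
- exact: open_parts_disjoint.
rewrite volumeE; apply: le_measure; rewrite ?inE.
- by apply: bigsetU_measurable => j _; exact: measurable_open_part.
- rewrite (big_morph _ (preimage_setU _) (preimage_set0 _)).
  by apply: bigsetU_measurable => j _; exact: measurable_closed_part.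
move=> t /in_bigsetU[j jP] [x [x0 x1] xE]; apply/in_bigsetU; exists j => //.
by exists x => //; split => [i|]; [exact/ltW/x0|exact: ltW].
Qed.

End CircuitVolume.

(** * Sign changes of a sequence *)

Section SignChanges.
Variable T : realDomainType.

Fixpoint last_sign (c : nat -> T) (l : nat) : T :=
  if l is l'.+1 then (if c l' == 0 then last_sign c l' else Num.sg (c l')) else 0.

(** The first nonzero term counts as a crossing, so that there is one more
crossing than sign changes. *)
Definition crossing (c : nat -> T) l := (c l != 0) && (last_sign c l != Num.sg (c l)).

Definition crossings (c : nat -> T) l := count (crossing c) (iota 0 l).

Lemma crossingsS c l : crossings c l.+1 = (crossings c l + crossing c l)%N.
Proof. by rewrite /crossings -addn1 iotaD count_cat /= add0n addn0. Qed.

Lemma leq_crossings c l k : (l <= k)%N -> (crossings c l <= crossings c k)%N.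
Proof. by move=> lk; rewrite /crossings -(subnKC lk) iotaD count_cat leq_addr. Qed.

Lemma last_sign_eq0 c l : (last_sign c l == 0) = all (fun i => c i == 0) (iota 0 l).
Proof.
elim: l => [|l IH]; first by rewrite /= eqxx.
rewrite -addn1 iotaD all_cat /= add0n andbT addn1 /=; case: (eqVneq (c l)) => [_|c0].
  by rewrite andbT.
by rewrite andbF sgr_eq0 (negbTE c0).
Qed.

Lemma last_sign_nz c l : last_sign c l != 0 ->
  exists i, [/\ (i < l)%N, c i != 0, Num.sg (c i) = last_sign c l &
    forall k, (i < k < l)%N -> c k = 0].
Proof.
elim: l => [|l IH] /=; first by rewrite eqxx.
case: (eqVneq (c l)) => [c0|c0] ls0.
  have [i [il ci si ik]] := IH ls0; exists i; split => //; first exact: ltnW.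
  move=> k /andP[ki]; rewrite ltnS leq_eqVlt => /predU1P[->//|kl].
  by apply: ik; rewrite ki.
by exists l; split => // k; rewrite ltnS => /andP[lk]; rewrite leqNgt lk.
Qed.

Lemma last_sign_const c x l : (x < l)%N -> c x != 0 ->
  (forall k, (x < k < l)%N -> ~~ crossing c k) -> last_sign c l = Num.sg (c x).
Proof.
move=> + cx; elim: l => // l IH; rewrite ltnS leq_eqVlt => /predU1P[<- _|xl nc] /=.
  by rewrite (negbTE cx).
have ls : last_sign c l = Num.sg (c x).
  by apply: IH => // k /andP[xk kl]; apply: nc; rewrite xk ltnW.
case: (eqVneq (c l)) => // cl; have := nc l; rewrite xl ltnSn => /(_ isT).
by rewrite /crossing cl /= negbK ls => /eqP.
Qed.

Lemma find_first (S : Type) (x0 : S) (p : pred S) (s : seq S) i :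
  (i < size s)%N -> p (nth x0 s i) -> (forall j, (j < i)%N -> ~~ p (nth x0 s j)) ->
  find p s = i.
Proof.
move=> si pi ni; apply/eqP; rewrite eqn_leq; apply/andP; split; rewrite leqNgt.
  by apply/negP => /(before_find x0); rewrite pi.
apply/negP => /ni; rewrite nth_find// has_find.
by apply: leq_ltn_trans si; rewrite leqNgt; apply/negP => /(before_find x0); rewrite pi.
Qed.

Lemma sgr_neq_lt0 (x y : T) : x != 0 -> y != 0 -> (x * y < 0) = (Num.sg x != Num.sg y).
Proof.
have n11 : (-1 != 1 :> T) by rewrite -subr_eq0 -opprD oppr_eq0 (pnatr_eq0 T 2).
move=> x0 y0; rewrite -[LHS]sgr_lt0 sgrM.
move: x0 y0; rewrite [x != 0]neq_lt [y != 0]neq_lt => /orP[x0|x0] /orP[y0|y0].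
- by rewrite !ltr0_sg// mulrNN mulr1 ltr10 eqxx.
- by rewrite (ltr0_sg x0) (gtr0_sg y0) mulr1 ltrN10 n11.
- by rewrite (gtr0_sg x0) (ltr0_sg y0) mul1r ltrN10 eq_sym n11.
- by rewrite !gtr0_sg// mulr1 ltr10 eqxx.
Qed.

(** The recursion of the sign change indices always jumps to the next crossing,
which has exactly one more crossing before it. *)
Lemma sign_change_index_crossing (c : seq T) s :
  (s < crossings (nth 0%R c) (size c))%N ->
  [/\ (sign_change_index c s < size c)%N, crossing (nth 0 c) (sign_change_index c s) &
      crossings (nth 0 c) (sign_change_index c s) = s].
Proof.
set f := nth 0 c.
have step x : (crossings f x < crossings f (size c))%N ->
    exists l, [/\ (x <= l < size c)%N, crossing f l & forall k, (x <= k < l)%N -> ~~ crossing f k].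
  move=> xc; have ex : exists l, (x <= l < size c)%N && crossing f l.
    have xs : (x <= size c)%N by rewrite leqNgt; apply/negP => /ltnW/leq_crossings-/(_ f); rewrite leqNgt xc.
    move: xc; rewrite {2}/crossings -(subnKC xs) iotaD count_cat add0n -/(crossings f x).
    rewrite -[ltnLHS]addn0 ltn_add2l -has_count => /hasP[l]; rewrite mem_iota subnKC// => lx cl.
    by exists l; rewrite lx cl.
  case: (ex_minnP ex) => l /andP[/andP[xl lc] cl] lmin; exists l; split; rewrite ?xl// => k /andP[xk kl].
  by apply/negP => ck; have := lmin k; rewrite xk ck (ltn_trans kl lc) => /(_ isT); rewrite leqNgt kl.
have stable x l : (x <= l)%N -> (forall k, (x <= k < l)%N -> ~~ crossing f k) -> crossings f l = crossings f x.
  move=> xl H; rewrite /crossings -(subnKC xl) iotaD count_cat add0n -[RHS]addn0; congr (_ + _)%N.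
  apply/eqP; rewrite -leqn0 leqNgt -has_count; apply/hasPn => k; rewrite mem_iota subnKC//; exact: H.
elim: s => [|s IH] sc.
  have [l [/andP[_ lc] cl lmin]] := step 0 sc.
  have l0 : last_sign f l = 0.
    apply/eqP; rewrite -[_ == 0]negbK; apply/negP => /last_sign_nz[i [il ci _ _]].
    have : last_sign f l == 0; last first.
      by rewrite last_sign_eq0 => /allP/(_ i); rewrite mem_iota add0n (negbTE ci) => /(_ il).
    rewrite last_sign_eq0; apply/allP => k; rewrite mem_iota add0n.
    elim/ltn_ind: k => k IHk kl; have := lmin k kl; rewrite /crossing negb_and negbK.
    case: eqVneq => //= fk; rewrite negbK => /eqP ls.
    have : last_sign f k == 0.
      rewrite last_sign_eq0; apply/allP => m; rewrite mem_iota add0n => mk.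
      by apply: IHk => //; exact: ltn_trans kl.
    by rewrite ls sgr_eq0 (negbTE fk).
  have -> : sign_change_index c 0 = l.
    apply: (@find_first _ 0) => //; first by case/andP: cl.
    move=> j jl; rewrite negbK; move/eqP: l0; rewrite last_sign_eq0 => /allP/(_ j).
    by rewrite mem_iota add0n; exact.
  by rewrite lc cl (stable 0%N l).
have [xc cx nx] := IH (ltnW sc); set x := sign_change_index c s in xc cx nx *.
have [|l [/andP[xl lc] cl lmin]] := step x.+1; first by rewrite crossingsS nx cx addn1.
have fx : f x != 0 by case/andP: cx.
have fl : f l != 0 by case/andP: cl.
have between k : (x < k <= l)%N -> last_sign f k = Num.sg (f x).
  move=> /andP[xk kl]; apply: last_sign_const => // m /andP[xm mk].
  by apply: lmin; rewrite xm (leq_trans mk).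
have -> : sign_change_index c s.+1 = l.
  have xl' : (x <= l)%N by exact: ltnW.
  rewrite /= -/x (_ : find _ _ = l - x)%N ?subnKC//.
  apply: (@find_first _ 0).
  - by rewrite size_drop ltn_sub2r.
  - rewrite nth_drop subnKC//.
    rewrite mulrC sgr_neq_lt0//; case/andP: cl => _; by rewrite between ?xl /=.
  - move=> j; rewrite ltn_subRL nth_drop -/(f _) -/(f _) => jl.
    case: (posnP j) => [->|j0]; first by rewrite addn0 -leNgt -expr2 sqr_ge0.
    have xj : (x < x + j)%N by rewrite -[ltnLHS]addn0 ltn_add2l.
    have := lmin (x + j)%N; rewrite xj jl => /(_ isT); rewrite /crossing negb_and negbK.
    rewrite between; last by rewrite xj ltnW.
    move=> /orP[/eqP->|]; first by rewrite mul0r ltxx.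
    rewrite negbK => /eqP sE; have [->|fj] := eqVneq (f (x + j)%N) 0; first by rewrite mul0r ltxx.
    by rewrite sgr_neq_lt0// sE negbK.
by split => //; rewrite (stable x.+1)// crossingsS nx cx addn1.
Qed.

(** Every crossing but the first one is the right end of exactly one sign
variation, whose left end is the last preceding nonzero term. *)
Lemma card_crossings (c : seq T) : ~~ all (fun x => x == 0) c ->
  crossings (nth 0 c) (size c) = (sgnvar c).+1.
Proof.
set f := nth 0 c => cn0.
have -> : crossings f (size c) = #|[set j : 'I_(size c) | crossing f j]%SET|.
  by rewrite cardsE cardE size_filter -(count_map (@nat_of_ord _) (crossing f)) -enumT val_enum_ord.
have ex : has (fun x => x != 0) c by rewrite has_predC.
have exl := ex; rewrite has_find in exl; pose i0 := Ordinal exl.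
have fi0 : f i0 != 0 by exact: (nth_find 0 ex).
have i0min k : (k < i0)%N -> f k = 0.
  by move=> /(before_find 0)/negbT; rewrite negbK => /eqP.
have li0 : last_sign f i0 == 0.
  by rewrite last_sign_eq0; apply/allP => k; rewrite mem_iota add0n => /i0min ->.
rewrite (cardsD1 i0) inE /crossing fi0 (eqP li0) eq_sym sgr_eq0 fi0 add1n; congr _.+1.
pose P := [set ij : 'I_(size c) * 'I_(size c) |
  [&& (ij.1 < ij.2)%N, c`_ij.1 * c`_ij.2 < 0 &
      [forall l : 'I_(size c), (ij.1 < l < ij.2)%N ==> (c`_l == 0)]]]%SET.
rewrite -[sgnvar c]/#|P|.
have PP (ij : 'I_(size c) * 'I_(size c)) : ij \in P -> [/\ (ij.1 < ij.2)%N, f ij.1 != 0, f ij.2 != 0,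
     f ij.1 * f ij.2 < 0 & forall k, (ij.1 < k < ij.2)%N -> f k = 0].
  rewrite inE => /and3P[lt neg0 /forallP zero].
  have neg : f ij.1 * f ij.2 < 0 by exact: neg0.
  split => //.
  - by apply: contraTneq neg => ->; rewrite mul0r ltxx.
  - by apply: contraTneq neg => ->; rewrite mulr0 ltxx.
  - move=> k /andP[ik kj]; have kc := ltn_trans kj (ltn_ord ij.2).
    by have := zero (Ordinal kc); rewrite /= ik kj => /eqP.
have last ij : ij \in P -> last_sign f ij.2 = Num.sg (f ij.1).
  move=> /PP[lt f1 f2 neg zero]; apply: last_sign_const => // k /zero fk.
  by rewrite /crossing fk eqxx.
rewrite -(card_in_imset (f := snd) (D := mem P)); last first.
  move=> [i j] [i' j'] /PP/= [lt f1 f2 neg zero] /PP/= [lt' f1' f2' neg' zero'] jj.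
  rewrite -{j'}jj in lt' f2' neg' zero' *; congr pair; apply/val_inj; apply/eqP.
  case: ltngtP => // ii.
    by have := zero i'; rewrite ii lt' => /(_ isT) /eqP; rewrite (negbTE f1').
  by have := zero' i; rewrite ii lt => /(_ isT) /eqP; rewrite (negbTE f1).
apply: eq_card => j; rewrite !inE; apply/andP/imsetP => [[ji /andP[fj lj]]|[ij ijP ->]].
- have : last_sign f j != 0.
    rewrite last_sign_eq0; apply/negP => /allP H.
    have : ~~ (i0 < j)%N by apply/negP => ij; have := H i0; rewrite mem_iota ij (negbTE fi0) => /(_ isT).
    rewrite -leqNgt leq_eqVlt => /predU1P[/val_inj jE|/i0min]; first by rewrite jE eqxx in ji.
    by move=> /eqP; rewrite (negbTE fj).
  move=> /last_sign_nz[i [ij fi si zero]].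
  exists (Ordinal (ltn_trans ij (ltn_ord j)), j) => //.
  rewrite inE /= ij /= -/f sgr_neq_lt0// si lj /=; apply/forallP => k; apply/implyP => /zero ->.
  by [].
- have [lt f1 f2 neg zero] := PP _ ijP; rewrite f2 last// -sgr_neq_lt0//; split => //.
  by apply: contraNneq f1 => e; apply/eqP; apply: i0min; rewrite -e.
Qed.

(** The indices of sign changes enumerate the crossings; the inverse map counts
the crossings before a given one. *)
Lemma sign_change_index_bij (c : seq T) : ~~ all (fun x => x == 0) c ->
  [/\ forall s, (s <= sgnvar c)%N ->
         (sign_change_index c s < size c)%N && crossing (nth 0 c) (sign_change_index c s),
      {in [pred s | (s <= sgnvar c)%N] &, injective (sign_change_index c)} &
      forall l, (l < size c)%N -> crossing (nth 0 c) l ->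
        exists2 s, (s <= sgnvar c)%N & sign_change_index c s = l].
Proof.
move=> cn0; have cc := card_crossings cn0.
have sP s : (s <= sgnvar c)%N -> _ := fun h => @sign_change_index_crossing c s (etrans (congr1 _ cc) h).
split.
- by move=> s /sP[-> ->].
- by move=> s s'; rewrite !inE => /sP[_ _ e] /sP[_ _ e'] E; rewrite -e -e' E.
- move=> l lc cl; exists (crossings (nth 0 c) l).
    by rewrite -ltnS -cc; apply: leq_trans (leq_crossings _ lc); rewrite crossingsS cl addn1.
  set s := crossings _ _; have [] := sP s.
    by rewrite -ltnS -cc; apply: leq_trans (leq_crossings _ lc); rewrite crossingsS cl addn1.
  move=> lc' cl' e; apply/eqP; case: ltngtP => // ll.
    have := leq_crossings (nth 0 c) ll; rewrite crossingsS cl' addn1 e /s ltnn //.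
  have := leq_crossings (nth 0 c) ll; rewrite crossingsS cl addn1 e /s ltnn //.
Qed.
End SignChanges.

(** * Zeros of a zigzag function *)

Section Zigzag.
Variables (R : realFieldType) (mu : nat -> int) (K : nat) (S : R) (D : nat -> R) (f : R -> R).
Local Notation m l := ((mu l)%:~R : R).

(** The first and the last piece are unbounded, so that the pieces cover the line. *)
Definition piece l (w : R) := ((l == 0)%N || (D l <= w)) && ((l == K)%N || (w <= D l.+1)).

Hypothesis S1 : 1 <= S.
Hypothesis muS : forall l, (l <= K)%N -> `|m l| <= S.
Hypothesis D1 : forall l, 1 <= D l.
Hypothesis DS : forall l, (S + 2) * D l <= D l.+1.
Hypothesis f_piece : forall l w w', (l <= K)%N -> piece l w -> piece l w' -> f w - f w' = m l * (w - w').
Variable l0 : nat.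
Hypothesis l0K : (l0 <= K)%N.
Hypothesis mul0 : mu l0 != 0.
Hypothesis l0min : forall l, (l < l0)%N -> mu l = 0.
Hypothesis f0 : f (D l0.+1 - 1) = 0.

Local Notation del := ((2 * S)^-1).
Local Notation sg l := (Num.sg (m l)).

Lemma gapD l : (S + 1) * D l <= D l.+1 - D l.
Proof. by have := DS l; lra. Qed.

Lemma gapD2 l : 2 <= D l.+1 - D l.
Proof. have d1 := D1 l; have := gapD l; have s1 := S1; have : 0 <= (S - 1) * (D l - 1) by rewrite mulr_ge0 ?subr_ge0. lra. Qed.

Lemma pieceD l : (l <= K)%N -> piece l (D l).
Proof. by move=> _; rewrite /piece lexx orbT /=; have := gapD2 l; case: (l == K) => //= ?; lra. Qed.

Lemma pieceDS l : (l <= K)%N -> piece l (D l.+1).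
Proof. by move=> _; rewrite /piece lexx orbT andbT; have := gapD2 l; case: (l == 0)%N => //= ?; lra. Qed.

Lemma f_step l : (l <= K)%N -> f (D l.+1) = f (D l) + m l * (D l.+1 - D l).
Proof. by move=> lK; rewrite -(f_piece lK (pieceDS lK) (pieceD lK)) subrKC. Qed.

Lemma norm_slope l : mu l != 0 -> 1 <= `|m l|.
Proof. by move=> h; rewrite -intr_norm ler1z -gtz0_ge1 normr_gt0. Qed.

Lemma sg_slope l : sg l * m l = `|m l|.
Proof. by rewrite normrEsg. Qed.

Lemma sg_cases l : mu l != 0 -> sg l = 1 \/ sg l = -1.
Proof. by rewrite -(intr_eq0 R) neq_lt => /orP[h|h]; [right; exact: ltr0_sg|left; exact: gtr0_sg]. Qed.

(** Since [f] is constant before [D l0] and vanishes near the end of the piece [l0],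
its value there is at least one slope unit away from zero. *)
Lemma f_before l : (l <= l0)%N -> sg l0 * f (D l) <= -1.
Proof.
move=> ll; suff H : sg l0 * f (D l0) <= -1.
  have : forall i, (i <= l0)%N -> f (D (l0 - i)%N) = f (D l0).
    elim=> [|i IH] il; first by rewrite subn0.
    rewrite -(IH (ltnW il)) -[in RHS](subnSK il) f_step; last first.
      by apply: leq_trans (leq_subr _ _) l0K.
    by rewrite (l0min (l := l0 - i.+1)) ?mul0r ?addr0// ltn_subrL /= (leq_ltn_trans _ il).
  by move=> /(_ (l0 - l)%N (leq_subr _ _)); rewrite subKn// => ->.
have pw : piece l0 (D l0.+1 - 1).
  by rewrite /piece; have := gapD2 l0; case: (l0 == 0)%N; case: (l0 == K) => //= ?; lra.
have := f_piece l0K pw (pieceD l0K); rewrite f0 sub0r => /(congr1 (fun x => sg l0 * x)).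
rewrite mulrA sg_slope mulrN => E.
have g := gapD2 l0.
have : D l0.+1 - 1 - D l0 <= `|m l0| * (D l0.+1 - 1 - D l0) by rewrite ler_peMl ?norm_slope//; lra.
lra.
Qed.

(** Invariant along the pieces after [l0]: [f] has at a breakpoint the sign of the
last nonzero slope.  The growth condition on [D] makes the contribution of a
piece larger than the accumulated value, bounded by [S * D l]. *)
Lemma f_after l : (l0 < l <= K.+1)%N ->
  1 <= (last_sign mu l)%:~R * f (D l) /\ `|f (D l)| <= S * D l.
Proof.
elim: l => // l IH; rewrite ltnS => /andP[]; rewrite leq_eqVlt => /predU1P[<- _|l0l lK].
  have pw : piece l0 (D l0.+1 - 1).
    by rewrite /piece; have := gapD2 l0; case: (l0 == 0)%N; case: (l0 == K) => //= ?; lra.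
  have := f_piece l0K (pieceDS l0K) pw; rewrite f0 subr0 => ->.
  rewrite (_ : D _ - _ = 1) ?mulr1; last by ring.
  rewrite /= (negbTE mul0) intr_sg sg_slope; split; first exact: norm_slope.
  apply: le_trans (muS l0K) _; have s1 := S1; rewrite ler_peMr ?D1//; lra.
have [{}IH1 IH2] := IH (ltac:(by rewrite l0l ltnW)).
have lK' : (l <= K)%N by [].
have bnd : `|f (D l.+1)| <= S * D l.+1.
  rewrite f_step//; apply: le_trans (ler_normD _ _) _; rewrite normrM.
  have g := gapD2 l; rewrite [X in _ * X]ger0_norm; last by lra.
  have : `|m l| * (D l.+1 - D l) <= S * (D l.+1 - D l) by rewrite ler_wpM2r ?muS//; lra.
  lra.
split=> //=; have [e|n] := eqVneq (mu l) 0; first by rewrite f_step// e mul0r addr0.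
rewrite f_step// intr_sg mulrDr mulrA sg_slope.
have fl : - (S * D l) <= sg l * f (D l).
  apply: lerNnormlW; rewrite normrM normr_sg intr_eq0 n mul1r //.
have g := gapD2 l; have : D l.+1 - D l <= `|m l| * (D l.+1 - D l).
  by rewrite ler_peMl ?norm_slope//; lra.
have := gapD l; have := D1 l; lra.
Qed.

(** On a piece which is not a crossing, the value at the left end and the slope
have compatible signs, so [f] stays away from zero. *)
Lemma noncrossing l : (l <= K)%N -> ~~ crossing mu l ->
  [/\ l = 0%N -> mu l = 0 & exists2 e : R, `|e| = 1 & [/\ 1 <= e * f (D l), 1 <= e * f (D l.+1) & 0 <= e * m l]].
Proof.
move=> lK; rewrite /crossing negb_and !negbK => nc.
have [ll|ll|le] := ltngtP l l0; last first.
- rewrite le in nc; move: nc; rewrite (negbTE mul0) /= => /eqP ls.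
  have : last_sign mu l0 == 0.
    by rewrite last_sign_eq0; apply/allP => i; rewrite mem_iota add0n => /l0min->.
  by rewrite ls sgr_eq0 (negbTE mul0).
- split; first by move=> e0; rewrite e0 in ll.
  have [h1 h2] := f_after (l := l) (ltac:(by rewrite ll ltnW)).
  have h0 : 0 <= (last_sign mu l)%:~R * m l.
    have [->|n] := eqVneq (mu l) 0; first by rewrite mulr0.
    by move: nc; rewrite (negbTE n) /= => /eqP->; rewrite intr_sg sg_slope.
  exists (last_sign mu l)%:~R.
    have : last_sign mu l != 0 by apply: contraTneq h1 => ->; rewrite mul0r -ltNge.
    by move=> /last_sign_nz[i [_ i0 <- _]]; rewrite intr_sg normr_sg intr_eq0 i0.
  split => //; rewrite f_step// mulrDr mulrA; have g := gapD2 l.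
  have : 0 <= (last_sign mu l)%:~R * m l * (D l.+1 - D l) by rewrite mulr_ge0//; lra.
  lra.
- have e := l0min ll; split => //; exists (- sg l0).
    by rewrite normrN normr_sg intr_eq0 mul0.
  by rewrite e mulr0 !mulNr; have := f_before (ltnW ll); have := f_before ll; split => //; lra.
Qed.

Lemma crossing_values l : (l <= K)%N -> crossing mu l ->
  sg l * f (D l) <= -1 /\ 1 <= sg l * f (D l.+1).
Proof.
move=> lK /andP[n ls].
have [ll|ll|le] := ltngtP l l0; last first.
- rewrite le; split; first exact: f_before.
  have [] := f_after (l := l0.+1) (ltac:(by rewrite ltnSn ltnS)).
  by rewrite /= (negbTE mul0) intr_sg.
- have [h1 h2] := f_after (l := l) (ltac:(by rewrite ll ltnW)).
  have [h3 h4] := f_after (l := l.+1) (ltac:(by rewrite ltnW)).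
  split; last by move: h3; rewrite /= (negbTE n) intr_sg.
  have : last_sign mu l != 0 by apply: contraTneq h1 => ->; rewrite mul0r -ltNge.
  move=> /last_sign_nz[i [_ i0 si _]]; rewrite -si in ls h1; move: ls h1; rewrite intr_sg.
  rewrite -sgr_neq_lt0//.
  move=> neg; have e : Num.sg (mu l) = - Num.sg (mu i).
    have /orP[h|h] : (mu i < 0) || (0 < mu i) by rewrite -neq_lt.
      by move: neg; rewrite nmulr_rlt0// => h'; rewrite (ltr0_sg h) (gtr0_sg h') opprK.
    by move: neg; rewrite pmulr_rlt0// => h'; rewrite (gtr0_sg h) (ltr0_sg h').
  by rewrite -!intr_sg e rmorphN mulNr => h; rewrite lerNl opprK.
- by rewrite (l0min ll) in n.
Qed.

(** Small values of [f] occur only well inside the crossing pieces; this is the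
stability of the zeros of [f] under small perturbations. *)
Lemma small_value l w : (l <= K)%N -> piece l w -> `|f w| < 2^-1 ->
  crossing mu l /\ D l + del < w < D l.+1 - del.
Proof.
move=> lK pw fw; have s1 := S1.
have fw1 e : `|e| = 1 -> `|e * f w| < 2^-1 by move=> e1; rewrite normrM e1 mul1r.
case: (boolP (crossing mu l)) => cl; last first.
  have [m0 [e e1 [h1 h2 h3]]] := noncrossing lK cl.
  have := fw1 e e1; rewrite ltr_norml => /andP[_].
  have := f_piece lK pw (pieceD lK) => /(congr1 (fun x => e * x)); rewrite mulrBr mulrA => E.
  have [/eqP l00|l00] := boolP (l == 0)%N; first by move: E; rewrite m0// mulr0 mul0r; lra.
  have Dw : D l <= w by move: pw; rewrite /piece (negbTE l00) /= => /andP[].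
  have : 0 <= e * m l * (w - D l) by rewrite mulr_ge0// subr_ge0.
  lra.
split=> //; have [h1 h2] := crossing_values lK cl; have n : mu l != 0 by case/andP: cl.
have sg1 : `|sg l| = 1 by rewrite normr_sg intr_eq0 n.
have := fw1 _ sg1; rewrite ltr_norml => /andP[g1 g2].
have := f_piece lK pw (pieceD lK) => /(congr1 (fun x => sg l * x)); rewrite mulrBr mulrA sg_slope => E1.
have := f_piece lK (pieceDS lK) pw => /(congr1 (fun x => sg l * x)); rewrite mulrBr mulrA sg_slope => E2.
have m1 := norm_slope n; have mS := muS lK.
have H x : 2^-1 < `|m l| * x -> del < x.
  move=> hx; have x0 : 0 < x by rewrite -(pmulr_rgt0 _ (lt_le_trans ltr01 m1)); apply: lt_trans hx; rewrite invr_gt0.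
  rewrite invfM mulrC ltr_pdivrMl; last by lra.
  by apply: lt_le_trans hx _; rewrite ler_wpM2r// ltW.
by apply/andP; split; [rewrite -ltrBrDl|rewrite ltrBrDl -ltrBrDr]; apply: H; lra.
Qed.

Lemma del_gt0 : 0 < del.
Proof. by have := S1; rewrite invr_gt0; lra. Qed.

Lemma del_le : del <= 2^-1.
Proof. by have s1 := S1; rewrite lef_pV2 ?posrE; lra. Qed.

Lemma slope_del l : (l <= K)%N -> `|m l| * del <= 2^-1.
Proof.
move=> lK; have s1 := S1; rewrite invfM mulrC -mulrA ler_piMr ?invr_ge0; [|lra|].
  by [].
by rewrite mulrC ler_pdivrMr ?mul1r ?muS//; lra.
Qed.

(** Shrinking a crossing piece by [del] at both ends loses at most one half of the
end values, as the slopes are bounded by [S]. *)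
Lemma crossing_window l : (l <= K)%N -> crossing mu l ->
  [/\ D l + del < D l.+1 - del, piece l (D l + del), piece l (D l.+1 - del),
      sg l * f (D l + del) <= - 2^-1 & 2^-1 <= sg l * f (D l.+1 - del)].
Proof.
move=> lK cl; have [h1 h2] := crossing_values lK cl.
have g := gapD2 l; have d1 := del_gt0; have d2 := del_le; have md := slope_del lK.
have p1 : piece l (D l + del).
  by rewrite /piece; apply/andP; split; apply/orP; right; lra.
have p2 : piece l (D l.+1 - del).
  by rewrite /piece; apply/andP; split; apply/orP; right; lra.
split => //; first by lra.
- have := f_piece lK p1 (pieceD lK) => /(congr1 (fun x => sg l * x)).
  by rewrite mulrBr mulrA sg_slope (_ : D l + del - D l = del); [lra|ring].
- have := f_piece lK (pieceDS lK) p2 => /(congr1 (fun x => sg l * x)).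
  by rewrite mulrBr mulrA sg_slope (_ : D l.+1 - (D l.+1 - del) = del); [lra|ring].
Qed.

Lemma crossing_zero l : (l <= K)%N -> crossing mu l ->
  exists w, D l < w < D l.+1 /\ f w = 0.
Proof.
move=> lK cl; have [h1 h2] := crossing_values lK cl.
have n : mu l != 0 by case/andP: cl.
have m1 := norm_slope n; have m0 : m l != 0 by rewrite intr_eq0.
have E := f_step lK; move: (h2); rewrite E mulrDr mulrA sg_slope => h3.
pose w := D l - f (D l) / m l; exists w.
have wE : `|m l| * (w - D l) = - (sg l * f (D l)).
  by rewrite /w -sg_slope; field.
have wE' : `|m l| * (D l.+1 - w) = sg l * f (D l.+1).
  by rewrite /w E -sg_slope; field.
have p1 : 0 < w - D l by rewrite -(pmulr_rgt0 _ (lt_le_trans ltr01 m1)) wE; lra.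
have p2 : 0 < D l.+1 - w by rewrite -(pmulr_rgt0 _ (lt_le_trans ltr01 m1)) wE'; lra.
split; first by lra.
have pw : piece l w by rewrite /piece; apply/andP; split; apply/orP; right; lra.
have := f_piece lK pw (pieceD lK).
by rewrite (_ : m l * (w - D l) = - f (D l)); [lra|rewrite /w; field].
Qed.

End Zigzag.

(** * The tropical function and its logarithmic deformation *)

Section Tropical.
Variables (R : realType) (N : nat) (b : 'I_N -> int) (blk : 'I_N -> nat) (K : nat).
Hypothesis blkK : forall j, (blk j <= K.+1)%N.
Local Notation br j := ((b j)%:~R : R).
Definition prefix_sum l : int := \sum_(j | (blk j <= l)%N) b j.
Definition mass : R := \sum_j `|br j|.

(** Powers of [mass + 2], the growth rate needed by the zigzag argument with the
slope bound [S = mass]. *)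
Definition breakpoint (l : nat) : R := (mass + 2) ^+ l.

(** The limit for large [L] of [ln (y + e^(L D)) / L] with [y = e^(L w)], where [D] is
the breakpoint of the block; the factor is [y] in the first block and 1 in the
last one. *)
Definition tropical_term j (w : R) : R :=
  if blk j == 0%N then w else if blk j == K.+1 then 0 else Num.max w (breakpoint (blk j)).
Definition tropical (kap w : R) : R := \sum_j br j * tropical_term j w - kap.

Lemma mass_ge0 : 0 <= mass. Proof. by apply: sumr_ge0. Qed.

Lemma breakpoint_ge1 l : 1 <= breakpoint l.
Proof. by rewrite exprn_ege1//; have := mass_ge0; lra. Qed.

Lemma breakpointS l : (mass + 2) * breakpoint l <= breakpoint l.+1.
Proof. by rewrite /breakpoint exprS. Qed.

Lemma breakpoint_mono l l' : (l <= l')%N -> breakpoint l <= breakpoint l'.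
Proof. by move=> h; apply: ler_weXn2l => //; have := mass_ge0; lra. Qed.

Lemma prefix_sum_le l : `|(prefix_sum l)%:~R : R| <= mass.
Proof.
rewrite rmorph_sum; apply: le_trans (ler_norm_sum _ _ _) _.
by rewrite /mass [leRHS](bigID (fun j => (blk j <= l)%N)) /= lerDl sumr_ge0.
Qed.

Lemma tropical_termB j l w w' : (l <= K)%N -> piece K breakpoint l w -> piece K breakpoint l w' ->
  tropical_term j w - tropical_term j w' = (blk j <= l)%N%:R * (w - w').
Proof.
move=> lK pw pw'; rewrite /tropical_term.
have [->|b0] := eqVneq (blk j) 0%N; first by rewrite mul1r.
have [->|bK] := eqVneq (blk j) K.+1; first by rewrite leqNgt ltnS lK mul0r subrr.
have bK' : (blk j <= K)%N by move: (blkK j); rewrite leq_eqVlt (negbTE bK).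
have [bl|bl] := leqP (blk j) l.
  have l0 : (l != 0)%N by apply: contraNneq b0 => l0; rewrite l0 leqn0 in bl.
  have H x : piece K breakpoint l x -> breakpoint (blk j) <= x.
    by rewrite /piece (negbTE l0) /= => /andP[+ _]; apply: le_trans; exact: breakpoint_mono.
  by rewrite !max_l ?H// mul1r.
have lnK : l != K by rewrite neq_ltn (leq_trans bl bK').
have H x : piece K breakpoint l x -> x <= breakpoint (blk j).
  by rewrite /piece (negbTE lnK) /= => /andP[_ h]; apply: le_trans h _; exact: breakpoint_mono.
by rewrite !max_r ?H// mul0r subrr.
Qed.

(** On the piece [l] the terms of the blocks up to [l] have slope 1 and the others
slope 0. *)
Lemma tropical_piece kap l w w' : (l <= K)%N -> piece K breakpoint l w -> piece K breakpoint l w' ->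
  tropical kap w - tropical kap w' = (prefix_sum l)%:~R * (w - w').
Proof.
move=> lK pw pw'; rewrite /tropical opprD addrACA subrr addr0 -sumrB.
under eq_bigr do rewrite -mulrBr (tropical_termB _ lK pw pw') mulrA.
rewrite -mulr_suml; congr (_ * _); rewrite rmorph_sum [RHS]big_mkcond /=.
by apply: eq_bigr => j _; case: ifP; rewrite ?mulr1 ?mulr0.
Qed.

Lemma piece_exists w : exists2 l, (l <= K)%N & piece K breakpoint l w.
Proof.
have [h|h] := leP w (breakpoint 1).
  by exists 0%N => //; rewrite /piece /= h orbT.
have ex : exists l, (0 < l <= K.+1)%N && ((l == K.+1) || (w <= breakpoint l)).
  by exists K.+1; rewrite eqxx ltnS leqnn.
case: (ex_minnP ex) => -[//|l] /andP[/= lK /orP wl] lmin.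
exists l => //; rewrite /piece; case: (posnP l) => [l0|l0].
  subst l => /=; case: wl => [/eqP[<-]//|->]; exact: orbT.
apply/andP; split; last by case: wl => [/eqP[->]|->]; rewrite ?eqxx ?orbT.
apply/orP; right; rewrite leNgt; apply/negP => h'.
have := lmin l; rewrite l0 (ltnW lK) (ltW h') orbT => /(_ isT); by rewrite ltnn.
Qed.

Variable L : R.

(** Writing [expR (L * D)] for [t^(-D)], with [L = - ln t], makes the comparison with
the tropical terms a matter of logarithms. *)
Definition coef_u j : R := (blk j != K.+1)%:R.
Definition coef_v j : R := if blk j == 0%N then 0 else if blk j == K.+1 then 1 else expR (L * breakpoint (blk j)).
Definition affine_factor j y : R := coef_u j * y + coef_v j.

(** Its positive zeros correspond to the positive solutions of the system, by the
coordinate [y = u / v]. *)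
Definition logsum (kap y : R) : R := \sum_j br j * ln (affine_factor j y) - L * kap.
Definition logsum_deriv (y : R) : R := \sum_j br j * (coef_u j / affine_factor j y).

Lemma affine_factor_cases j y : [\/ blk j = 0%N /\ affine_factor j y = y, blk j = K.+1 /\ affine_factor j y = 1 |
   [/\ blk j != 0%N, blk j != K.+1 & affine_factor j y = y + expR (L * breakpoint (blk j))]].
Proof.
rewrite /affine_factor /coef_u /coef_v; have [->|b0] := eqVneq (blk j) 0%N.
  by constructor 1; rewrite mul1r addr0.
have [->|bK] := eqVneq (blk j) K.+1; first by constructor 2; rewrite mul0r add0r.
by constructor 3; rewrite mul1r.
Qed.

Lemma affine_factor_gt0 j y : 0 < y -> 0 < affine_factor j y.
Proof.
by move=> y0; case: (affine_factor_cases j y) => [[_ ->]|[_ ->]|[_ _ ->]]//; rewrite addr_gt0// expR_gt0.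
Qed.

Lemma ln_sum_expR (x y : R) : Num.max x y <= ln (expR x + expR y) <= Num.max x y + 1.
Proof.
have p (z z' : R) : 0 < expR z + expR z' by rewrite addr_gt0 ?expR_gt0.
have H (z z' : R) : z' <= z -> z <= ln (expR z + expR z') <= z + 1.
  move=> zz; rewrite -{1}(expRK z) ler_ln ?posrE ?expR_gt0//.
  rewrite lerDl expR_ge0 /= -[leRHS]expRK ler_ln ?posrE ?expR_gt0//.
  rewrite expRD; have e2 : 2 <= expR (1 : R) by have := expR_ge1Dx (1 : R); lra.
  have e0 := expR_gt0 z; have : expR z' <= expR z by rewrite ler_expR.
  have : 0 <= expR z * (expR 1 - 2) by apply: mulr_ge0; [exact: ltW|rewrite subr_ge0].
  lra.
have [xy|xy] := leP x y; first by rewrite addrC; exact: H.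
by apply: H; exact: ltW.
Qed.

Hypothesis L0 : 0 < L.

Lemma ln_affine_factor j w :
  0 <= ln (affine_factor j (expR (L * w))) - L * tropical_term j w <= 1.
Proof.
case: (affine_factor_cases j (expR (L * w))) => [[e ->]|[e ->]|[e e' ->]]; rewrite /tropical_term.
- by rewrite e eqxx expRK subrr lexx ler01.
- by rewrite e /= eqxx ln1 mulr0 subrr lexx ler01.
rewrite (negbTE e) (negbTE e') maxr_pMr ?(ltW L0)//.
by have := ln_sum_expR (L * w) (L * breakpoint (blk j)); lra.
Qed.

(** Each logarithm is within 1 of its tropical limit, the weights [b] having total
mass [mass]. *)
Lemma logsum_tropical kap w :
  `|logsum kap (expR (L * w)) - L * tropical kap w| <= mass.
Proof.
have -> : logsum kap (expR (L * w)) - L * tropical kap w =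
    \sum_j br j * (ln (affine_factor j (expR (L * w))) - L * tropical_term j w).
  rewrite /logsum /tropical; under [RHS]eq_bigr do rewrite mulrBr mulrCA.
  by rewrite sumrB -mulr_sumr; ring.
apply: le_trans (ler_norm_sum _ _ _) _; apply: ler_sum => j _.
rewrite normrM ler_piMr//.
have /andP[h1 h2] := ln_affine_factor j w; rewrite ger0_norm//.
Qed.

Lemma is_derive_logsum kap (y : R) : 0 < y -> is_derive y (1 : R) (logsum kap) (logsum_deriv y).
Proof.
move=> y0.
have H j : is_derive y (1 : R) (fun y => br j * ln (affine_factor j y)) (br j * (coef_u j / affine_factor j y)).
  have l0 := affine_factor_gt0 j y0.
  have dl : is_derive y (1 : R) (affine_factor j) (coef_u j).
    rewrite (_ : affine_factor j = (coef_u j \*: id + cst (coef_v j) : R -> R)); last by apply/funext.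
    apply: is_derive_eq; by rewrite /GRing.scale /= mulr1 addr0.
  have dln : is_derive y (1 : R) (@ln R \o affine_factor j) (coef_u j / affine_factor j y).
    have hl := is_derive1_ln l0.
    by apply: is_derive_eq; rewrite /GRing.scale /= mulrC.
  exact: (is_deriveZ (br j) dln).
rewrite (_ : logsum kap = (\sum_j (fun y => br j * ln (affine_factor j y))) - cst (L * kap)); last first.
  by apply/funext => x; rewrite /logsum [RHS]/= fct_sumE.
rewrite -[logsum_deriv y]subr0.
exact: is_deriveB.
Qed.

Local Notation del := ((2 * mass)^-1).

Lemma ratio_bound (x z : R) : 0 < x -> 0 < z -> x / (x + z) <= x / z.
Proof. by move=> x0 z0; rewrite ler_pM2l// lef_pV2 ?posrE ?addr_gt0// lerDr ltW. Qed.

(** At distance [del] from the breakpoints, a logarithmic derivative is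
exponentially close to 0 or 1. *)
Lemma slope_term j l w : (l <= K)%N -> piece K breakpoint l (w + del) -> piece K breakpoint l (w - del) -> 0 < del ->
  `|expR (L * w) * (coef_u j / affine_factor j (expR (L * w))) - (blk j <= l)%N%:R| <= expR (- (L * del)).
Proof.
move=> lK p1 p2 d0; set y := expR (L * w); have y0 : 0 < y by exact: expR_gt0.
case: (affine_factor_cases j y) => [[e ->]|[e ->]|[e e' ->]]; rewrite /coef_u.
- by rewrite e /= mul1r divff ?gt_eqF// subrr normr0 expR_ge0.
- by rewrite e eqxx /= mul0r mulr0 leqNgt ltnS lK subr0 normr0 expR_ge0.
have bK' : (blk j <= K)%N by move: (blkK j); rewrite leq_eqVlt (negbTE e').
rewrite e' mul1r; set z := expR _; have z0 : 0 < z by exact: expR_gt0.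
have [bl|bl] := leqP (blk j) l.
  have l0 : (l != 0)%N by apply: contraNneq e => l0; rewrite l0 leqn0 in bl.
  have h : breakpoint (blk j) <= w - del.
    by move: p2; rewrite /piece (negbTE l0) /= => /andP[+ _]; apply: le_trans; exact: breakpoint_mono.
  have -> : y * (y + z)^-1 - 1 = - (z / (y + z)).
    by field; rewrite gt_eqF// addr_gt0.
  have zy : 0 <= z / (y + z) by rewrite divr_ge0// ltW// addr_gt0.
  rewrite normrN (ger0_norm zy) [y + z]addrC.
  apply: le_trans (ratio_bound z0 y0) _; rewrite -expRN -expRD ler_expR.
  by rewrite -mulrBr -mulrN ler_pM2l//; lra.
have lnK : l != K by rewrite neq_ltn (leq_trans bl bK').
have h : w + del <= breakpoint (blk j).
  by move: p1; rewrite /piece (negbTE lnK) /= => /andP[_ h]; apply: le_trans h _; exact: breakpoint_mono.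
have zy : 0 <= y / (y + z) by rewrite divr_ge0// ltW// addr_gt0.
rewrite subr0 (ger0_norm zy).
apply: le_trans (ratio_bound y0 z0) _; rewrite -expRN -expRD ler_expR.
by rewrite -mulrBr -mulrN ler_pM2l//; lra.
Qed.

(** In the coordinate [w], the slope of the deformation is close to the slope of
the tropical function. *)
Lemma logsum_deriv_slope l w : (l <= K)%N -> piece K breakpoint l (w + del) -> piece K breakpoint l (w - del) -> 0 < del ->
  `|expR (L * w) * logsum_deriv (expR (L * w)) - (prefix_sum l)%:~R| <= mass * expR (- (L * del)).
Proof.
move=> lK p1 p2 d0.
have -> : expR (L * w) * logsum_deriv (expR (L * w)) - (prefix_sum l)%:~R =
   \sum_j br j * (expR (L * w) * (coef_u j / affine_factor j (expR (L * w))) - (blk j <= l)%N%:R).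
  rewrite /logsum_deriv /prefix_sum rmorph_sum mulr_sumr [X in _ - X]big_mkcond -sumrB.
  apply: eq_bigr => j _; rewrite mulrBr mulrCA; congr (_ - _).
  by case: ifP; rewrite ?mulr1 ?mulr0.
apply: le_trans (ler_norm_sum _ _ _) _; rewrite /mass mulr_suml; apply: ler_sum => j _.
by rewrite normrM ler_wpM2l// slope_term.
Qed.

Hypothesis mass1 : 1 <= mass.
Hypothesis Lbig : 4 * mass ^+ 2 < L.
Variables (l0 : nat) (kap : R).
Hypothesis l0K : (l0 <= K)%N.
Hypothesis mul0 : prefix_sum l0 != 0.
Hypothesis l0min : forall l, (l < l0)%N -> prefix_sum l = 0.
Hypothesis kapE : tropical kap (breakpoint l0.+1 - 1) = 0.

Let muS l (_ : (l <= K)%N) := prefix_sum_le l.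
Let smallv := small_value mass1 muS breakpoint_ge1 breakpointS (tropical_piece kap) l0K mul0 l0min kapE.
Let window := crossing_window mass1 muS breakpoint_ge1 breakpointS (tropical_piece kap) l0K mul0 l0min kapE.

Lemma del_pos : 0 < del.
Proof. exact: del_gt0. Qed.

Lemma L_mass : mass < L / 2.
Proof.
have m1 := mass1; have := Lbig; have : 0 <= (mass - 1) * mass by rewrite mulr_ge0; lra.
by rewrite expr2; lra.
Qed.

(** The bound [4 * mass ^+ 2 < L] is what makes [L * del > 2 * mass] here; together
with [e^x > x] it brings the error below one half. *)
Lemma error_small : mass * expR (- (L * del)) < 2^-1.
Proof.
have m1 := mass1; have m0 : 0 < mass by lra.
have x2 : 2 * mass < L * del.
  by rewrite ltr_pdivlMr; [have := Lbig; rewrite expr2; lra|lra].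
rewrite expRN -ltr_pdivlMl// invf_plt ?posrE ?expR_gt0 ?mulr_gt0 ?invr_gt0//.
by apply: lt_le_trans (expR_ge1Dx _); rewrite invfM !invrK; lra.
Qed.

(** The slopes [prefix_sum l] are integers, so an error below one half cannot
cancel a nonzero one. *)
Lemma slope_sign l w : (l <= K)%N -> prefix_sum l != 0 -> breakpoint l + del < w < breakpoint l.+1 - del ->
  logsum_deriv (expR (L * w)) != 0.
Proof.
move=> lK n /andP[w1 w2]; have d0 := del_pos.
have p1 : piece K breakpoint l (w + del) by rewrite /piece; apply/andP; split; apply/orP; right; lra.
have p2 : piece K breakpoint l (w - del) by rewrite /piece; apply/andP; split; apply/orP; right; lra.
have := logsum_deriv_slope lK p1 p2 d0; apply: contraTneq => ->.
rewrite mulr0 sub0r normrN -ltNge; have := error_small; have := norm_slope R n; lra.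
Qed.

(** At a zero of the deformation the tropical function is small, which locates
the zero by [small_value]. *)
Lemma zero_window y : 0 < y -> logsum kap y = 0 ->
  exists l, [/\ (l <= K)%N, crossing prefix_sum l, breakpoint l + del < ln y / L < breakpoint l.+1 - del & y = expR (L * (ln y / L))].
Proof.
move=> y0 G0; set w := ln y / L.
have yE : y = expR (L * w) by rewrite /w mulrC divfK ?lnK ?posrE// gt_eqF.
have [l lK pw] := piece_exists w.
have fw : `|tropical kap w| < 2^-1.
  have := logsum_tropical kap w; rewrite -yE G0 sub0r normrN normrM (gtr0_norm L0) => h.
  rewrite -(ltr_pM2l L0); apply: le_lt_trans h _; exact: L_mass.
have [cl wl] := smallv lK pw fw.
by exists l.
Qed.

Lemma logsum_cont y : 0 < y -> {for y, continuous (logsum kap)}.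
Proof. by move=> y0; have [d _] := is_derive_logsum kap y0; exact/differentiable_continuous/derivable1_diffP. Qed.

Lemma zero_unique l w1 w2 : (l <= K)%N -> prefix_sum l != 0 -> breakpoint l + del < w1 -> w2 < breakpoint l.+1 - del ->
  w1 < w2 -> logsum kap (expR (L * w1)) = 0 -> logsum kap (expR (L * w2)) = 0 -> False.
Proof.
move=> lK n h1 h2 w12 G1 G2.
have lt12 : expR (L * w1) < expR (L * w2) by rewrite ltr_expR ltr_pM2l.
have pos x : expR (L * w1) <= x -> 0 < x by apply: lt_le_trans; exact: expR_gt0.
have [||x xin E] := @MVT R (logsum kap) logsum_deriv _ _ lt12.
- by move=> x; rewrite in_itv /= => /andP[h _]; apply: is_derive_logsum; exact/pos/ltW.
- apply: continuous_in_subspaceT => x; rewrite inE /= in_itv /= => /andP[h _].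
  exact/logsum_cont/pos.
move: xin; rewrite in_itv /= => /andP[x1 x2]; have x0 := pos _ (ltW x1).
have : logsum_deriv x = 0.
  move/eqP: E; rewrite G1 G2 subrr eq_sym mulf_eq0 subr_eq0 (gt_eqF lt12) orbF.
  by move=> /eqP.
have xE : x = expR (L * (ln x / L)) by rewrite mulrC divfK ?lnK ?posrE// gt_eqF.
set v := ln x / L in xE; apply/eqP; rewrite xE; apply: (slope_sign lK n).
move: x1 x2; rewrite xE !ltr_expR !ltr_pM2l// => x1 x2.
by rewrite (lt_trans h1 x1) (lt_trans x2 h2).
Qed.

(** Tropical values of opposite signs and of size at least one half survive the
deformation, and the intermediate value theorem applies. *)
Lemma crossing_has_zero l : (l <= K)%N -> crossing prefix_sum l ->
  exists y, [/\ 0 < y, logsum kap y = 0 & expR (L * breakpoint l) < y < expR (L * breakpoint l.+1)].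
Proof.
move=> lK cl; have [lt12 p1 p2 h1 h2] := window lK cl.
have n : prefix_sum l != 0 by case/andP: cl.
have lt12' : expR (L * (breakpoint l + del)) < expR (L * (breakpoint l.+1 - del)) by rewrite ltr_expR ltr_pM2l.
have pos x : expR (L * (breakpoint l + del)) <= x -> 0 < x by apply: lt_le_trans; exact: expR_gt0.
have sg1 : `|Num.sg ((prefix_sum l)%:~R : R)| = 1 by rewrite normr_sg intr_eq0 n.
have app w := logsum_tropical kap w.
have appr w : `|Num.sg ((prefix_sum l)%:~R : R) * logsum kap (expR (L * w)) -
    L * (Num.sg ((prefix_sum l)%:~R : R) * tropical kap w)| <= mass.
  by rewrite mulrCA -mulrBr normrM sg1 mul1r.
set s := Num.sg _ in h1 h2 sg1 appr.
have v1 : s * logsum kap (expR (L * (breakpoint l + del))) < 0.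
  have := appr (breakpoint l + del); rewrite ler_norml => /andP[_].
  have : L * (s * tropical kap (breakpoint l + del)) <= L * - 2^-1 by rewrite ler_pM2l.
  have := L_mass; lra.
have v2 : 0 < s * logsum kap (expR (L * (breakpoint l.+1 - del))).
  have := appr (breakpoint l.+1 - del); rewrite ler_norml => /andP[+ _].
  have : L * 2^-1 <= L * (s * tropical kap (breakpoint l.+1 - del)) by rewrite ler_pM2l.
  have := L_mass; lra.
have cG : {within `[expR (L * (breakpoint l + del)), expR (L * (breakpoint l.+1 - del))], continuous (logsum kap)}.
  apply: continuous_in_subspaceT => x; rewrite inE /= in_itv /= => /andP[h _].
  exact/logsum_cont/pos.
have [|y yin G0] := @IVT R (logsum kap) _ _ 0 (ltW lt12') cG.
  rewrite ge_min le_max.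
  have [s1|s1] : s = 1 \/ s = -1 by apply: sg_cases.
    by move: v1 v2; rewrite s1 !mul1r => v1 v2; rewrite (ltW v1) (ltW v2) orbT.
  by move: v1 v2; rewrite s1 !mulN1r oppr_lt0 oppr_gt0 => v1 v2; rewrite (ltW v1) (ltW v2) orbT.
move: yin; rewrite in_itv /= => /andP[y1 y2]; exists y; split => //; first exact: pos.
have d0 := del_pos; apply/andP; split.
  by apply: lt_le_trans y1; rewrite ltr_expR ltr_pM2l//; lra.
by apply: le_lt_trans y2 _; rewrite ltr_expR ltr_pM2l//; lra.
Qed.

(** Inside a crossing window the derivative does not vanish, so each window
contains exactly one zero, which is simple. *)
Lemma logsum_zeros : exists Y : nat -> R,
  [/\ forall l, (l <= K)%N -> crossing prefix_sum l -> 0 < Y l /\ logsum kap (Y l) = 0,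
      forall l l', (l <= K)%N -> crossing prefix_sum l -> (l' <= K)%N -> crossing prefix_sum l' -> Y l = Y l' -> l = l',
      forall y, 0 < y -> logsum kap y = 0 -> exists l, [/\ (l <= K)%N, crossing prefix_sum l & y = Y l] &
      forall y, 0 < y -> logsum kap y = 0 -> logsum_deriv y != 0].
Proof.
have ex l : exists y, (l <= K)%N -> crossing prefix_sum l ->
    [/\ 0 < y, logsum kap y = 0 & expR (L * breakpoint l) < y < expR (L * breakpoint l.+1)].
  have [lK|] := boolP (l <= K)%N; last by exists 0.
  have [cl|] := boolP (crossing prefix_sum l); last by exists 0.
  by have [y h] := crossing_has_zero lK cl; exists y.
have [Y YP] := choice ex; exists Y.
have Ylt l l' : (l < l')%N -> (l <= K)%N -> crossing prefix_sum l -> (l' <= K)%N -> crossing prefix_sum l' -> Y l < Y l'.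
  move=> ll lK cl lK' cl'.
  have [_ _ /andP[_ h1]] := YP l lK cl; have [_ _ /andP[h2 _]] := YP l' lK' cl'.
  apply: lt_trans h1 (le_lt_trans _ h2); rewrite ler_expR ler_pM2l//; exact: breakpoint_mono.
split.
- by move=> l lK cl; have [] := YP l lK cl.
- move=> l l' lK cl lK' cl' E; apply/eqP; case: ltngtP => // ll.
    by have := Ylt _ _ ll lK cl lK' cl'; rewrite E ltxx.
  by have := Ylt _ _ ll lK' cl' lK cl; rewrite E ltxx.
- move=> y y0 G0; have [l [lK cl /andP[w1 w2] yE]] := zero_window y0 G0.
  have n : prefix_sum l != 0 by case/andP: cl.
  exists l; split => //; have [Y0 GY /andP[Y1 Y2]] := YP l lK cl.
  have [l' [lK' cl' /andP[w1' w2'] YE]] := zero_window Y0 GY.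
  have d0 := del_pos.
  have ll : l' = l.
    move: Y1 Y2; rewrite YE !ltr_expR !ltr_pM2l// => Y1 Y2.
    apply/eqP; case: ltngtP => // h.
      have := breakpoint_mono h; lra.
    have := breakpoint_mono h; lra.
  rewrite ll in w1' w2'; rewrite yE in G0; rewrite YE in GY.
  have [h|h|h] := ltgtP (ln y / L) (ln (Y l) / L).
  + by have := zero_unique lK n w1 w2' h G0 GY.
  + by have := zero_unique lK n w1' w2 h GY G0.
  + by rewrite yE YE h.
- move=> y y0 G0; have [l [lK cl w yE]] := zero_window y0 G0.
  by rewrite yE; apply: (slope_sign lK _ w); case/andP: cl.
Qed.

End Tropical.

(** * Multiplicity one at nondegenerate zeros *)

Section LocalRing.
Variables (R : realType) (n : nat) (x : 'rV[R]_n).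
Local Notation P := (mpoly n R).
Local Notation F := {fraction P}.
Local Notation tf := (@FracField.tofrac P).
Local Notation ev p := (meval (x ord0) p).

(** The element [u] of the local ring takes the value [c] at [x].  The relation
form spares choosing a numerator and a denominator. *)
Definition has_value (u : F) (c : R) : Prop :=
  exists p q : P, ev q != 0 /\ u = tf p / tf q /\ ev p = c * ev q.

Lemma tf_neq0 q : ev q != 0 -> tf q != 0.
Proof. by move=> h; rewrite tofrac_eq0; apply: contraNneq h => ->; rewrite meval0. Qed.

Lemma local_ring_value u : local_ring x u <-> exists c, has_value u c.
Proof.
split=> [[p [q [q0 ->]]]|[c [p [q [q0 [-> _]]]]]]; last by exists p, q.
by exists (ev p / ev q), p, q; split => //; rewrite divfK.
Qed.

Lemma has_value_local u c : has_value u c -> local_ring x u.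
Proof. by move=> h; apply/local_ring_value; exists c. Qed.

Lemma has_value_inj u c c' : has_value u c -> has_value u c' -> c = c'.
Proof.
move=> [p [q [q0 [-> pE]]]] [p' [q' [q0' [E pE']]]].
have : tf (p * q') = tf (p' * q).
  rewrite !rmorphM /=; apply/eqP; rewrite -eqr_div ?tf_neq0//; exact/eqP.
move=> /eqP; rewrite tofrac_eq => /eqP /(congr1 (fun p => ev p)).
rewrite !rmorphM /= pE pE' => E'; apply/eqP; rewrite -subr_eq0.
have : (c - c') * (ev q * ev q') == 0.
  rewrite (_ : _ * _ = c * ev q * ev q' - c' * ev q' * ev q); last by ring.
  by rewrite E' subrr.
by rewrite !mulf_eq0 (negbTE q0) (negbTE q0') !orbF.
Qed.

Lemma has_value_tofrac p : has_value (tf p) (ev p).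
Proof. by exists p, 1; rewrite !rmorph1 divr1 mulr1 oner_neq0. Qed.

Lemma has_value_const c : has_value (const_frac n c) c.
Proof. by have := has_value_tofrac (mpolyC n c); rewrite mevalC. Qed.

Lemma has_value0 : has_value 0 0.
Proof. by have := has_value_tofrac 0; rewrite rmorph0 meval0. Qed.

Lemma has_value1 : has_value 1 1.
Proof. by have := has_value_tofrac 1; rewrite rmorph1 rmorph1. Qed.

Lemma has_valueD u v c d : has_value u c -> has_value v d -> has_value (u + v) (c + d).
Proof.
move=> [p [q [q0 [-> pE]]]] [p' [q' [q0' [-> pE']]]].
exists (p * q' + p' * q), (q * q'); rewrite !rmorphM /= mulf_neq0//; split => //; split.
  by rewrite !rmorphD !rmorphM /= addf_div// tf_neq0.
by rewrite !rmorphD !rmorphM /= pE pE'; ring.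
Qed.

Lemma has_valueM u v c d : has_value u c -> has_value v d -> has_value (u * v) (c * d).
Proof.
move=> [p [q [q0 [-> pE]]]] [p' [q' [q0' [-> pE']]]].
exists (p * p'), (q * q'); rewrite !rmorphM /= mulf_neq0//; split => //; split.
  by rewrite mulf_div.
by rewrite pE pE'; ring.
Qed.

Lemma has_valueN u c : has_value u c -> has_value (- u) (- c).
Proof.
move=> h; have := has_valueM (has_value_const (-1)) h.
by rewrite mulN1r /const_frac !rmorphN !rmorph1 mulN1r.
Qed.

Lemma has_valueB u v c d : has_value u c -> has_value v d -> has_value (u - v) (c - d).
Proof. by move=> h h'; apply: has_valueD => //; exact: has_valueN. Qed.

Lemma has_valueV u c : c != 0 -> has_value u c -> has_value (u^-1) (c^-1).
Proof.
move=> c0 [p [q [q0 [-> pE]]]]; exists q, p; rewrite pE mulf_neq0//; split => //; split.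
  by rewrite invf_div.
by rewrite mulKf.
Qed.

Lemma has_value_sum (I : Type) (r : seq I) (Q : pred I) (f : I -> F) (g : I -> R) :
  (forall i, Q i -> has_value (f i) (g i)) ->
  has_value (\sum_(i <- r | Q i) f i) (\sum_(i <- r | Q i) g i).
Proof.
by move=> h; elim/big_rec2: _ => [|i u c Qi IH]; [exact: has_value0|apply: has_valueD => //; exact: h].
Qed.

Lemma has_value_prod (I : Type) (r : seq I) (Q : pred I) (f : I -> F) (g : I -> R) :
  (forall i, Q i -> has_value (f i) (g i)) ->
  has_value (\prod_(i <- r | Q i) f i) (\prod_(i <- r | Q i) g i).
Proof.
by move=> h; elim/big_rec2: _ => [|i u c Qi IH]; [exact: has_value1|apply: has_valueM => //; exact: h].
Qed.

Lemma has_value_sign k : has_value ((-1) ^+ k) ((-1) ^+ k).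
Proof.
elim: k => [|k IH]; rewrite ?expr0 ?exprS; first exact: has_value1.
by apply: has_valueM => //; apply: has_valueN; exact: has_value1.
Qed.

Lemma has_value_det m (A : 'M[F]_m) (B : 'M[R]_m) :
  (forall i j, has_value (A i j) (B i j)) -> has_value (\det A) (\det B).
Proof.
move=> h; apply: has_value_sum => s _; apply: has_valueM; first exact: has_value_sign.
exact: has_value_prod.
Qed.

Lemma has_value_adj m (A : 'M[F]_m) (B : 'M[R]_m) :
  (forall i j, has_value (A i j) (B i j)) ->
  forall i j, has_value ((\adj A) i j) ((\adj B) i j).
Proof.
move=> h i j; rewrite !mxE; apply: has_valueM; first exact: has_value_sign.
by apply: has_value_det => k l; rewrite !mxE.
Qed.

Lemma rescale_parameter (k : fieldType) (v X c t : k) : c != 0 -> t != 0 ->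
  v * (X - c) / t = v * c / t * (X / c - 1).
Proof. by move=> c0 t0; field; rewrite c0 t0. Qed.

Hypothesis x0 : forall l, x ord0 l != 0.

Definition coordinate (l : 'I_n) : F := tf (mpolyX R (mnm1 l)) / const_frac n (x ord0 l).

(** Local parameters normalized by the coordinates of the point, which makes
monomials easy to expand. *)
Definition parameter (l : 'I_n) : F := coordinate l - 1.

Lemma const_frac_neq0 (c : R) : c != 0 -> const_frac n c != 0.
Proof. by move=> c0; rewrite /const_frac tofrac_eq0 mpolyC_eq0. Qed.

Lemma has_value_coordinate l : has_value (coordinate l) 1.
Proof.
rewrite -(divff (x0 l)); apply: has_valueM; last first.
  by apply: has_valueV => //; exact: has_value_const.
by have := has_value_tofrac (mpolyX R (mnm1 l)); rewrite mevalXU.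
Qed.

Lemma has_value_parameter l : has_value (parameter l) 0.
Proof. by rewrite -(subrr 1); apply: has_valueB; [exact: has_value_coordinate|exact: has_value1]. Qed.

(** The value of [u] at [x] and its gradient in the local parameters.  Letting the coefficients be elements
of the local ring, instead of neglecting second-order terms, gives an exact
identity. *)
Definition expansion (u : F) (c : R) (v : 'I_n -> R) : Prop :=
  exists2 G : 'I_n -> F, forall l, has_value (G l) (v l) &
    u = const_frac n c + \sum_l G l * parameter l.

Lemma expansion_value u c v : expansion u c v -> has_value u c.
Proof.
move=> [G GV ->]; rewrite -[c in X in has_value _ X]addr0; apply: has_valueD; first exact: has_value_const.
have e0 : 0 = \sum_l v l * 0 by rewrite big1// => l _; rewrite mulr0.
rewrite [X in has_value _ X]e0.
by apply: has_value_sum => l _; apply: has_valueM => //; exact: has_value_parameter.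
Qed.

Lemma expansion_ext u c v v' : v =1 v' -> expansion u c v -> expansion u c v'.
Proof. by move=> e [G GV uE]; exists G => // l; rewrite -e. Qed.

Lemma expansion1 : expansion 1 1 (fun=> 0).
Proof.
exists (fun=> 0) => [l|]; first exact: has_value0.
by rewrite big1 ?addr0 ?/const_frac ?rmorph1// => l _; rewrite mul0r.
Qed.

Lemma expansion_mul u u' v v' : expansion u 1 v -> expansion u' 1 v' ->
  expansion (u * u') 1 (fun l => v l + v' l).
Proof.
move=> uX [G' GV' uE']; have uV := expansion_value uX; case: uX => G GV uE.
exists (fun l => G l + u * G' l).
  by move=> l; apply: has_valueD => //; rewrite -[v' l]mul1r; exact: has_valueM.
rewrite {1}uE'; under [in RHS]eq_bigr do rewrite mulrDl -mulrA.
rewrite big_split /= -mulr_sumr mulrDr addrA -uE; congr (_ + _).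
by rewrite /const_frac !rmorph1 mulr1.
Qed.

Lemma expansion_inv u v : expansion u 1 v -> expansion (u^-1) 1 (fun l => - v l).
Proof.
move=> uX; have uV := expansion_value uX; case: uX => G GV uE.
have u0 : u != 0.
  apply/eqP => u0; rewrite u0 in uV; have /eqP := has_value_inj has_value0 uV.
  by rewrite eq_sym oner_eq0.
exists (fun l => - (u^-1 * G l)).
  move=> l; apply: has_valueN; rewrite -[v l]mul1r -[X in X * v l]invr1.
  by apply: has_valueM => //; apply: has_valueV => //; exact: oner_neq0.
under eq_bigr do rewrite mulNr -mulrA.
rewrite sumrN -mulr_sumr.
have -> : \sum_l G l * parameter l = u - 1 by rewrite uE /const_frac !rmorph1 addrC addKr.
by rewrite /const_frac !rmorph1 mulrBr mulVf// mulr1 opprB addrCA subrr addr0.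
Qed.

Lemma expansion_expz u v (e : int) : expansion u 1 v -> expansion (u ^ e) 1 (fun l => e%:~R * v l).
Proof.
move=> uX.
have H k : expansion (u ^+ k) 1 (fun l => k%:R * v l).
  elim: k => [|k IH]; first by apply: expansion_ext expansion1 => l; rewrite mul0r.
  rewrite exprS; apply: expansion_ext (expansion_mul uX IH) => l.
  by rewrite -natr1 mulrDl mul1r addrC.
case: e => k; first exact: H.
by rewrite NegzE -exprnN; apply: expansion_ext (expansion_inv (H k.+1)) => l; rewrite rmorphN mulNr.
Qed.

Lemma expansion_prod (I : Type) (r : seq I) (u : I -> F) (v : I -> 'I_n -> R) :
  (forall i, expansion (u i) 1 (v i)) ->
  expansion (\prod_(i <- r) u i) 1 (fun l => \sum_(i <- r) v i l).
Proof.
move=> h; elim: r => [|i r IH].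
  by rewrite big_nil; apply: expansion_ext expansion1 => l; rewrite big_nil.
rewrite big_cons; apply: expansion_ext (expansion_mul (h i) IH) => l.
by rewrite big_cons.
Qed.

Lemma expansion_coordinate l : expansion (coordinate l) 1 (fun k => (k == l)%:R).
Proof.
exists (fun k => (k == l)%:R).
  by move=> k; case: (k == l); [exact: has_value1|exact: has_value0].
rewrite (bigD1 l)//= eqxx mul1r big1 ?addr0; last by move=> k /negbTE->; rewrite mul0r.
by rewrite /const_frac !rmorph1 subrKC.
Qed.

Lemma const_frac_prod (I : Type) (r : seq I) (f : I -> R) :
  const_frac n (\prod_(i <- r) f i) = \prod_(i <- r) const_frac n (f i).
Proof. by rewrite /const_frac rmorph_prod rmorph_prod. Qed.

Lemma const_frac_expz (c : R) (e : int) : c != 0 -> const_frac n (c ^ e) = const_frac n c ^ e.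
Proof.
move=> c0; case: e => k; first by rewrite /const_frac !rmorphXn.
rewrite NegzE -!exprnN.
have ck : c ^+ k.+1 != 0 by rewrite expf_neq0.
apply: (mulfI (const_frac_neq0 ck)); rewrite [in RHS]/const_frac !rmorphXn /= -/(const_frac n c).
rewrite divff ?expf_neq0 ?const_frac_neq0//.
by rewrite /const_frac -!rmorphM divff// !rmorph1.
Qed.

Definition monomial_value (e : 'rV[int]_n) : R := \prod_(l < n) x ord0 l ^ e ord0 l.

(** The linear part of a monomial is its exponent vector, because the coordinates
are normalized to have value 1. *)
Lemma laurent_monomialE (e : 'rV[int]_n) : exists2 G : 'I_n -> F, forall l, has_value (G l) (e 0 l)%:~R &
  laurent_monomial R e = const_frac n (monomial_value e) * (1 + \sum_l G l * parameter l).
Proof.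
have : expansion (\prod_l coordinate l ^ e 0 l) 1 (fun k => (e 0 k)%:~R).
  have := @expansion_prod _ (index_enum 'I_n) (fun l => coordinate l ^ e 0 l) _ (fun l => expansion_expz (e 0 l) (expansion_coordinate l)).
  apply: expansion_ext => k; rewrite (bigD1 k)//= eqxx mulr1 big1 ?addr0// => l lk.
  by rewrite eq_sym (negbTE lk) mulr0.
move=> [G GV GE]; exists G => //.
have -> : 1 + \sum_l G l * parameter l = \prod_l coordinate l ^ e 0 l.
  by rewrite GE /const_frac !rmorph1.
rewrite /laurent_monomial /monomial_value const_frac_prod -big_split /=.
apply: eq_bigr => l _; rewrite const_frac_expz// -expfzMl.
by rewrite /coordinate mulrC divfK ?const_frac_neq0.
Qed.

(** A polynomial minus its value is a combination of the coordinates minus their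
values; this is stable under sums and products, and clear for the generators. *)
Lemma maximal_ideal_parameters u : has_value u 0 ->
  exists2 v : 'I_n -> F, forall l, local_ring x (v l) & u = \sum_l v l * parameter l.
Proof.
have H (p : P) : exists v : 'I_n -> P, p - mpolyC n (ev p) =
    \sum_l v l * (mpolyX R (mnm1 l) - mpolyC n (x ord0 l)).
  pose good (p : P) := exists v : 'I_n -> P, p - mpolyC n (ev p) =
    \sum_l v l * (mpolyX R (mnm1 l) - mpolyC n (x ord0 l)).
  have gC c : good (mpolyC n c).
    by exists (fun=> 0); rewrite mevalC subrr big1// => l _; rewrite mul0r.
  have gD q q' : good q -> good q' -> good (q + q').
    move=> [v vE] [v' vE']; exists (fun l => v l + v' l).
    rewrite rmorphD rmorphD /= opprD addrACA vE vE' -big_split /=.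
    by apply: eq_bigr => l _; rewrite mulrDl.
  have gM q q' : good q -> good q' -> good (q * q').
    move=> [v vE] [v' vE']; exists (fun l => mpolyC n (ev q') * v l + q * v' l).
    under eq_bigr do rewrite mulrDl -!mulrA.
    rewrite big_split /= -!mulr_sumr -vE -vE' !rmorphM /= ; ring.
  have gX l : good (mpolyX R (mnm1 l)).
    exists (fun k => (k == l)%:R); rewrite mevalXU (bigD1 l)//= eqxx mul1r big1 ?addr0// => k /negbTE->.
    by rewrite mul0r.
  have gXn l k : good (mpolyX R (mnm1 l) ^+ k).
    by elim: k => [|k IH]; rewrite ?exprS; [rewrite expr0 -(rmorph1 (@mpolyC n R)); exact: gC|exact: gM].
  rewrite -/(good p) (mpolyE p).
  elim/big_rec: _ => [|m q _ gq]; first by rewrite -(rmorph0 (@mpolyC n R)); exact: gC.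
  apply: gD => //; rewrite -mul_mpolyC; apply: (gM); first exact: gC.
  rewrite mpolyXE_id; elim/big_rec: _ => [|l r _ gr]; last exact: gM.
  by rewrite -(rmorph1 (@mpolyC n R)); exact: gC.
move=> [p [q [q0 [-> pE]]]]; rewrite mul0r in pE.
have [v vE] := H p; exists (fun l => tf (v l) * const_frac n (x ord0 l) / tf q).
  move=> l; apply: has_value_local; apply: has_valueM.
    apply: has_valueM; [exact: has_value_tofrac|exact: has_value_const].
  by apply: has_valueV; [exact: q0|exact: has_value_tofrac].
move: vE; rewrite pE rmorph0 subr0 => ->.
rewrite rmorph_sum mulr_suml; apply: eq_bigr => l _.
rewrite rmorphM rmorphB /= /parameter /coordinate -/(const_frac n _).
have c0 := const_frac_neq0 (x0 l); have t0 := tf_neq0 q0.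
move: c0 t0; rewrite /const_frac; move: (tf (v l)) (tf q) (tf (mpolyC _ _)) (tf (mpolyX _ _)) => vl t c X c0 t0.
exact: (@rescale_parameter F vl X c t c0 t0).
Qed.

(** If the matrix [W] of the equations in the local parameters is invertible at
the point, its adjugate divided by its determinant has entries in the local
ring and expresses the parameters in terms of the equations. *)
Lemma parameters_generated (f : 'I_n -> F) (W : 'M[F]_n) (J : 'M[R]_n) :
  (forall i l, has_value (W i l) (J i l)) -> \det J != 0 ->
  (forall i, f i = \sum_l W i l * parameter l) ->
  forall u, has_value u 0 -> local_ideal x f u.
Proof.
move=> WJ J0 fE u /maximal_ideal_parameters[v vl ->].
have WV := has_value_det WJ; have AV := has_value_adj WJ.
have W0 : \det W != 0.
  apply/eqP => W0; rewrite W0 in WV; have := has_value_inj has_value0 WV.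
  by move/eqP; rewrite eq_sym (negbTE J0).
have zE l : parameter l = \sum_i ((\adj W) l i / \det W) * f i.
  have : \adj W *m (W *m (\col_l parameter l)) = (\det W)%:M *m \col_l parameter l.
    by rewrite mulmxA mul_adj_mx.
  move=> /colP/(_ l); rewrite mul_scalar_mx [RHS]mxE [in RHS]mxE mxE => E.
  rewrite -[LHS](mulKf W0) -E mulr_sumr; apply: eq_bigr => i _.
  rewrite mulrA [_^-1 * _]mulrC fE mxE; congr (_ * _).
  by rewrite [LHS]mxE; apply: eq_bigr => k _; congr (_ * _); rewrite mxE.
exists (fun i => \sum_l v l * ((\adj W) l i / \det W)).
  move=> i; have vV l : exists c, has_value (v l) c by exact/local_ring_value.
  have [c cV] := choice vV; apply: has_value_local.
  apply: has_value_sum => l _; apply: has_valueM; first exact: cV.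
  by apply: has_valueM; [exact: AV|exact: has_valueV WV].
under [LHS]eq_bigr do rewrite zE mulr_sumr.
rewrite exchange_big; apply: eq_bigr => i _ /=.
by rewrite mulr_suml; apply: eq_bigr => l _; rewrite mulrA.
Qed.

(** The ideal of the equations is the maximal ideal, whose residue field is the
ground field. *)
Lemma multiplicity_one (f : 'I_n -> F) (W : 'M[F]_n) (J : 'M[R]_n) :
  (forall i l, has_value (W i l) (J i l)) -> \det J != 0 ->
  (forall i, f i = \sum_l W i l * parameter l) -> local_multiplicity x f 1.
Proof.
move=> WJ J0 fE; exists (fun=> 1) => [_|u /local_ring_value[c uc]].
  exact: has_value_local has_value1.
have fV i : has_value (f i) 0.
  rewrite fE (_ : 0 = \sum_l J i l * 0); last by rewrite big1// => l _; rewrite mulr0.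
  by apply: has_value_sum => l _; apply: has_valueM => //; exact: has_value_parameter.
exists (\row__ c); split.
  rewrite big_ord1 mxE mulr1; apply: (parameters_generated WJ J0 fE).
  by rewrite -(subrr c); apply: has_valueB => //; exact: has_value_const.
move=> d; rewrite big_ord1 mulr1 => -[v vl E].
apply/rowP => k; rewrite mxE ord1.
have vV l : exists c, has_value (v l) c by exact/local_ring_value.
have [g gV] := choice vV.
have E0 : has_value (u - const_frac n (d ord0 ord0)) 0.
  rewrite E (_ : 0 = \sum_i g i * 0); last by rewrite big1// => l _; rewrite mulr0.
  by apply: has_value_sum => l _; exact: has_valueM.
apply/eqP; rewrite -subr_eq0; apply/eqP.
by apply: has_value_inj E0; apply: has_valueB => //; exact: has_value_const.
Qed.

(** The determinant is the Jacobian of the system at [x] for the logarithmic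
derivatives [x_l d/dx_l]. *)
Lemma nondegenerate_multiplicity (a : 'I_n.+2 -> 'rV[int]_n) (C : 'M[R]_(n, n.+2)) :
  (forall i, \sum_j C i j * monomial_value (a j) = 0) ->
  \det (\matrix_(i, l) \sum_j C i j * monomial_value (a j) * (a j 0 l)%:~R) != 0 ->
  local_multiplicity x (system_poly a C) 1.
Proof.
move=> Cx J0.
have /choice[G GP] : forall j, exists G : 'I_n -> F, (forall l, has_value (G l) (a j 0 l)%:~R) /\
  laurent_monomial R (a j) = const_frac n (monomial_value (a j)) * (1 + \sum_l G l * parameter l).
  by move=> j; have [G GV GE] := laurent_monomialE (a j); exists G.
apply: (@multiplicity_one _ (\matrix_(i, l) \sum_j const_frac n (C i j * monomial_value (a j)) * G j l) _ _ J0).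
  move=> i l; rewrite !mxE; apply: has_value_sum => j _.
  by apply: has_valueM; [exact: has_value_const|exact: (GP j).1].
move=> i; rewrite /system_poly.
transitivity (\sum_j const_frac n (C i j * monomial_value (a j)) * (1 + \sum_l G j l * parameter l)).
  by apply: eq_bigr => j _; rewrite (GP j).2 mulrA /const_frac !rmorphM.
under eq_bigr do rewrite mulrDr mulr1.
rewrite big_split /= -[X in X + _](_ : const_frac n (\sum_j C i j * monomial_value (a j)) = _); last first.
  by rewrite /const_frac !rmorph_sum.
rewrite Cx /const_frac !rmorph0 add0r.
under eq_bigr do rewrite mulr_sumr.
rewrite exchange_big; apply: eq_bigr => l _ /=; rewrite mxE mulr_suml.
by apply: eq_bigr => j _; rewrite mulrA.
Qed.

End LocalRing.

(** * The Viro system and its kernel *)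

Section Construction.
Variables (R : realType) (n : nat) (a : 'I_n.+2 -> 'rV[int]_n).
Local Notation b := (affine_relation a).
Local Notation br j := ((b j)%:~R : R).
Hypothesis b0 : forall j, b j != 0.
Variables (blk : 'I_n.+2 -> nat) (K : nat).
Hypothesis blkK : forall j, (blk j <= K.+1)%N.
Variables (r0 : 'I_n.+2) (r1' : 'I_n.+1).
Local Notation r1 := (lift r0 r1').
Local Notation rho i := (lift r0 (lift r1' i)).
Hypothesis blk_r0 : blk r0 = 0%N.
Hypothesis blk_r1 : blk r1 = K.+1.
Variable kappa : R.

(** The row [i] is a trinomial in the columns [rho i], [r0] and [r1], which are the
indices other than the two roots and the roots themselves.  Its coefficient at
a root vanishes if [rho i] lies in the block of the other root. *)
Definition coef_matrix : 'M[R]_(n, n.+2) := \matrix_(i, j)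
  (if j == rho i then -1 else if j == r0 then (blk (rho i) != K.+1)%:R
   else if j == r1 then (blk (rho i) != 0%N)%:R else 0).

(** The exponents turn the row [i] into the equation
[v_rho = t^(kappa b_rho) (u + t^(-D) v)], with [D] the breakpoint of the block of
[rho i]. *)
Definition height_matrix : 'M[R]_(n, n.+2) := \matrix_(i, j)
  (if j == rho i then - (kappa * br (rho i))
   else if (j == r1) && (blk (rho i) != K.+1) then - breakpoint R b (blk (rho i)) else 0).

Lemma rho_r0 (i : 'I_n) : (rho i == r0) = false. Proof. by rewrite eq_sym (negbTE (neq_lift _ _)). Qed.
Lemma rho_r1 (i : 'I_n) : (rho i == r1) = false.
Proof. by rewrite (inj_eq lift_inj) eq_sym (negbTE (neq_lift _ _)). Qed.
Lemma rho_inj : injective (fun i : 'I_n => rho i). Proof. by move=> i j /lift_inj/lift_inj. Qed.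
Lemma r1_r0 : (r1 == r0) = false. Proof. by rewrite eq_sym (negbTE (neq_lift _ _)). Qed.
Lemma r0_rho (i : 'I_n) : (r0 == rho i) = false. Proof. by rewrite eq_sym rho_r0. Qed.
Lemma r1_rho (i : 'I_n) : (r1 == rho i) = false. Proof. by rewrite eq_sym rho_r1. Qed.
Lemma r0_r1 : (r0 == r1) = false. Proof. by rewrite eq_sym r1_r0. Qed.

Lemma coef_rho i : coef_matrix i (rho i) = -1. Proof. by rewrite mxE eqxx. Qed.
Lemma coef_r0 i : coef_matrix i r0 = (blk (rho i) != K.+1)%:R.
Proof. by rewrite mxE r0_rho eqxx. Qed.
Lemma coef_r1 i : coef_matrix i r1 = (blk (rho i) != 0%N)%:R.
Proof. by rewrite mxE r1_rho r1_r0 eqxx. Qed.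
Lemma coef_other i l : l != i -> coef_matrix i (rho l) = 0.
Proof. by move=> li; rewrite mxE (inj_eq rho_inj) (negbTE li) rho_r0 rho_r1. Qed.

Lemma sum_roots (V : nmodType) (f : 'I_n.+2 -> V) :
  \sum_j f j = f r0 + f r1 + \sum_i f (rho i).
Proof. by rewrite (bigD1_ord r0)//= (bigD1_ord r1')//= addrA. Qed.

Section Deformation.
Variables (t L : R).
Hypothesis tE : t = expR (- L).
Local Notation Ct := (viro_matrix coef_matrix height_matrix t).

Lemma powRt h : t `^ h = expR (- (L * h)).
Proof. by rewrite tE -expRM mulNr. Qed.

Lemma viro_rho i : Ct i (rho i) = - expR (L * (kappa * br (rho i))).
Proof. by rewrite mxE coef_rho powRt mxE eqxx mulrN opprK mulN1r. Qed.

Lemma viro_r0 i : Ct i r0 = coef_u R blk K (rho i).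
Proof. by rewrite mxE coef_r0 powRt mxE r0_rho r0_r1 /= mulr0 oppr0 expR0 mulr1. Qed.

Lemma viro_r1 i : Ct i r1 = coef_v b blk K L (rho i).
Proof.
rewrite mxE coef_r1 powRt mxE r1_rho eqxx /= /coef_v.
case: (eqVneq (blk (rho i)) 0%N) => [_|e0]; first by rewrite mul0r.
case: (eqVneq (blk (rho i)) K.+1) => [_|e1] /=; rewrite mul1r; first by rewrite mulr0 oppr0 expR0.
by rewrite mulrN opprK.
Qed.

Lemma viro_other i l : l != i -> Ct i (rho l) = 0.
Proof. by move=> li; rewrite mxE coef_other// mul0r. Qed.

(** The factor [t^(kappa b_j)], omitted at the two roots, where the kernel
coordinates are the parameters themselves. *)
Definition gauge j : R := if (j == r0) || (j == r1) then 1 else expR (- (L * (kappa * br j))).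

Lemma gauge_gt0 j : 0 < gauge j.
Proof. by rewrite /gauge; case: ifP => _; rewrite ?ltr01 ?expR_gt0. Qed.

Lemma gauge_rho i : gauge (rho i) = expR (- (L * (kappa * br (rho i)))).
Proof. by rewrite /gauge rho_r0 rho_r1. Qed.

Local Notation alp j := (coef_u R blk K j).
Local Notation bet j := (coef_v b blk K L j).

Lemma root_params : [/\ alp r0 = 1, bet r0 = 0, alp r1 = 0 & bet r1 = 1].
Proof. by rewrite /coef_u /coef_v blk_r0 blk_r1 /= eqxx. Qed.

Lemma coef_uv_gt0 j : 0 < alp j + bet j.
Proof. by have := affine_factor_gt0 b blk K L j (ltr01 : 0 < (1 : R)); rewrite /affine_factor mulr1. Qed.

Lemma row_equation (v : 'I_n.+2 -> R) i :
  \sum_j Ct i j * v j = 0 <-> v (rho i) = gauge (rho i) * (alp (rho i) * v r0 + bet (rho i) * v r1).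
Proof.
have -> : \sum_j Ct i j * v j = alp (rho i) * v r0 + bet (rho i) * v r1 - expR (L * (kappa * br (rho i))) * v (rho i).
  rewrite sum_roots viro_r0 viro_r1; congr (_ + _).
  rewrite (bigD1 i)//= viro_rho big1 ?addr0 ?mulNr// => l li.
  by rewrite viro_other// mul0r.
rewrite gauge_rho expRN; split => [/eqP|->].
  by rewrite subr_eq0 => /eqP->; rewrite mulKf// gt_eqF// expR_gt0.
by rewrite mulVKf ?subrr// gt_eqF// expR_gt0.
Qed.

Lemma kernel_equation (v : 'I_n.+2 -> R) :
  (forall i, \sum_j Ct i j * v j = 0) <-> (forall j, v j = gauge j * (alp j * v r0 + bet j * v r1)).
Proof.
have [a0 e0 a1 e1] := root_params.
split => [H j|H i]; last by apply/row_equation.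
have [->|->|[i ->]] := nonroot_cases r0 r1' j.
- by rewrite a0 e0 mul1r mul0r addr0 /gauge eqxx mul1r.
- by rewrite a1 e1 mul1r mul0r add0r /gauge eqxx orbT mul1r.
- exact/row_equation.
Qed.

(** Its columns are the kernel vectors for [(u, v) = (1, 0)] and [(0, 1)]. *)
Definition gale : 'M[R]_(n.+2, 2) :=
  \matrix_(j, c) (gauge j * (if c == 0 then alp j else bet j)).

Lemma gale_mul (w : 'cV[R]_2) j : (gale *m w) j 0 = gauge j * (alp j * w 0 0 + bet j * w 1 0).
Proof.
have l1 : lift ord0 ord0 = 1 :> 'I_2 by exact: val_inj.
by rewrite mxE big_ord_recl big_ord1 l1 [gale j _]mxE [gale j _]mxE /= mulrDr !mulrA.
Qed.

Lemma gale_kernel_basis : kernel_basis Ct gale.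
Proof.
have [a0 e0 a1 e1] := root_params.
have root0 (w : 'cV[R]_2) : (gale *m w) r0 0 = w 0 0.
  by rewrite gale_mul a0 e0 mul1r mul0r addr0 /gauge eqxx mul1r.
have root1 (w : 'cV[R]_2) : (gale *m w) r1 0 = w 1 0.
  by rewrite gale_mul a1 e1 mul1r mul0r add0r /gauge eqxx orbT mul1r.
move=> v; split => [Cv|[w [-> _]]].
  have Cv' i : \sum_j Ct i j * v j 0 = 0.
    by move/colP/(_ i): Cv; rewrite [LHS]mxE [RHS]mxE.
  exists (\col_c (if c == 0 then v r0 0 else v r1 0)); split.
    by apply/colP => j; rewrite gale_mul !mxE /=; exact: (kernel_equation (fun j => v j 0)).1.
  move=> w vE; apply/colP => c; rewrite mxE vE root0 root1.
  by case: (unliftP 0 c) => [c' ->|->]//=; rewrite [c']ord1 /=; congr (w _ _); apply: val_inj.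
apply/colP => i; rewrite [LHS]mxE [RHS]mxE.
apply: (kernel_equation (fun j => (gale *m w) j 0)).2 => j.
by rewrite root0 root1 gale_mul.
Qed.

Lemma viro_rank : \rank Ct = n.
Proof.
apply/eqP; rewrite -/(row_free Ct); apply: inj_row_free => v vC.
apply/rowP => i; move/rowP/(_ (rho i)): vC; rewrite [in X in X -> _]mxE [X in _ = X -> _]mxE => E.
rewrite mxE; move: E; rewrite (bigD1 i)//= big1 ?addr0 => [|l li]; last by rewrite viro_other ?mulr0// eq_sym.
by move/eqP; rewrite viro_rho mulf_eq0 oppr_eq0 (gt_eqF (expR_gt0 _)) orbF => /eqP.
Qed.

Lemma viro_cone : zero_in_open_cone Ct.
Proof.
have [a0 e0 a1 e1] := root_params.
exists (fun j => gauge j * (alp j + bet j)); split.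
  by move=> j; rewrite mulr_gt0 ?gauge_gt0 ?coef_uv_gt0.
apply/colP => i; rewrite summxE [RHS]mxE.
under eq_bigr do rewrite mxE mxE mulrC.
apply: (kernel_equation (fun j => gauge j * (alp j + bet j))).2 => j.
by rewrite a0 e0 a1 e1 addr0 add0r /gauge !eqxx orbT /= !mulr1.
Qed.

Hypothesis L0 : 0 < L.

Lemma det_mx22 (k : comNzRingType) (M : 'M[k]_2) : \det M = M 0 0 * M 1 1 - M 0 1 * M 1 0.
Proof.
have l1 : lift ord0 ord0 = 1 :> 'I_2 by exact: val_inj.
have l0 : lift (1 : 'I_2) ord0 = 0 :> 'I_2 by exact: val_inj.
rewrite (expand_det_row _ 0) big_ord_recl big_ord1 /cofactor !det_mx11 l1.
have -> : row' 0 (col' ord0 M) 0 0 = M 1 1.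
  by rewrite mxE mxE; congr (M _ _); exact: val_inj.
have -> : row' 0 (col' 1 M) 0 0 = M 1 0.
  by rewrite mxE mxE; congr (M _ _); exact: val_inj.
by rewrite expr0 mul1r expr1 mulN1r mulrN.
Qed.

Lemma det_gale i j : det_rows gale i j = gauge i * gauge j * (alp i * bet j - alp j * bet i).
Proof.
rewrite /det_rows det_mx22.
have u c : (col_mx (row i gale) (row j gale) : 'M[R]_2) 0 c = gale i c.
  transitivity ((col_mx (row i gale) (row j gale)) (lshift 1 0) c); last by rewrite col_mxEu mxE.
  by congr (fun_of_matrix _ _ _); exact: val_inj.
have v c : (col_mx (row i gale) (row j gale) : 'M[R]_2) 1 c = gale j c.
  transitivity ((col_mx (row i gale) (row j gale)) (rshift 1 0) c); last by rewrite col_mxEd mxE.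
  by congr (fun_of_matrix _ _ _); exact: val_inj.
by rewrite !u !v !mxE /=; ring.
Qed.

Lemma breakpoint_lt l l' : (l < l')%N -> breakpoint R b l < breakpoint R b l'.
Proof.
move=> ll; apply: lt_le_trans (breakpoint_mono R b ll).
have := breakpointS R b l; have := breakpoint_ge1 R b l; have := mass_ge0 R b => m0 d1.
have : 0 <= mass R b * breakpoint R b l by rewrite mulr_ge0//; lra.
lra.
Qed.

(** The slopes [coef_v / coef_u] are 0, then exponentials of increasing
breakpoints, and finally infinite. *)
Lemma det_gale_lt i j : (blk i < blk j)%N -> 0 < det_rows gale i j.
Proof.
move=> ij; rewrite det_gale !mulr_gt0 ?gauge_gt0// subr_gt0.
have jK := blkK j.
have iK : (blk i == K.+1) = false by apply/negbTE; rewrite neq_ltn (leq_trans ij jK).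
have j0 : (blk j == 0%N) = false by apply/negbTE; rewrite -lt0n (leq_ltn_trans _ ij).
have ai : alp i = 1 by rewrite /coef_u iK.
case: (eqVneq (blk j) K.+1) => [jK1|jK1].
  have aj : alp j = 0 by rewrite /coef_u jK1 eqxx.
  have bj : bet j = 1 by rewrite /coef_v jK1 eqxx.
  by rewrite ai aj bj mul0r mul1r ltr01.
have aj : alp j = 1 by rewrite /coef_u jK1.
have bj : bet j = expR (L * breakpoint R b (blk j)) by rewrite /coef_v j0 (negbTE jK1).
rewrite ai aj !mul1r bj /coef_v iK; case: ifP => _; first exact: expR_gt0.
by rewrite ltr_expR ltr_pM2l// breakpoint_lt.
Qed.

Lemma det_gale_eq0 i j : (det_rows gale i j == 0) = (blk i == blk j).
Proof.
have anti : det_rows gale i j = - det_rows gale j i by rewrite !det_gale; ring.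
case: ltngtP => ij; last by rewrite det_gale /coef_u /coef_v ij; apply/eqP; ring.
  by rewrite gt_eqF// det_gale_lt.
by rewrite anti oppr_eq0 gt_eqF// det_gale_lt.
Qed.

Local Notation N2 := (\sum_i br (rho i) ^+ 2).
Variable kap : R.
Hypothesis kapE : kap = kappa * N2.
Local Notation logs := (logsum b blk K L kap).

(** The gauge contributes the constant term [kap] of the tropical function: this is
how [kappa] is tuned. *)
Lemma sum_log_gauge : \sum_j br j * ln (gauge j) = - (L * kap).
Proof.
rewrite sum_roots /gauge !eqxx orbT /= ln1 !mulr0 !add0r kapE mulrA mulr_sumr -sumrN.
by apply: eq_bigr => i _; rewrite rho_r0 rho_r1 expRK expr2; ring.
Qed.

Lemma logsum_gauge y : 0 < y -> logs y = \sum_j br j * ln (gauge j * affine_factor b blk K L j y).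
Proof.
move=> y0; rewrite /logsum -sum_log_gauge addrC -big_split /=; apply: eq_bigr => j _.
by rewrite lnM ?posrE ?gauge_gt0 ?affine_factor_gt0// mulrDr.
Qed.

Definition log_row (x : 'rV[R]_n) : 'rV[R]_n := \row_l ln (x 0 l).
Definition exp_row (xi : 'rV[R]_n) : 'rV[R]_n := \row_l expR (xi 0 l).

Lemma expR_intmul (r : R) (e : int) : expR r ^ e = expR (r * e%:~R).
Proof.
case: e => k; first by rewrite -exprnP -expRM_natl mulrC.
by rewrite NegzE -exprnN -expRM_natl -expRN rmorphN mulrN mulrC.
Qed.

Lemma monomial_exp xi j : monomial_value (exp_row xi) (a j) = expR (pairing a xi j).
Proof.
rewrite pairingE expR_sum; apply: eq_bigr => l _.
by rewrite mxE expR_intmul.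
Qed.

Lemma log_rowK (x : 'rV[R]_n) : (forall l, 0 < x 0 l) -> exp_row (log_row x) = x.
Proof. by move=> x0; apply/rowP => l; rewrite !mxE lnK// posrE. Qed.

Lemma monomial_log (x : 'rV[R]_n) j : (forall l, 0 < x 0 l) -> monomial_value x (a j) = expR (pairing a (log_row x) j).
Proof. by move=> x0; rewrite -{1}(log_rowK x0) monomial_exp. Qed.

Lemma positive_solutionE (x : 'rV[R]_n) : positive_solution a Ct x <->
  (forall l, 0 < x 0 l) /\ (forall j, monomial_value x (a j) =
     gauge j * (alp j * monomial_value x (a r0) + bet j * monomial_value x (a r1))).
Proof.
split=> -[x0 H]; split => //.
  exact: (kernel_equation (fun j => monomial_value x (a j))).1.
exact: (kernel_equation (fun j => monomial_value x (a j))).2.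
Qed.

Definition ratio (x : 'rV[R]_n) := monomial_value x (a r0) / monomial_value x (a r1).

Lemma solution_affine_factor x j : positive_solution a Ct x ->
  [/\ 0 < monomial_value x (a r1), 0 < ratio x &
   monomial_value x (a j) = monomial_value x (a r1) * (gauge j * affine_factor b blk K L j (ratio x))].
Proof.
move=> /positive_solutionE[x0 H].
have p i : 0 < monomial_value x (a i) by rewrite monomial_log// expR_gt0.
split; rewrite ?divr_gt0//.
by rewrite H /affine_factor /ratio; field; rewrite gt_eqF.
Qed.

(** The logarithms of the monomials are a linear form in the exponents, hence
orthogonal to the affine relation. *)
Lemma solution_zero x : positive_solution a Ct x -> logs (ratio x) = 0.
Proof.
move=> xs; have [x0 _] := xs; have [m0 y0 _] := solution_affine_factor r0 xs; rewrite logsum_gauge//.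
transitivity (\sum_j br j * pairing a (log_row x) j - (\sum_j br j) * ln (monomial_value x (a r1))).
  rewrite mulr_suml -sumrB; apply: eq_bigr => j _; rewrite -mulrBr; congr (_ * _).
  have [_ _ xj] := solution_affine_factor j xs.
  rewrite -[pairing _ _ _]expRK -monomial_log// xj !lnM ?posrE ?mulr_gt0 ?gauge_gt0 ?affine_factor_gt0//.
  by ring.
by rewrite sum_affine_relation_pairing sum_affine_relationR mul0r subr0.
Qed.

(** Two solutions with the same ratio have proportional monomial vectors, and the
points [a j] affinely span the space. *)
Lemma ratio_inj x x' : positive_solution a Ct x -> positive_solution a Ct x' -> ratio x = ratio x' -> x = x'.
Proof.
move=> xs xs' E; have [x0 _] := xs; have [x0' _] := xs'.
rewrite -(log_rowK x0) -(log_rowK x0'); congr exp_row; apply/eqP; rewrite -subr_eq0; apply/eqP.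
have [m0 _ _] := solution_affine_factor r0 xs; have [m0' _ _] := solution_affine_factor r0 xs'.
apply: (affine_span b0 (c := ln (monomial_value x (a r1)) - ln (monomial_value x' (a r1)))) => j.
rewrite /pairing mulmxBl mxE [X in _ + X]mxE -/(pairing a _ _) -/(pairing a _ _).
have [_ y0 e] := solution_affine_factor j xs; have [_ y0' e'] := solution_affine_factor j xs'.
rewrite -[pairing a (log_row x) j]expRK -[pairing a (log_row x') j]expRK -!monomial_log// e e' -E.
by rewrite !lnM ?posrE ?mulr_gt0 ?gauge_gt0 ?affine_factor_gt0//; ring.
Qed.

(** At a zero the logarithms of the kernel vector are orthogonal to the affine
relation, hence interpolated by an affine function; its linear part is the
logarithm of the solution and its constant the common scale. *)
Lemma zero_solution y : 0 < y -> logs y = 0 -> exists2 x, positive_solution a Ct x & ratio x = y.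
Proof.
move=> y0 G0; have [a0 e0 a1 e1] := root_params.
have [|c [xi H]] := @affine_interpolation _ a R b0 (fun j => ln (gauge j * affine_factor b blk K L j y)).
  by rewrite -logsum_gauge.
have E j : monomial_value (exp_row xi) (a j) = expR (- c) * (gauge j * affine_factor b blk K L j y).
  rewrite monomial_exp -[X in _ * X]lnK ?posrE ?mulr_gt0 ?gauge_gt0 ?affine_factor_gt0//.
  by rewrite -expRD H addKr.
have Er0 : monomial_value (exp_row xi) (a r0) = expR (- c) * y.
  by rewrite E /affine_factor a0 e0 /gauge eqxx !mul1r addr0.
have Er1 : monomial_value (exp_row xi) (a r1) = expR (- c).
  by rewrite E /affine_factor a1 e1 /gauge eqxx orbT mul1r mul0r add0r mulr1.
exists (exp_row xi); last by rewrite /ratio Er0 Er1 mulrC mulKf// gt_eqF// expR_gt0.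
apply/positive_solutionE; split; first by move=> l; rewrite mxE expR_gt0.
by move=> j; rewrite Er0 Er1 E /affine_factor; ring.
Qed.

(** A tangent vector [th] killed by the Jacobian gives the kernel vector
[x^(a_j) <th, a_j>].  Dividing by [x^(a_j)] shows that [<th, a_j>] is a constant
plus [p'] times the logarithmic derivative of the [j]-th factor; pairing with
the affine relation leaves [p'] times the derivative of [logsum], so [p' = 0]
and the form [th] is constant on the points. *)
Lemma solution_multiplicity x : positive_solution a Ct x ->
  logsum_deriv b blk K L (ratio x) != 0 -> local_multiplicity x (system_poly a Ct) 1.
Proof.
move=> xs G'; have [x0 Cx] := xs.
have x0' l : x ord0 l != 0 by rewrite gt_eqF.
apply: (nondegenerate_multiplicity x0') => //.
set J := \matrix_(i, l) _; apply/negP => /eqP; rewrite -det_tr => /eqP/det0P[th th0 E].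
move/negP: th0; apply; apply/eqP.
have V i : \sum_j Ct i j * (monomial_value x (a j) * pairing a th j) = 0.
  have Ei : (th *m J^T) 0 i = 0 by rewrite E mxE.
  rewrite -[RHS]Ei [RHS]mxE.
  under [RHS]eq_bigr do rewrite mxE mxE mulr_sumr.
  rewrite exchange_big; apply: eq_bigr => j _ /=; rewrite pairingE !mulr_sumr.
  by apply: eq_bigr => l _; ring.
have [m0 y0 _] := solution_affine_factor r0 xs; set y := ratio x in G' y0 *.
set m := monomial_value x (a r1) in m0.
set p := monomial_value x (a r0) * pairing a th r0; set q := m * pairing a th r1.
have Vj j : monomial_value x (a j) * pairing a th j = gauge j * (alp j * p + bet j * q).
  exact: (kernel_equation (fun j => monomial_value x (a j) * pairing a th j)).1.
pose c := q / m; pose p' := p / m - c * y.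
have P j : pairing a th j = c + p' * (alp j / affine_factor b blk K L j y).
  have [_ _ e] := solution_affine_factor j xs; have := Vj j; rewrite e -/y -/m => E1.
  have l0 := affine_factor_gt0 b blk K L j y0; have g0 := gauge_gt0 j.
  have : m * affine_factor b blk K L j y * pairing a th j = alp j * p + bet j * q.
    apply: (mulfI (lt0r_neq0 g0)); rewrite -E1; ring.
  move=> E2; apply: (mulfI (lt0r_neq0 (mulr_gt0 m0 l0))); rewrite E2 /p' /c.
  transitivity (q * affine_factor b blk K L j y + (p - q * y) * alp j); first by rewrite /affine_factor; ring.
  by field; rewrite !gt_eqF.
have p'0 : p' = 0.
  have E1 : \sum_j br j * pairing a th j = c * \sum_j br j + p' * logsum_deriv b blk K L y.
    rewrite /logsum_deriv !mulr_sumr -big_split; apply: eq_bigr => j _ /=.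
    by rewrite P mulrDr [br j * c]mulrC [br j * (p' * _)]mulrCA.
  move: E1; rewrite sum_affine_relation_pairing sum_affine_relationR mulr0 add0r => /esym/eqP.
  by rewrite mulf_eq0 (negbTE G') orbF => /eqP.
by apply: (affine_span b0 (c := c)) => j; rewrite P p'0 mul0r addr0.
Qed.

End Deformation.
End Construction.

(** * Decorated mixed cells *)

Section Cells.
Variables (R : realType) (n : nat) (a : 'I_n.+2 -> 'rV[int]_n).
Local Notation b := (affine_relation a).
Local Notation br j := ((b j)%:~R : R).
Hypothesis b0 : forall j, b j != 0.
Variables (blk : 'I_n.+2 -> nat) (K : nat).
Hypothesis blkK : forall j, (blk j <= K.+1)%N.
Variables (r0 : 'I_n.+2) (r1' : 'I_n.+1).
Local Notation r1 := (lift r0 r1').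
Local Notation rho i := (lift r0 (lift r1' i)).
Hypothesis blk_r0 : blk r0 = 0%N.
Hypothesis blk_r1 : blk r1 = K.+1.
Variable kappa : R.
Local Notation C := (coef_matrix R blk K r0 r1').
Local Notation H := (height_matrix a blk K r0 r1' kappa).
Local Notation mus := (prefix_sum b blk).
Local Notation D l := (breakpoint R b l).
Local Notation N2 := (\sum_i br (rho i) ^+ 2).
Variable kap : R.
Hypothesis kapE : kap = kappa * N2.
Local Notation trop := (tropical b blk K kap).
Local Notation term j w := (tropical_term b blk K j w).

(** At a point [w] between [D lam] and [D lam.+1], the height of the first root is
the smaller one exactly in the rows whose block is at most [lam]. *)
Definition root_of (lam : nat) (i : 'I_n) : 'I_n.+2 := if (blk (rho i) <= lam)%N then r0 else r1.

Definition cell_of (lam : nat) : cell_label n := [ffun i => [set rho i; root_of lam i]%SET].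

Lemma root_ofP lam i : (root_of lam i == r0) || (root_of lam i == r1).
Proof. by rewrite /root_of; case: ifP; rewrite eqxx ?orbT. Qed.

Lemma rho_root lam i : rho i != root_of lam i.
Proof. by rewrite /root_of; case: ifP => _; rewrite ?rho_r0 ?rho_r1. Qed.

(** The tree of the first root in the cell [lam] consists of the blocks up to [lam];
the second root lies in the last block and is never counted. *)
Lemma prefix_sum_forest lam : (lam <= K)%N -> mus lam = b r0 + \sum_(i | root_of lam i == r0) b (rho i).
Proof.
move=> lK; rewrite /prefix_sum big_mkcond (sum_roots r0 r1') blk_r0 blk_r1 /= leqNgt ltnS lK /= addr0.
congr (_ + _); rewrite [RHS]big_mkcond; apply: eq_bigr => i _.
by rewrite /root_of; case: ifP => _; rewrite ?eqxx ?r1_r0.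
Qed.

Lemma det_cell lam : (lam <= K)%N ->
  `|\det (edges (real_point a R) (fun i => rho i) (root_of lam))| = `|(mus lam)%:~R : R|.
Proof.
move=> lK; rewrite prefix_sum_forest//.
have -> : edges (real_point a R) (fun i => rho i) (root_of lam) =
    map_mx intr (\matrix_i (a (rho i) - a (root_of lam i))).
  by apply/matrixP => i l; rewrite !mxE rmorphB.
rewrite det_map_mx -!intr_norm; congr (_%:~R).
by rewrite -!abszE; congr Posz; exact: (det_forest a (root_ofP lam)).
Qed.

Lemma minkowski_cell lam : minkowski_points R a (cell_of lam) =
  [seq \sum_i real_point a R (p i)
    | p : {ffun 'I_n -> 'I_n.+2} in family (fun i => mem [set rho i; root_of lam i]%SET)].
Proof.
rewrite /minkowski_points (_ : (fun i => mem (cell_of lam i)) = (fun i => mem [set rho i; root_of lam i]%SET))//.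
by apply/funext => i; rewrite ffunE.
Qed.

Lemma cell_of_volume lam : (lam <= K)%N -> mus lam != 0 ->
  cell_volume R a (cell_of lam) = (`|(mus lam)%:~R : R|)%:E.
Proof.
move=> lK n0; rewrite /cell_volume minkowski_cell.
rewrite (convex_hull_parallelepiped (real_point a R) (rho_root lam)) volume_affine_image.
- by rewrite volume_unit_cube mule1 det_cell.
- by rewrite unitmxE unitfE -normr_eq0 det_cell// normr_eq0 intr_eq0.
- exact: measurable_cube.
- by move=> s x x01 i; rewrite mxE.
Qed.

Lemma cell_of_affdim lam : (lam <= K)%N -> mus lam != 0 ->
  affdim (minkowski_points R a (cell_of lam)) = n.
Proof.
move=> lK n0; rewrite minkowski_cell; apply: affdim_vertices.
by rewrite unitmxE unitfE -normr_eq0 det_cell// normr_eq0 intr_eq0.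
Qed.

Lemma height_rho z i : lifted_height a H z i (rho i) = pairing a z (rho i) - kappa * br (rho i).
Proof. by rewrite /lifted_height [H i _]mxE eqxx. Qed.

Lemma height_r0 z i : lifted_height a H z i r0 = pairing a z r0.
Proof. by rewrite /lifted_height [H i _]mxE r0_rho r0_r1 addr0. Qed.

Lemma height_r1 z i : lifted_height a H z i r1 =
  pairing a z r1 - (if blk (rho i) != K.+1 then D (blk (rho i)) else 0).
Proof. by rewrite /lifted_height [H i _]mxE r1_rho eqxx /=; case: ifP => _; rewrite ?oppr0. Qed.

Lemma support_rho i : rho i \in support_set C i.
Proof. by rewrite inE coef_rho oppr_eq0 oner_eq0. Qed.
Lemma support_r0 i : (r0 \in support_set C i) = (blk (rho i) != K.+1).
Proof. by rewrite inE coef_r0 pnatr_eq0 eqb0 negbK. Qed.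
Lemma support_r1 i : (r1 \in support_set C i) = (blk (rho i) != 0%N).
Proof. by rewrite inE coef_r1 pnatr_eq0 eqb0 negbK. Qed.
Lemma support_other i l : l != i -> (rho l \in support_set C i) = false.
Proof. by move=> li; rewrite inE coef_other// eqxx. Qed.

Lemma minimizersE z i j : (j \in minimizers a C H z i) =
  [&& j \in support_set C i, lifted_height a H z i j <= lifted_height a H z i (rho i),
     (blk (rho i) != K.+1) ==> (lifted_height a H z i j <= lifted_height a H z i r0) &
     (blk (rho i) != 0%N) ==> (lifted_height a H z i j <= lifted_height a H z i r1)].
Proof.
rewrite inE -support_r0 -support_r1; congr andb.
apply/forallP/and3P => [h|[h1 h2 h3] k].
  split; [|exact: (h r0)|exact: (h r1)].
  by have := h (rho i); rewrite support_rho.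
have [->|->|[l ->]] := nonroot_cases r0 r1' k; rewrite ?h2 ?h3//.
have [->|li] := eqVneq l i; first by rewrite h1 implybT.
by rewrite support_other.
Qed.

Lemma term_cases j w : [\/ blk j = 0%N /\ term j w = w, blk j = K.+1 /\ term j w = 0 |
   [/\ blk j != 0%N, blk j != K.+1 & term j w = Num.max w (D (blk j))]].
Proof.
rewrite /tropical_term; have [->|e0] := eqVneq (blk j) 0%N; first by constructor 1.
by have [->|e1] := eqVneq (blk j) K.+1; [constructor 2|constructor 3].
Qed.

Lemma sum_terms w : \sum_j br j * term j w = br r0 * w + \sum_i br (rho i) * term (rho i) w.
Proof.
rewrite (sum_roots r0 r1') (_ : term r0 w = w); last by rewrite /tropical_term blk_r0.
by rewrite (_ : term r1 w = 0) ?mulr0 ?addr0// /tropical_term blk_r1 /= eqxx.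
Qed.

(** At a zero [w] of the tropical function, the vector
[kappa * b - tropical_term w] (with the gauge dropped at the roots) is orthogonal
to the affine relation, so it is interpolated by an affine function; its linear
part [z] gives [rho i] the smaller one of the heights of the two roots. *)
Lemma cell_from_zero lam w : (lam <= K)%N -> D lam < w < D lam.+1 -> trop w = 0 ->
  exists z, forall i, cell_of lam i = minimizers a C H z i.
Proof.
move=> lK /andP[w1 w2] T0.
(* the constant 0 at the roots reflects that their heights contain no gauge *)
pose eta j := (if (j == r0) || (j == r1) then 0 else kappa * br j) - term j w.
have [|c [z zE]] := @affine_interpolation _ a R b0 eta.
  under eq_bigr do rewrite mulrBr.
  rewrite sumrB (_ : \sum_j br j * term j w = kap); last by move/eqP: T0; rewrite subr_eq0 => /eqP.
  apply/eqP; rewrite subr_eq0 (sum_roots r0 r1') !eqxx orbT !mulr0 !add0r kapE mulr_sumr; apply/eqP.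
  by apply: eq_bigr => i _; rewrite rho_r0 rho_r1 /=; ring.
have zE' j : pairing a z j = eta j - c by rewrite zE [c + _]addrC addrK.
have t0 : term r0 w = w by rewrite /tropical_term blk_r0.
have t1 : term r1 w = 0 by rewrite /tropical_term blk_r1 /= eqxx.
have hr i : lifted_height a H z i (rho i) = - c - term (rho i) w.
  by rewrite height_rho zE' /eta rho_r0 rho_r1 /=; ring.
have h0 i : lifted_height a H z i r0 = - c - w.
  by rewrite height_r0 zE' /eta eqxx /= t0; ring.
have h1 i : lifted_height a H z i r1 = - c - (if blk (rho i) != K.+1 then D (blk (rho i)) else 0).
  by rewrite height_r1 zE' /eta eqxx orbT /= t1; ring.
exists z => i; rewrite ffunE; apply/setP => j; rewrite minimizersE.
have [->|->|[l ->]] := nonroot_cases r0 r1' j; last first.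
- have [->|li] := eqVneq l i; last first.
    by rewrite support_other// !inE (inj_eq (@rho_inj n r0 r1')) (negbTE li) /root_of; case: ifP; rewrite ?rho_r0 ?rho_r1.
  rewrite !inE eqxx /= coef_rho oppr_eq0 oner_eq0 /= lexx hr h0 h1 !lerD2l !lerN2 /=.
  case: (term_cases (rho i) w) => [[-> ->]|[-> ->]|[e0 e1 ->]].
  + by rewrite /= ?lexx ?implybT.
  + by rewrite ?eqxx /= ?lexx ?implybT.
  + by rewrite e1 e0 /= !le_max !lexx orbT.
- rewrite support_r1 !inE r1_rho /= hr h0 h1 !lerD2l !lerN2 /root_of.
  case: (term_cases (rho i) w) => [[-> ->]|[-> ->]|[e0 e1 ->]].
  + by rewrite /= r1_r0.
  + by rewrite leqNgt ltnS lK /= !eqxx /= lexx.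
  + rewrite e0 e1 /= lexx andbT ge_max lexx andbT.
    have [bl|bl] := leqP (blk (rho i)) lam.
      have wD : (w <= D (blk (rho i))) = false.
        by apply/negbTE; rewrite -ltNge (le_lt_trans _ w1)// breakpoint_mono.
      by rewrite r1_r0 wD.
    have wD : w <= D (blk (rho i)) by rewrite (le_trans (ltW w2))// breakpoint_mono.
    by rewrite eqxx wD.
- rewrite support_r0 !inE r0_rho /= hr h0 h1 !lerD2l !lerN2 /root_of.
  case: (term_cases (rho i) w) => [[-> ->]|[-> ->]|[e0 e1 ->]].
  + by rewrite /= eqxx lexx.
  + by rewrite leqNgt ltnS lK /= eqxx /= r0_r1.
  + rewrite e0 e1 /= lexx /= ge_max lexx /= andbb.
    have [bl|bl] := leqP (blk (rho i)) lam.
      have wD : D (blk (rho i)) <= w by rewrite (le_trans _ (ltW w1))// breakpoint_mono.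
      by rewrite eqxx wD.
    have wD : (D (blk (rho i)) <= w) = false.
      by apply/negbTE; rewrite -ltNge (lt_le_trans w2)// breakpoint_mono.
    by rewrite r0_r1 wD.
Qed.

(** The coefficients at the two roots are nonnegative, so a decorated pair must
contain [rho i]. *)
Lemma decorated_support z i : #|minimizers a C H z i| = 2 ->
  {in minimizers a C H z i &, forall j j', j != j' -> C i j * C i j' < 0} ->
  rho i \in minimizers a C H z i /\
  (minimizers a C H z i = [set rho i; r0]%SET \/ minimizers a C H z i = [set rho i; r1]%SET).
Proof.
set s := minimizers a C H z i => /eqP/cards2P[x [y [xy sE]]] neg.
have sub j : j \in s -> [\/ j = rho i, j = r0 | j = r1].
  rewrite minimizersE => /andP[js _]; have [->|->|[l e]] := nonroot_cases r0 r1' j.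
  - by constructor 2.
  - by constructor 3.
  - constructor 1; rewrite e in js *; have [->//|li] := eqVneq l i.
    by rewrite support_other in js.
have xs : x \in s by rewrite sE !inE eqxx.
have ys : y \in s by rewrite sE !inE eqxx orbT.
have := neg x y xs ys xy.
case: (sub x xs) => [xE|xE|xE]; case: (sub y ys) => [yE|yE|yE]; rewrite xE yE in xy xs ys sE *;
  rewrite ?eqxx in xy => //; rewrite ?coef_r0 ?coef_r1 => h.
- by rewrite sE; split; [rewrite !inE eqxx|left].
- by rewrite sE; split; [rewrite !inE eqxx|right].
- by rewrite sE finset.setUC; split; [rewrite !inE eqxx|left].
- by move: h; rewrite ltNge mulr_ge0// ler0n.
- by rewrite sE finset.setUC; split; [rewrite !inE eqxx|right].
- by move: h; rewrite ltNge mulr_ge0// ler0n.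
Qed.

(** If [z] selects a decorated mixed cell, the height of [rho i] equals the
smaller of the two root heights, so the pairings of [z] with the points are the
tropical terms up to a constant; orthogonality to the affine relation then says
that the tropical function vanishes at [w]. *)
Lemma zero_from_cell sigma : decorated_mixed_cell a C H sigma ->
  exists w, trop w = 0 /\ forall i, [\/ sigma i = [set rho i; r0]%SET /\ (blk (rho i) = 0%N \/ [/\ blk (rho i) != K.+1 & D (blk (rho i)) < w]) |
     sigma i = [set rho i; r1]%SET /\ (blk (rho i) = K.+1 \/ [/\ blk (rho i) != 0%N & w < D (blk (rho i))])].
Proof.
move=> [[[z zE] _] mix dec].
pose w := pairing a z r1 - pairing a z r0; exists w.
have key i : pairing a z (rho i) = kappa * br (rho i) + pairing a z r1 - term (rho i) w /\
   [\/ sigma i = [set rho i; r0]%SET /\ (blk (rho i) = 0%N \/ [/\ blk (rho i) != K.+1 & D (blk (rho i)) < w]) |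
     sigma i = [set rho i; r1]%SET /\ (blk (rho i) = K.+1 \/ [/\ blk (rho i) != 0%N & w < D (blk (rho i))])].
  have [|rs sE] := @decorated_support z i (etrans (congr1 (fun s : {set _} => #|s|) (esym (zE i))) (mix i)).
    by move=> j j'; rewrite -!zE; exact: dec.
  have := rs; rewrite minimizersE => /and4P[_ _ q0 q1].
  have hr := height_rho z i; have h0 := height_r0 z i; have h1 := height_r1 z i.
  case: sE => sE.
  - have r0s : r0 \in minimizers a C H z i by rewrite sE !inE eqxx orbT.
    have r1s : r1 \notin minimizers a C H z i by rewrite sE !inE r1_rho r1_r0.
    move: (r0s); rewrite minimizersE support_r0 => /and4P[e1 p0 _ p1].
    rewrite e1 /= in q0; have E : lifted_height a H z i (rho i) = lifted_height a H z i r0.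
      by apply/eqP; rewrite eq_le q0 p0.
    case: (term_cases (rho i) w) => [[e te]|[e te]|[e0 _ te]]; last 2 first.
    + by rewrite e eqxx in e1.
    + rewrite e0 /= h0 h1 e1 in p1.
      have lt : D (blk (rho i)) < w.
        rewrite lt_neqAle; apply/andP; split; last by rewrite /w; lra.
        apply: contraNneq r1s => Dw; rewrite minimizersE support_r1 e0 e1 /= lexx andbT E h1 h0 e1.
        by rewrite Dw /w; apply/andP; split; lra.
      split; last by constructor 1; rewrite zE sE; split => //; right.
      by rewrite te max_l ?(ltW lt)//; move: E; rewrite hr h0 /w; lra.
    + split; last by constructor 1; rewrite zE sE; split => //; left.
      by rewrite te; move: E; rewrite hr h0 /w; lra.
  - have r1s : r1 \in minimizers a C H z i by rewrite sE !inE eqxx orbT.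
    have r0s : r0 \notin minimizers a C H z i by rewrite sE !inE r0_rho r0_r1.
    move: (r1s); rewrite minimizersE support_r1 => /and4P[e0 p0 p1 _].
    rewrite e0 /= in q1; have E : lifted_height a H z i (rho i) = lifted_height a H z i r1.
      by apply/eqP; rewrite eq_le q1 p0.
    case: (term_cases (rho i) w) => [[e te]|[e te]|[_ e1 te]].
    + by rewrite e in e0.
    + split; last by constructor 2; rewrite zE sE; split => //; left.
      by rewrite te; move: E; rewrite hr h1 e eqxx /=; lra.
    + rewrite e1 /= h0 h1 e1 in p1.
      have lt : w < D (blk (rho i)).
        rewrite lt_neqAle; apply/andP; split; last by rewrite /w; lra.
        apply: contraNneq r0s => Dw; rewrite minimizersE support_r0 e0 e1 /= lexx E h1 h0 e1 /=.
        by rewrite -Dw /w; apply/andP; split; lra.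
      split; last by constructor 2; rewrite zE sE; split => //; right.
      by rewrite te max_r ?(ltW lt)//; move: E; rewrite hr h1 e1; lra.
split; last by move=> i; exact: (key i).2.
rewrite /tropical sum_terms kapE mulr_sumr.
have S0 := sum_affine_relation_pairing a z; have Sb := sum_affine_relationR a R.
rewrite (sum_roots r0 r1') in S0; rewrite (sum_roots r0 r1') in Sb.
have E : \sum_i br (rho i) * pairing a z (rho i) =
   \sum_i kappa * br (rho i) ^+ 2 + (\sum_i br (rho i)) * pairing a z r1 - \sum_i br (rho i) * term (rho i) w.
  rewrite mulr_suml -big_split -sumrB; apply: eq_bigr => i _ /=.
  by rewrite (key i).1; ring.
have X : \sum_i br (rho i) = - (br r0 + br r1) by lra.
rewrite E X in S0; rewrite /w.
set T := \sum_i br (rho i) * term _ _ in S0 *. set T' := \sum_i kappa * _ in S0 *.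
lra.
Qed.

Hypothesis mass1 : 1 <= mass R b.
Variable l0 : nat.
Hypothesis l0K : (l0 <= K)%N.
Hypothesis mul0 : mus l0 != 0.
Hypothesis l0min : forall l, (l < l0)%N -> mus l = 0.
Hypothesis kap0 : trop (D l0.+1 - 1) = 0.

Let muS l (_ : (l <= K)%N) := prefix_sum_le R b blk l.

(** The zeros of the tropical function lie one in each crossing piece, and the
label of the cell only depends on the piece. *)
Lemma decorated_cells sigma : decorated_mixed_cell a C H sigma <->
  exists lam, [/\ (lam <= K)%N, crossing mus lam & sigma = cell_of lam].
Proof.
split=> [/zero_from_cell[w [T0 sE]]|[lam [lK cl ->]]].
  have [lam lK pw] := piece_exists b K w.
  have [|cl /andP[w1 w2]] := small_value mass1 muS (breakpoint_ge1 R b) (breakpointS R b) (tropical_piece blkK kap) l0K mul0 l0min kap0 lK pw.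
    by rewrite T0 normr0.
  have d0 : 0 < (2 * mass R b)^-1 by exact: del_gt0.
  exists lam; split => //; apply/ffunP => i; rewrite ffunE.
  case: (sE i) => [[-> h]|[-> h]]; rewrite /root_of.
    case: h => [->//|[_ Dw]].
    suff -> : (blk (rho i) <= lam)%N by [].
    rewrite leqNgt; apply/negP => /(breakpoint_mono R b); lra.
  suff -> : (blk (rho i) <= lam)%N = false by [].
  apply/negbTE; rewrite -ltnNge; case: h => [->//|[_ Dw]].
  rewrite ltnNge; apply/negP => /(breakpoint_mono R b); lra.
have n0 : mus lam != 0 by case/andP: cl.
have [w [ww T0]] := crossing_zero mass1 muS (breakpoint_ge1 R b) (breakpointS R b) (tropical_piece blkK kap) l0K mul0 l0min kap0 lK cl.
split.
- by split; [exact: cell_from_zero ww T0|exact: cell_of_affdim].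
- by move=> i; rewrite ffunE cards2 rho_root.
- have pos i : C i (root_of lam i) = 1.
    rewrite /root_of; case: ifP => h; rewrite ?coef_r0 ?coef_r1.
      by rewrite (_ : blk (rho i) != K.+1)// neq_ltn ltnS (leq_trans h lK).
    by rewrite (_ : blk (rho i) != 0%N)//; apply: contraFneq h => ->.
  move=> i j j'; rewrite ffunE !inE => /orP[/eqP->|/eqP->] /orP[/eqP->|/eqP->]; rewrite ?eqxx// => _.
    by rewrite coef_rho pos mulr1 ltrN10.
  by rewrite coef_rho pos mul1r ltrN10.
Qed.

Lemma cell_of_inj : (forall l, (l <= K.+1)%N -> exists j, blk j = l) ->
  forall lam lam', (lam <= K)%N -> (lam' <= K)%N -> cell_of lam = cell_of lam' -> lam = lam'.
Proof.
move=> surj.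
have H lam lam' : (lam < lam' <= K)%N -> cell_of lam != cell_of lam'.
  move=> /andP[ll lK]; apply/eqP => /ffunP E.
  have [j jl] := surj lam' (leqW lK).
  have [e|e|[i e]] := nonroot_cases r0 r1' j.
  - by move: ll; rewrite -jl e blk_r0.
  - by move: lK; rewrite -jl e blk_r1 ltnn.
  have := E i; rewrite !ffunE /root_of -e jl leqnn leqNgt ll /= => /setP/(_ r0).
  by rewrite e !inE eqxx orbT r0_rho r0_r1.
move=> lam lam' lK lK' E; apply/eqP; case: ltngtP => // ll.
  by have := H lam lam'; rewrite ll lK' E eqxx => /(_ isT).
by have := H lam' lam; rewrite ll lK E eqxx => /(_ isT).
Qed.

End Cells.

(** * Blocks, partial sums and the system realizing them *)

(** A bijection with a transversal numbers the blocks. *)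
Lemma transversal_blocks (T : finType) (Kp : {set {set T}}) (K : {set T}) k (sbar : 'I_k -> T) :
  finset.partition Kp [set: T]%SET -> is_transversal K Kp [set: T]%SET ->
  injective sbar -> (sbar @: [set: 'I_k])%SET = K ->
  exists blk : T -> 'I_k, [/\ forall i, blk (sbar i) = i &
    forall x y, (y \in finset.pblock Kp x) = (blk x == blk y)].
Proof.
move=> partK trK sinj sK.
have /and3P[/eqP covK trivK K0] := partK.
have cov x : x \in finset.cover Kp by rewrite covK inE.
have pinj := pblock_inj trK; have pimg := pblock_transversal trK.
have inK i : sbar i \in K by rewrite -sK imset_f.
have ex x : exists i, finset.pblock Kp x = finset.pblock Kp (sbar i).
  have : finset.pblock Kp x \in finset.pblock Kp @: K by rewrite pimg pblock_mem.
  move=> /imsetP[y yK ->]; rewrite -sK in yK; have /imsetP[i _ ->] := yK.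
  by exists i.
have [blk blkP] := choice ex; exists blk; split.
  by move=> i; apply/sinj/(pinj _ _ (inK _) (inK _)).
move=> x y; rewrite -eq_pblock//.
apply/eqP/eqP => [E|E]; last by rewrite (blkP x) (blkP y) E.
by apply/sinj/(pinj _ _ (inK _) (inK _)); rewrite -blkP -blkP.
Qed.

Lemma nth_partial_sums n k (b : 'I_n.+2 -> int) (Kp : {set {set 'I_n.+2}})
    (sbar : 'I_k -> 'I_n.+2) (blk : 'I_n.+2 -> 'I_k) :
  (forall i, blk (sbar i) = i) ->
  (forall x y, (y \in finset.pblock Kp x) = (blk x == blk y)) ->
  \sum_j b j = 0 ->
  nth 0 (partial_sums b Kp sbar) =1 prefix_sum b (fun j => blk j).
Proof.
move=> bs bp sb l; have [lk|kl] := ltnP l k.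
  rewrite /partial_sums (nth_map (Ordinal lk)) ?size_enum_ord// /prefix_sum.
  rewrite (nth_ord_enum _ (Ordinal lk)); apply: eq_bigl => j.
  apply/bigcupP/idP => [[i il]|jl].
    by rewrite bp bs => /eqP<-.
  by exists (blk j) => //; rewrite bp bs.
rewrite nth_default; last by rewrite /partial_sums size_map size_enum_ord.
transitivity (\sum_j b j); first by rewrite sb.
rewrite /prefix_sum; apply: eq_bigl => j; apply/esym.
by rewrite (leq_trans (ltnW (ltn_ord _)) kl).
Qed.

(** As every block is a single index, the [b j] are the differences of consecutive
partial sums.  These alternate in sign, so [`|m_l - m_(l-1)| = `|m_l| + `|m_(l-1)|] and
each [`|m_l|] counts twice in the sum of the [`|b j|]; so do the positive [b j], since
[b] sums to zero. *)
Lemma alternating_slopes n (b : 'I_n.+2 -> int) (blk : 'I_n.+2 -> nat) :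
  (forall j, (blk j <= n.+1)%N) -> (forall l, (l <= n.+1)%N -> exists j, blk j = l) ->
  \sum_j b j = 0 -> (forall l, (l <= n)%N -> crossing (prefix_sum b blk) l) ->
  \sum_(l < n.+1) `|prefix_sum b blk l| = \sum_(j | 0 < b j) b j.
Proof.
move=> blkn surj sb cr.
have /choice[h hP] : forall l : 'I_n.+2, exists j, blk j = l by move=> l; apply: surj; rewrite -ltnS.
have hinj : injective h by move=> l l' e; apply: ord_inj; rewrite -(hP l) e hP.
pose m := prefix_sum b blk; pose pre l := if l is l'.+1 then m l' else 0.
have mE l : m l = \sum_(i < n.+2 | (i <= l)%N) b (h i).
  by rewrite /m /prefix_sum (reindex_inj hinj); apply: eq_bigl => i; rewrite hP.
have bE (l : 'I_n.+2) : b (h l) = m l - pre l.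
  case: l => [[|l] ln]; rewrite /pre /=.
    rewrite subr0 mE (big_pred1 (Ordinal ln))// => i.
    by rewrite leqn0; apply/eqP/eqP => [e|->//]; exact: val_inj.
  rewrite !mE (bigD1 (Ordinal ln))//=.
  rewrite (eq_bigl (fun i : 'I_n.+2 => (i <= l)%N)) ?addrK// => i.
  rewrite -(inj_eq val_inj) /= leq_eqVlt ltnS; case: (eqVneq (i : nat) l.+1) => [->|]; rewrite ?andbF ?andbT ?ltnn//=.
have mlast : m n.+1 = 0.
  transitivity (\sum_j b j); last exact: sb.
  by apply: eq_bigl => j; rewrite blkn.
have absE (l : 'I_n.+2) : `|b (h l)| = `|m l| + `|pre l|.
  rewrite bE; case: l => [[|l] ln] /=; first by rewrite subr0 normr0 addr0.
  have cl : crossing m l by apply: cr; rewrite -ltnS.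
  move: (ln); rewrite ltnS leq_eqVlt => /predU1P[[e]|ln'].
    have -> : m l.+1 = 0 by rewrite e mlast.
    by rewrite sub0r normrN normr0 add0r.
  have cl' : crossing m l.+1 by apply: cr; rewrite -ltnS.
  have m0 : m l != 0 by case/andP: cl.
  have m1 : m l.+1 != 0 by case/andP: cl'.
  have : m l * m l.+1 < 0.
    by case/andP: cl' => _; rewrite sgr_neq_lt0//= (negbTE m0).
  move: m0; rewrite neq_lt => /orP[h0|h0].
    by rewrite nmulr_rlt0// => h1; rewrite ger0_norm ?(ltr0_norm h0) ?(gtr0_norm h1)//; lia.
  by rewrite pmulr_rlt0// => h1; rewrite ler0_norm ?(gtr0_norm h0) ?(ltr0_norm h1)//; lia.
have tot : \sum_j `|b j| = (\sum_(l < n.+1) `|m l|) *+ 2.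
  rewrite (reindex_inj hinj) /=; under eq_bigr do rewrite absE.
  rewrite big_split /= [X in X + _]big_ord_recr [X in _ + X]big_ord_recl /= mlast !normr0 addr0 add0r mulr2n.
  by congr (_ + _); apply: eq_bigr => l _; rewrite /pre /= /bump.
have tot2 : \sum_j `|b j| = (\sum_(j | 0 < b j) b j) *+ 2.
  transitivity (\sum_j `|b j| + \sum_j b j); first by rewrite sb addr0.
  rewrite mulr2n -!big_split /= [RHS]big_mkcond /=.
  by apply: eq_bigr => j _; case: ltP => h0; [rewrite gtr0_norm|rewrite ler0_norm// addNr].
by move: tot; rewrite tot2 !mulr2n /m; lia.
Qed.

(** There are at most [n.+2] blocks, hence at most [n.+1] crossings; if there are
[n.+1] of them, every block is a single index and every position is a crossing. *)
Lemma crossing_slopes_sum n m K (b : 'I_n.+2 -> int) (blk : 'I_n.+2 -> nat) (ell : nat -> nat) :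
  (forall j, (blk j <= K.+1)%N) -> (forall l, (l <= K.+1)%N -> exists j, blk j = l) ->
  \sum_j b j = 0 ->
  (forall s, (s <= m)%N -> (ell s <= K)%N /\ crossing (prefix_sum b blk) (ell s)) ->
  (forall s s', (s <= m)%N -> (s' <= m)%N -> ell s = ell s' -> s = s') ->
  m = n ->
  \sum_(s < m.+1) `|prefix_sum b blk (ell s)| = \sum_(j | 0 < b j) b j.
Proof.
move=> blkK surj sb ellK ellinj mn; subst m.
pose f (s : 'I_n.+1) : 'I_K.+1 := inord (ell s).
have fE s : f s = ell s :> nat by rewrite inordK// ltnS (ellK s _).1// -ltnS.
have finj : injective f.
  move=> s s' e; apply/ord_inj/ellinj; [rewrite -ltnS|rewrite -ltnS|by rewrite -!fE e] => //.
have /choice[h hP] : forall l : 'I_K.+2, exists j, blk j = l.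
  by move=> l; apply: surj; rewrite -ltnS.
have hinj : injective h by move=> l l' e; apply: ord_inj; rewrite -(hP l) e hP.
have KE : K = n.
  by move: (leq_card h hinj) (leq_card f finj); rewrite !card_ord; lia.
subst K; rewrite -(alternating_slopes blkK surj sb); last first.
  move=> l ln; have /codomP[s sE] : Ordinal (ln : (l < n.+1)%N) \in codom f.
    by rewrite (inj_card_onto finj)// !card_ord.
  have <- : ell s = l by rewrite -fE -sE.
  by apply: (ellK s _).2; rewrite -ltnS.
by rewrite [RHS](reindex_inj finj); apply: eq_bigr => s _; rewrite fE.
Qed.

Theorem theorem3p4 (R : realType) (n : nat) (a : 'I_n.+2 -> 'rV[int]_n)
    (k : nat) (Kp : {set {set 'I_n.+2}}) (K : {set 'I_n.+2})
    (sbar : 'I_k -> 'I_n.+2) :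
  circuit a R ->
  finset.partition Kp [set: 'I_n.+2]%SET -> #|Kp| = k ->
  is_transversal K Kp [set: 'I_n.+2]%SET ->
  injective sbar -> (sbar @: [set: 'I_k])%SET = K ->
  let mu := partial_sums (affine_relation a) Kp sbar in
  let m := sgnvar mu in
  let ell := sign_change_index mu in
  ~~ all (fun x => x == 0) mu ->
  exists C H : 'M[R]_(n, n.+2),
    [/\ exists Z : 'I_m.+1 -> cell_label n,
          [/\ injective Z,
              forall sigma : cell_label n,
                decorated_mixed_cell a C H sigma <-> exists s, Z s = sigma,
              forall s : 'I_m.+1,
                cell_volume R a (Z s) = ((`|mu`_(ell s)|)%:~R)%:E &
              m = n ->
                (\sum_s cell_volume R a (Z s)
                   = (n`!%:R)%:E * volume (convex_hull (codom (real_point a R))))%E],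
        forall t : R, 0 < t < 1 ->
          [/\ \rank (viro_matrix C H t) = n,
              zero_in_open_cone (viro_matrix C H t) &
              strict_ordering (viro_matrix C H t) Kp sbar] &
        exists2 t0 : R, 0 < t0 &
          forall t : R, 0 < t < t0 ->
            num_positive_solutions a (viro_matrix C H t) (1 + m)%N].
Proof.
move=> [ainj adim b0] partK cardK trK sinj sK mus m ell mus0.
have [blk [bs bp]] := transversal_blocks partK trK sinj sK.
clear trK sK K cardK.
have sb := sum_affine_relation a.
pose bk j := nat_of_ord (blk j).
have musE : nth 0 mus =1 prefix_sum (affine_relation a) bk by exact: nth_partial_sums.
have smus : size mus = k by rewrite size_map size_enum_ord.
clearbody mus.
have mu_last l : (k <= l.+1)%N -> prefix_sum (affine_relation a) bk l = 0.
  move=> kl; transitivity (\sum_j affine_relation a j); last exact: sb.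
  by apply: eq_bigl => j; rewrite -ltnS (leq_trans (ltn_ord _) kl).
have n0 : (0 < n)%N.
  clear -ainj; case: n a ainj => // a ainj.
  have : (ord0 : 'I_2) = lift ord0 ord0 by apply: ainj; rewrite [LHS]thinmx0 [RHS]thinmx0.
  by move=> /(congr1 val).
have [ellP ellinj ellsurj] := sign_change_index_bij mus0; rewrite -/m -/ell in ellP ellinj ellsurj.
have cE : crossing (nth 0 mus) =1 crossing (prefix_sum (affine_relation a) bk) by move=> l; rewrite (funext musE).
have nz l : crossing (prefix_sum (affine_relation a) bk) l -> prefix_sum (affine_relation a) bk l != 0 by case/andP.
(* a crossing exists and the last partial sum is zero, so there are at least
   two blocks *)
have [K kE] : exists K, k = K.+2.
  have /andP[e1 e2] := ellP 0%N isT; rewrite smus in e1; rewrite cE in e2.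
  have := mu_last (ell 0%N); have := nz _ e2; case: (k) e1 => [//|[|K] e1].
    by move=> /eqP h1 h2; exfalso; apply/h1/h2.
  by exists K.
rewrite kE in smus; subst k.
have bkK j : (bk j <= K.+1)%N by rewrite -ltnS; exact: (ltn_ord (blk j)).
have ellK s : (s <= m)%N -> (ell s <= K)%N /\ crossing (prefix_sum (affine_relation a) bk) (ell s).
  move=> /ellP/andP[e1 e2]; rewrite cE in e2; split => //; rewrite smus in e1.
  by rewrite leqNgt; apply/negP => h; have := nz _ e2; rewrite mu_last ?eqxx.
have ell_onto l : (l <= K)%N -> crossing (prefix_sum (affine_relation a) bk) l -> exists2 s, (s <= m)%N & ell s = l.
  by move=> lK cl; apply: ellsurj; rewrite ?cE// smus ltnS leqW.
pose r0 := sbar ord0.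
have br0 : bk r0 = 0%N by rewrite /bk bs.
have [r1' r1E] : exists r1', sbar ord_max = lift r0 r1'.
  case: (unliftP r0 (sbar ord_max)) => [r1' ->|e]; first by exists r1'.
  by have /(congr1 val) := sinj _ _ e.
have br1 : bk (lift r0 r1') = K.+1 by rewrite -r1E /bk bs.
have surj l : (l <= K.+1)%N -> exists j, bk j = l.
  by move=> lK; exists (sbar (Ordinal (lK : (l < K.+2)%N))); rewrite /bk bs.
pose l0 := ell 0%N.
have [l0K cl0] := ellK 0%N isT.
have l0min l : (l < l0)%N -> prefix_sum (affine_relation a) bk l = 0.
  by move=> /(before_find 0)/negbT; rewrite negbK -musE => /eqP.
have mass1 : 1 <= mass R (affine_relation a).
  rewrite /mass (bigD1 r0)//=; apply: (@le_trans _ _ `|((affine_relation a r0)%:~R : R)|).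
    by rewrite -intr_norm ler1z -gtz0_ge1 normr_gt0.
  by rewrite lerDl sumr_ge0.
pose kap := tropical (affine_relation a) bk K 0 (breakpoint R (affine_relation a) l0.+1 - 1).
pose N2 : R := \sum_i ((affine_relation a (lift r0 (lift r1' i)))%:~R : R) ^+ 2.
have N2p : N2 != 0.
  rewrite gt_eqF// /N2 (bigD1 (Ordinal n0))//= ltr_wpDr ?sumr_ge0// => [i _|].
    exact: sqr_ge0.
  by rewrite exprn_even_gt0//= intr_eq0.
pose kappa := kap / N2.
have kapE : kap = kappa * N2 by rewrite /kappa divfK.
have kap0 : tropical (affine_relation a) bk K kap (breakpoint R (affine_relation a) l0.+1 - 1) = 0.
  by rewrite /kap /tropical subr0 subrr.
pose C := coef_matrix R bk K r0 r1'; pose H := height_matrix a bk K r0 r1' kappa.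
exists C, H; split.
- exists (fun s => cell_of bk r0 r1' (ell s)); split.
  + move=> s s' e; apply: ord_inj; apply: ellinj; [by rewrite inE -ltnS|by rewrite inE -ltnS|].
    exact: (cell_of_inj br0 br1 surj (ellK s (ltn_ord s)).1 (ellK s' (ltn_ord s')).1 e).
  + move=> sigma; split.
      move=> /(decorated_cells b0 bkK br0 br1 kapE mass1 l0K (nz _ cl0) l0min kap0)[lam [lK cl ->]].
      by have [s sm <-] := ell_onto _ lK cl; exists (Ordinal (sm : (s < m.+1)%N)).
    move=> [s <-]; apply/(decorated_cells b0 bkK br0 br1 kapE mass1 l0K (nz _ cl0) l0min kap0).
    by exists (ell s); have [? ?] := ellK s (ltn_ord s).
  + move=> s; have [lK cl] := ellK s (ltn_ord s).
    by rewrite (cell_of_volume R br0 br1 lK (nz _ cl)) musE intr_norm.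
  + move=> mn; rewrite volume_circuit_hull// -EFinM mulrC divfK ?pnatr_eq0 -?lt0n ?fact_gt0//.
    rewrite -(crossing_slopes_sum bkK surj sb ellK _ mn); last first.
      by move=> s s' sm sm'; apply: ellinj.
    rewrite rmorph_sum -sumEFin; apply: eq_bigr => s _.
    have [lK cl] := ellK s (ltn_ord s).
    by rewrite (cell_of_volume R br0 br1 lK (nz _ cl)) -intr_norm.
- move=> t /andP[t0 t1]; pose L := - ln t.
  have tE : t = expR (- L) by rewrite /L opprK lnK.
  have L0 : 0 < L by rewrite oppr_gt0 ln_lt0// t0.
  split.
  + exact: (viro_rank a bk K r0 r1' kappa tE).
  + exact: (viro_cone a br0 br1 kappa tE).
  + exists (gale a bk K r0 r1' kappa L); split.
    * exact: (gale_kernel_basis a br0 br1 kappa tE).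
    * rewrite -[RHS](equivalence_partition_pblock partK); apply: eq_imset => x.
      by apply/setP => y; rewrite !inE bp (det_gale_eq0 a bkK r0 r1' kappa L0).
    * exists 1; first by left.
      move=> i j ij; rewrite mul1r; apply: (det_gale_lt a bkK r0 r1' kappa L0).
      by rewrite /bk !bs.
(* smallness of t is the bound L > 4 mass^2 on L = - ln t *)
- exists (expR (- (4 * mass R (affine_relation a) ^+ 2))); first exact: expR_gt0.
  move=> t /andP[t0 tt]; pose L := - ln t.
  have tE : t = expR (- L) by rewrite /L opprK lnK.
  have Lbig : 4 * mass R (affine_relation a) ^+ 2 < L.
    by rewrite ltrNr -[ltRHS]expRK ltr_ln ?posrE ?expR_gt0.
  have L0 : 0 < L by apply: le_lt_trans Lbig; rewrite mulr_ge0// sqr_ge0.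
  have [Y [Y1 Y2 Y3 Y4]] := logsum_zeros bkK L0 mass1 Lbig l0K (nz _ cl0) l0min kap0.
  have ex l : exists x, (l <= K)%N -> crossing (prefix_sum (affine_relation a) bk) l ->
      positive_solution a (viro_matrix C H t) x /\ ratio a r0 r1' x = Y l.
    have [lK|] := boolP (l <= K)%N; last by exists 0.
    have [cl|] := boolP (crossing (prefix_sum (affine_relation a) bk) l); last by exists 0.
    have [Yp YG] := Y1 l lK cl.
    by have [x xs xE] := zero_solution b0 br0 br1 tE kapE Yp YG; exists x.
  have [X XP] := choice ex.
  have XP' s : (s <= m)%N -> positive_solution a (viro_matrix C H t) (X (ell s)) /\ ratio a r0 r1' (X (ell s)) = Y (ell s).
    by move=> /ellK[h1 h2]; exact: XP.
  exists [seq X (ell s) | s <- iota 0 m.+1], (fun=> 1%N); split.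
  + rewrite map_inj_in_uniq ?iota_uniq// => s s'; rewrite !mem_iota !add0n !ltnS => sm sm' e.
    apply: ellinj => //; have [h1 h2] := ellK s sm; have [h1' h2'] := ellK s' sm'.
    by apply: Y2 => //; rewrite -(XP' s sm).2 -(XP' s' sm').2 e.
  + move=> x; split.
      by move=> /mapP[s]; rewrite mem_iota add0n ltnS => sm ->; exact: (XP' s sm).1.
    move=> xs; have [_ y0 _] := solution_affine_factor br0 br1 tE r0 xs.
    have [l [lK cl yl]] := Y3 _ y0 (solution_zero br0 br1 tE kapE xs).
    have [s sm se] := ell_onto l lK cl; apply/mapP; exists s; first by rewrite mem_iota add0n ltnS.
    apply: (ratio_inj b0 br0 br1 tE xs (XP' s sm).1); by rewrite (XP' s sm).2 se.
  + move=> x /mapP[s]; rewrite mem_iota add0n ltnS => sm ->; have [xs xE] := XP' s sm.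
    apply: (solution_multiplicity b0 br0 br1 tE xs); have [h1 h2] := ellK s sm.
    by have [y0 G0] := Y1 _ h1 h2; rewrite xE; exact: Y4.
  + by rewrite sum1_size size_map size_iota add1n.
Qed.
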